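(* Let $G$ be a finite simple graph and let $f:G\to\mathbb{R}^3$ be a linear embedding. If $f(G)$ has a descending direction, then $\pi_1(\mathbb{R}^3-f(G))$ is a free group, i.e. $f$ is free.
   Context: Graphs are regarded as topological 1-complexes. An embedding $f$ of a graph $G$ into $\mathbb{R}^3$ is linear if every edge is mapped onto a straight line segment; it is free if $\pi_1(\mathbb{R}^3-f(G))$ is a free group. Linear embeddings are assumed to be in general position (no three vertices of $f(G)$ are collinear). For an embedded vertex $v$ and a vertex $w$ joined to $v$ by an edge, the vector $\vec{vw}$ (from $f(v)$ to $f(w)$) is called a $G$-vector at $v$. A direction is a unit vector $\mathbf{l}\in\mathbb{R}^3$; it is generic (with respect to $f(G)$) if it is orthogonal to no $G$-vector. For a generic direction $\mathbf{l}$, a vertex $v$ is a descendant along $\mathbf{l}$ if there is a $G$-vector $\vec{vw}$ at $v$ with $\mathbf{l}\cdot\vec{vw}<0$. A generic direction $\mathbf{l}$ is a descending direction of $f(G)$ if every vertex of $G$ except exactly one is a descendant along $\mathbf{l}$. *)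

(* Defs.v *)
From HB Require Import structures.
From mathcomp Require Import all_boot all_order all_algebra.
From mathcomp Require Import reals.
Set Implicit Arguments. Unset Strict Implicit. Unset Printing Implicit Defensive.
Import Order.TTheory GRing.Theory Num.Theory.
Local Open Scope ring_scope.

Section Defs.
Variable R : realType.

Definition point := 'rV[R]_3.

Definition dot (u v : point) : R := \sum_(i < 3) u ord0 i * v ord0 i.

Definition dist2 (p q : point) : R := dot (p - q) (p - q).

Definition on_segment (p q x : point) : Prop :=
  exists t : R, 0 <= t <= 1 /\ x = (1 - t) *: p + t *: q.

Definition collinear (p q r : point) : Prop :=
  exists (a b c : R), (a, b, c) != (0, 0, 0) /\ a + b + c = 0 /\
    a *: p + b *: q + c *: r = 0.

Definition simple_graph (V : finType) (adj : rel V) : Prop :=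
  symmetric adj /\ irreflexive adj.

Definition image_graph (V : finType) (adj : rel V) (f : V -> point)
  (x : point) : Prop :=
  (exists v, x = f v) \/ (exists v w, adj v w /\ on_segment (f v) (f w) x).

Definition general_position (V : finType) (f : V -> point) : Prop :=
  forall u v w : V, u != v -> v != w -> u != w -> ~ collinear (f u) (f v) (f w).

Definition linear_embedding (V : finType) (adj : rel V) (f : V -> point) : Prop :=
  injective f /\ general_position f /\
  forall a b c d : V, adj a b -> adj c d ->
    ~ ((a == c) && (b == d) || (a == d) && (b == c)) ->
    forall x, on_segment (f a) (f b) x -> on_segment (f c) (f d) x ->
      exists v, ((v == a) || (v == b)) /\ ((v == c) || (v == d)) /\ x = f v.

Definition Gvector (V : finType) (f : V -> point) (v w : V) : point := f w - f v.

Definition generic_direction (V : finType) (adj : rel V) (f : V -> point)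
  (l : point) : Prop :=
  dot l l = 1 /\ forall v w, adj v w -> dot l (Gvector f v w) != 0.

Definition descendant (V : finType) (adj : rel V) (f : V -> point)
  (l : point) (v : V) : Prop :=
  exists w, adj v w /\ dot l (Gvector f v w) < 0.

Definition descending_direction (V : finType) (adj : rel V) (f : V -> point)
  (l : point) : Prop :=
  generic_direction adj f l /\
  exists v0, ~ descendant adj f l v0 /\
    forall v, v != v0 -> descendant adj f l v.

Definition has_descending_direction (V : finType) (adj : rel V)
  (f : V -> point) : Prop := exists l, descending_direction adj f l.

Definition unit_I (t : R) : Prop := 0 <= t <= 1.

Definition continuous_on_I (g : R -> point) : Prop :=
  forall s0, unit_I s0 -> forall e, 0 < e -> exists2 d, 0 < d &
    forall s, unit_I s -> `|s - s0| < d -> dist2 (g s) (g s0) < e.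

Definition continuous_on_I2 (h : R -> R -> point) : Prop :=
  forall s0 t0, unit_I s0 -> unit_I t0 -> forall e, 0 < e -> exists2 d, 0 < d &
    forall s t, unit_I s -> unit_I t -> `|s - s0| < d -> `|t - t0| < d ->
      dist2 (h s t) (h s0 t0) < e.

(* loops in X based at x0, parametrized by [0,1] (values outside are irrelevant) *)
Definition loop (X : point -> Prop) (x0 : point) (g : R -> point) : Prop :=
  continuous_on_I g /\ g 0 = x0 /\ g 1 = x0 /\ forall t, unit_I t -> X (g t).

Definition loop_homotopic (X : point -> Prop) (x0 : point) (g1 g2 : R -> point)
  : Prop :=
  exists h : R -> R -> point, continuous_on_I2 h /\
    (forall t, unit_I t -> h 0 t = g1 t /\ h 1 t = g2 t) /\
    (forall s, unit_I s -> h s 0 = x0 /\ h s 1 = x0) /\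
    (forall s t, unit_I s -> unit_I t -> X (h s t)).

Definition concat (g1 g2 : R -> point) : R -> point :=
  fun t => if t <= 2^-1 then g1 (2 * t) else g2 (2 * t - 1).

(* pi_1(X, x0) is a free group: there is a family of loops whose classes form
   a free basis, i.e. satisfy the universal property of a free group: every
   assignment of the basis to elements of an arbitrary group H extends to a
   unique homomorphism pi_1(X,x0) -> H (a homomorphism being a map on loops,
   constant on homotopy classes, turning concatenation into multiplication). *)
Definition is_pi1_hom (X : point -> Prop) (x0 : point) (H : Type)
  (mul : H -> H -> H) (phi : (R -> point) -> H) : Prop :=
  (forall g1 g2, loop X x0 g1 -> loop X x0 g2 -> loop_homotopic X x0 g1 g2 ->
     phi g1 = phi g2) /\
  (forall g1 g2, loop X x0 g1 -> loop X x0 g2 ->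
     phi (concat g1 g2) = mul (phi g1) (phi g2)).

Definition pi1_free (X : point -> Prop) (x0 : point) : Prop :=
  exists (I : Type) (gen : I -> R -> point),
    (forall i, loop X x0 (gen i)) /\
    forall (H : Type) (mul : H -> H -> H) (one : H) (inv : H -> H),
      (forall a b c, mul a (mul b c) = mul (mul a b) c) ->
      (forall a, mul one a = a) ->
      (forall a, mul (inv a) a = one) ->
      forall a : I -> H,
        (exists phi, is_pi1_hom X x0 mul phi /\ forall i, phi (gen i) = a i) /\
        (forall phi1 phi2,
           is_pi1_hom X x0 mul phi1 -> (forall i, phi1 (gen i) = a i) ->
           is_pi1_hom X x0 mul phi2 -> (forall i, phi2 (gen i) = a i) ->
           forall g, loop X x0 g -> phi1 g = phi2 g).

(* f is free: pi_1 of the complement R^3 - f(G) is free (at every basepoint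
   of the complement; the complement is path-connected) *)
Definition free_embedding (V : finType) (adj : rel V) (f : V -> point) : Prop :=
  forall x0, ~ image_graph adj f x0 -> pi1_free (fun x => ~ image_graph adj f x) x0.

End Defs.

(* Main.v *)
From HB Require Import structures.
From mathcomp Require Import all_boot all_order all_algebra.
From mathcomp Require Import all_classical reals topology normedtype.
From mathcomp Require Import interval_inference lra ring zify.
Require Import Defs.
Set Implicit Arguments. Unset Strict Implicit. Unset Printing Implicit Defensive.
Import Order.TTheory GRing.Theory Num.Theory.
Import numFieldNormedType.Exports.
Local Open Scope classical_set_scope.
Local Open Scope ring_scope.

(** Sweep the complement of the graph by the half-spaces above a horizontal plane
    that moves down along the descending direction.  Above the graph the half-space
    is convex.  Passing a level without vertices does not change the homotopy type.
    Passing a vertex with [k] lower edges amounts to attaching [k - 1] one-handles,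
    which adds [k - 1] free generators; this needs [k >= 1], that is, that the
    vertex is a descendant.  The only exception is the lowest vertex [v0], to which
    a downward vertical ray is attached to play the role of its lower edge.  In the
    end the ray is put back: a loop around it can be slid outwards, past the graph
    and over its top, hence is already trivial.

    Fundamental groups are handled through local systems: a homomorphism from pi_1
    to a group [H] is an [H]-valued function of pairs of nearby points satisfying the
    cocycle identity near every point, and homomorphisms are evaluated on loops by
    taking products along fine subdivisions.  Local systems pull back along
    continuous maps and glue along open covers without any choice of paths. *)

(** Lowering the level past a vertex without lower edges would glue in a 2-cell and could impose a
    relation. The ray turns this case at [v0] into one with a single lower strand.

    All levels are treated alike: the centres of a level are its vertices and the points where edges
    cross it. A crossing edge has one lower strand and so gives no handle. The step starts from any
    level slightly above the current one, which lets an infimum replace a list of critical heights.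

    Points straight below a centre cannot be raised past it continuously. Hence a cone below each
    centre is first cored out; what is left can be lifted, and handles followed by a radial push
    fill the cone again.

    The handles are slabs between neighbouring lower strands in the order of their first
    coordinates, which therefore must have distinct slopes. General position makes the directions of
    the edges at a vertex independent, and a generic choice of the first axis separates their
    slopes.

    Freeness is carried along as a universal property: a list of loops on which the values of a
    local system may be prescribed and which determine its holonomies. *)

Section Continuity.
Variable R : realType.
Notation pt := (Defs.point R).

(** * Pointwise continuity of real-valued and point-valued functions *)

Definition ct (T : topologicalType) (z : T) (f : T -> R) : Prop :=
  f w @[w --> z] --> f z.

Section Scalar.
Variables (T : topologicalType) (z : T).
Implicit Types f g : T -> R.

Lemma ct_cst (k : R) : ct z (fun=> k).
Proof. exact: cvg_cst. Qed.

Lemma ctD f g : ct z f -> ct z g -> ct z (fun w => f w + g w).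
Proof. exact: cvgD. Qed.

Lemma ctN f : ct z f -> ct z (fun w => - f w).
Proof. exact: cvgN. Qed.

Lemma ctM f g : ct z f -> ct z g -> ct z (fun w => f w * g w).
Proof. exact: cvgM. Qed.

Lemma ctV f : f z != 0 -> ct z f -> ct z (fun w => (f w)^-1).
Proof. exact: cvgV. Qed.

Lemma ct_norm f : ct z f -> ct z (fun w => `|f w|).
Proof. exact: cvg_norm. Qed.

Lemma ct_max f g : ct z f -> ct z g -> ct z (fun w => Num.max (f w) (g w)).
Proof. exact: (@continuous_max R T f g z). Qed.

Lemma ct_min f g : ct z f -> ct z g -> ct z (fun w => Num.min (f w) (g w)).
Proof. exact: (@continuous_min R T f g z). Qed.

Lemma ct_sum (J : Type) (r : seq J) (P : pred J) (F : J -> T -> R) :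
  (forall j, ct z (F j)) -> ct z (fun w => \sum_(j <- r | P j) F j w).
Proof.
move=> hF; elim: r => [|j r IH].
  by under [X in ct z X]eq_fun => w do rewrite big_nil; exact: ct_cst.
under [X in ct z X]eq_fun => w do rewrite big_cons.
by case: (P j) => //; apply: ctD.
Qed.

Lemma ct_ext f g : f =1 g -> ct z f -> ct z g.
Proof. by move=> /funext ->. Qed.

Lemma ct_lt f (k : R) : ct z f -> f z < k -> \forall w \near z, f w < k.
Proof.
move=> /cvgrPdist_lt h fk.
have := h (k - f z); rewrite subr_gt0 => /(_ fk).
by apply: filterS => w; rewrite ltr_norml => /andP[]; lra.
Qed.

Lemma ct_gt f (k : R) : ct z f -> k < f z -> \forall w \near z, k < f w.
Proof.
move=> /ctN /ct_lt h kf; have := h (- k); rewrite ltrN2 => /(_ kf).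
by apply: filterS => w; rewrite ltrN2.
Qed.

End Scalar.

Lemma ct_id (x : R) : ct x id. Proof. exact: cvg_id. Qed.

Lemma ct_comp (T : topologicalType) (z : T) (f : T -> R) (g : R -> R) :
  ct z f -> ct (f z) g -> ct z (fun w => g (f w)).
Proof. by move=> hf hg; apply: (cvg_comp _ _ hf hg). Qed.

Lemma ct_fst (z : R * R) : ct z fst. Proof. exact: cvg_fst. Qed.
Lemma ct_snd (z : R * R) : ct z snd. Proof. exact: cvg_snd. Qed.

Lemma ct_compf (T U : topologicalType) (z : T) (phi : T -> U) (f : U -> R) :
  {for z, continuous phi} -> ct (phi z) f -> ct z (fun w => f (phi w)).
Proof. by move=> hf hg; apply: (cvg_comp _ _ hf hg). Qed.

Lemma ct_comp2 (T : topologicalType) (z : T) (a b : T -> R) (f : R * R -> R) :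
  ct z a -> ct z b -> ct (a z, b z) f -> ct z (fun w => f (a w, b w)).
Proof.
move=> ha hb hf; apply: (@ct_compf _ _ _ (fun w => (a w, b w))) hf.
exact: (cvg_pair ha hb).
Qed.

(** Precomposition with this retraction onto the unit interval turns continuity on the interval into
    continuity of total functions on the line or the plane. *)
Definition clamp (t : R) : R := Num.max 0 (Num.min 1 t).

Lemma clampI t : unit_I (clamp t).
Proof.
rewrite /unit_I /clamp le_max lexx /= ge_max ler01 /=.
by rewrite ge_min lexx.
Qed.

Lemma clamp_id t : unit_I t -> clamp t = t.
Proof.
rewrite /unit_I /clamp => /andP[t0 t1].
by rewrite (min_idPr t1); apply/max_idPr.
Qed.

Lemma clamp0 t : t <= 0 -> clamp t = 0.
Proof.
move=> t0; rewrite /clamp; apply/max_idPl.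
by rewrite ge_min t0 orbT.
Qed.

Lemma clamp1 t : 1 <= t -> clamp t = 1.
Proof. by move=> t1; rewrite /clamp (min_idPl t1); apply/max_idPr. Qed.

Lemma clamp_lip s t : `|clamp s - clamp t| <= `|s - t|.
Proof.
have main a b : a <= b -> `|clamp a - clamp b| <= `|a - b|.
  move=> ab; rewrite [leRHS]distrC (ger0_norm (_ : 0 <= b - a)) ?subr_ge0//.
  have [a0|a0] := leP a 0; have [b0|b0] := leP b 0;
    have [a1|a1] := leP 1 a; have [b1|b1] := leP 1 b; try lra;
    rewrite ?(clamp0 a0) ?(clamp0 b0) ?(clamp1 a1) ?(clamp1 b1)
      ?(@clamp_id a) ?(@clamp_id b) /unit_I ?ler_norml; lra.
have [st|/ltW st] := leP s t; first exact: main.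
by rewrite distrC [leRHS]distrC; apply: main.
Qed.

Lemma ct_clamp (T : topologicalType) (z : T) (f : T -> R) :
  ct z f -> ct z (fun w => clamp (f w)).
Proof. by move=> hf; apply: ct_max; [|apply: ct_min => //]; apply: ct_cst. Qed.

Definition ctp (T : topologicalType) (z : T) (F : T -> pt) : Prop :=
  forall i, ct z (fun w => F w ord0 i).

Lemma ctp_near (T : topologicalType) (z : T) (F : T -> pt) e : 0 < e ->
  ctp z F -> \forall w \near z, forall i, `|F w ord0 i - F z ord0 i| < e.
Proof.
move=> e0 hF.
apply: (@filter_forall _ _ (fun i w => `|F w ord0 i - F z ord0 i| < e)) => i.
have /cvgrPdist_lt /(_ _ e0) := hF i.
by apply: filterS => w; rewrite distrC.
Qed.

Lemma nbhs2P (z : R * R) (P : R * R -> Prop) :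
  (\forall w \near z, P w) <->
  exists2 d : R, 0 < d & forall w : R * R, `|w.1 - z.1| < d -> `|w.2 - z.2| < d -> P w.
Proof.
split.
  move=> [[A B] /= [/nbhs_ballP[d1 /= d10 h1] /nbhs_ballP[d2 /= d20 h2]] h].
  exists (Num.min d1 d2); first by rewrite lt_min d10.
  move=> [a b] /=; rewrite !lt_min => /andP[a1 _] /andP[_ b2]; apply: h; split => /=.
    by apply: h1; rewrite /ball/= distrC.
  by apply: h2; rewrite /ball/= distrC.
move=> [d d0 h]; exists (ball z.1 d, ball z.2 d) => /=.
  by split; exact: nbhsx_ballx.
by move=> [a b] [/= ? ?]; apply: h; rewrite distrC.
Qed.

Lemma dist2_ge (p q : pt) i : (p ord0 i - q ord0 i) ^+ 2 <= dist2 p q.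
Proof.
rewrite /dist2 /dot (bigD1 i)//= !mxE -expr2 lerDl.
by apply: sumr_ge0 => j _; rewrite -expr2 sqr_ge0.
Qed.

Lemma dist2_lt_coord (p q : pt) e i : 0 < e -> dist2 p q < e ^+ 2 ->
  `|p ord0 i - q ord0 i| < e.
Proof.
move=> e0 /(le_lt_trans (dist2_ge p q i)).
rewrite -real_normK ?num_real// ltr_pXn2r// ?nnegrE//; exact: ltW.
Qed.

Lemma coord_dist2_lt (p q : pt) e : 0 < e ->
  (forall i, `|p ord0 i - q ord0 i| < Num.min 1 (e / 4)) -> dist2 p q < e.
Proof.
move=> e0 h; have k i : (p ord0 i - q ord0 i) ^+ 2 <= e / 4.
  have := h i; rewrite lt_min => /andP[h1 h2].
  rewrite -real_normK ?num_real// expr2.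
  apply: (le_trans (ler_wpM2r (normr_ge0 _) (ltW h1))).
  by rewrite mul1r ltW.
rewrite /dist2 /dot; apply: (@le_lt_trans _ _ (\sum_(i < 3) e / 4)).
  by apply: ler_sum => i _; rewrite !mxE -expr2.
rewrite sumr_const card_ord; lra.
Qed.

Lemma contI_ctp g : continuous_on_I g <-> forall t, ctp t (fun w : R => g (clamp w)).
Proof.
split.
- move=> hg t i; apply/cvgrPdist_lt => e e0.
  have [d d0 hd] := hg _ (clampI t) _ (exprn_gt0 2 e0).
  apply/nbhs_ballP; exists d => // w wd.
  rewrite distrC; apply: dist2_lt_coord => //; apply: hd; first exact: clampI.
  by apply: le_lt_trans (clamp_lip _ _) _; rewrite distrC.
- move=> hg s0 s0I e e0.
  have m0 : 0 < Num.min 1 (e / 4) by rewrite lt_min; lra.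
  have /nbhs_ballP[d /= d0 hd] := ctp_near m0 (hg s0).
  exists d => // s sI sd.
  apply: coord_dist2_lt => // i.
  by rewrite -{1}(clamp_id s0I) -{1}(clamp_id sI); apply: hd; rewrite /ball/= distrC.
Qed.

Lemma contI2_ctp h : continuous_on_I2 h <->
  forall z, ctp z (fun w : R * R => h (clamp w.1) (clamp w.2)).
Proof.
split.
- move=> hh t i; apply/cvgrPdist_lt => e e0.
  have [d d0 hd] := hh _ _ (clampI t.1) (clampI t.2) _ (exprn_gt0 2 e0).
  apply/nbhs2P; exists d => // w w1 w2.
  rewrite distrC; apply: dist2_lt_coord => //; apply: hd; try exact: clampI.
    exact: le_lt_trans (clamp_lip _ _) _.
  exact: le_lt_trans (clamp_lip _ _) _.
- move=> hg s0 t0 s0I t0I e e0.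
  have m0 : 0 < Num.min 1 (e / 4) by rewrite lt_min; lra.
  have /nbhs2P[d /= d0 hd] := ctp_near m0 (hg (s0, t0)).
  exists d => // s t sI tI sd td.
  apply: coord_dist2_lt => // i.
  rewrite -{1}(clamp_id s0I) -{1}(clamp_id sI) -{1}(clamp_id t0I) -{1}(clamp_id tI).
  exact: (hd (s, t)).
Qed.

Section Points.
Variables (T : topologicalType) (z : T).
Implicit Types F G : T -> pt.

Lemma ctp_cst (p : pt) : ctp z (fun=> p).
Proof. by move=> i; apply: ct_cst. Qed.

Lemma ctpD F G : ctp z F -> ctp z G -> ctp z (fun w => F w + G w).
Proof.
move=> hF hG i; apply: (@ct_ext _ _ (fun w => F w ord0 i + G w ord0 i)).
  by move=> w; rewrite !mxE.
exact: ctD.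
Qed.

Lemma ctpN F : ctp z F -> ctp z (fun w => - F w).
Proof.
move=> hF i; apply: (@ct_ext _ _ (fun w => - F w ord0 i)).
  by move=> w; rewrite !mxE.
exact: ctN.
Qed.

Lemma ctpZ (a : T -> R) F : ct z a -> ctp z F -> ctp z (fun w => a w *: F w).
Proof.
move=> ha hF i; apply: (@ct_ext _ _ (fun w => a w * F w ord0 i)).
  by move=> w; rewrite !mxE.
exact: ctM.
Qed.

Lemma ctp_ext F G : F =1 G -> ctp z F -> ctp z G.
Proof. by move=> /funext ->. Qed.

Lemma ctp_comp (a : T -> R) (F : R -> pt) :
  ct z a -> ctp (a z) F -> ctp z (fun w => F (a w)).
Proof. by move=> ha hF i; apply: (ct_comp (g := fun w => F w ord0 i)). Qed.

Lemma ctp_comp2 (a b : T -> R) (F : R -> R -> pt) :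
  ct z a -> ct z b -> ctp (a z, b z) (fun w => F w.1 w.2) ->
  ctp z (fun w => F (a w) (b w)).
Proof. by move=> ha hb hF i; apply: (ct_comp2 ha hb (hF i)). Qed.

Lemma ctp_path (a : T -> R) p :
  continuous_on_I p -> ct z a -> ctp z (fun w => p (clamp (a w))).
Proof.
move=> /contI_ctp hp ha.
exact: (ctp_comp (F := fun w => p (clamp w))).
Qed.

Lemma ctp_square (a b : T -> R) h :
  continuous_on_I2 h -> ct z a -> ct z b ->
  ctp z (fun w => h (clamp (a w)) (clamp (b w))).
Proof.
move=> /contI2_ctp hp ha hb.
by apply: (ctp_comp2 (F := fun s t => h (clamp s) (clamp t))).
Qed.

End Points.
End Continuity.

(** * Holonomy of local systems *)

(** Only the left-sided axioms appear, since these are what [pi1_free] supplies; the right-sided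
    laws are derived below. *)
Record grp := Grp {
  gcar :> Type;
  gmul : gcar -> gcar -> gcar;
  gone : gcar;
  ginv : gcar -> gcar;
  gmulA : forall a b c, gmul a (gmul b c) = gmul (gmul a b) c;
  gmul1 : forall a, gmul gone a = a;
  gmulV : forall a, gmul (ginv a) a = gone }.

Notation "a ** b" := (gmul a b) (at level 40, left associativity).
Arguments gone {_}.

Section GroupTheory.
Variable H : grp.
Implicit Types a b c : H.

Lemma gmulK a b : ginv a ** (a ** b) = b.
Proof. by rewrite gmulA gmulV gmul1. Qed.

Lemma gmul_cancel a b c : a ** b = a ** c -> b = c.
Proof. by move=> /(congr1 (gmul (ginv a))); rewrite !gmulK. Qed.

Lemma gmulr1 a : a ** gone = a.
Proof. by apply: (@gmul_cancel (ginv a)); rewrite gmulK gmulV. Qed.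

Lemma gmulrV a : a ** ginv a = gone.
Proof. by apply: (@gmul_cancel (ginv a)); rewrite gmulK gmulr1. Qed.

Lemma gmulVK a b : a ** (ginv a ** b) = b.
Proof. by rewrite gmulA gmulrV gmul1. Qed.

Lemma ginv_eq a b : a ** b = gone -> ginv a = b.
Proof. by move=> ab; apply: (@gmul_cancel a); rewrite gmulrV ab. Qed.

Lemma ginvK a : ginv (ginv a) = a.
Proof. by apply: ginv_eq; rewrite gmulV. Qed.

Lemma ginv1 : ginv gone = gone :> H.
Proof. by apply: ginv_eq; rewrite gmul1. Qed.

Lemma ginvM a b : ginv (a ** b) = ginv b ** ginv a.
Proof. by apply: ginv_eq; rewrite -gmulA gmulVK gmulrV. Qed.

Lemma gmulAr a b c : (a ** b) ** c = a ** (b ** c).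
Proof. by rewrite gmulA. Qed.

Lemma gidem a : a ** a = a -> a = gone.
Proof. by move=> aa; apply: (@gmul_cancel a); rewrite aa gmulr1. Qed.

Definition gsimp := (gmulAr, ginvM, ginvK, ginv1, gmul1, gmulr1, gmulV, gmulrV,
  gmulK, gmulVK).

End GroupTheory.

Section Holonomy.
Variable R : realType.
Notation pt := (Defs.point R).
Notation region := (pt -> Prop).

(** Cubes form a base of convex neighbourhoods, so nearby points can be joined by segments inside
    them. *)
Definition near_pt (x : pt) (r : R) (y : pt) : Prop :=
  forall i, `|y ord0 i - x ord0 i| < r.

Definition open_region (X : region) : Prop :=
  forall x, X x -> exists2 r, 0 < r & forall y, near_pt x r y -> X y.

Definition pth (X : region) (p : R -> pt) : Prop :=
  continuous_on_I p /\ forall t, unit_I t -> X (p t).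

Definition sqr_in (X : region) (h : R -> R -> pt) : Prop :=
  continuous_on_I2 h /\ forall s t, unit_I s -> unit_I t -> X (h s t).

Lemma unit_I0 : unit_I (0 : R). Proof. by rewrite /unit_I lexx ler01. Qed.
Lemma unit_I1 : unit_I (1 : R). Proof. by rewrite /unit_I lexx ler01. Qed.
Hint Resolve unit_I0 unit_I1 : core.

Lemma sub_pth (X Y : region) p : (forall x, X x -> Y x) -> pth X p -> pth Y p.
Proof. by move=> XY [cp hp]; split=> // t /hp /XY. Qed.

(* Written as a sum, a concatenation is visibly continuous: at each time all but
   one of the moving terms is stuck at the common endpoint. *)
Lemma concat_sum (p q : R -> pt) t : p 1 = q 0 -> unit_I t ->
  concat p q t = p (clamp (2 * t)) + q (clamp (2 * t - 1)) - p 1.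
Proof.
move=> e /andP[t0 t1]; rewrite /concat; case: ifPn => [h|]; [|rewrite -ltNge => h].
  by rewrite (@clamp0 _ (2 * t - 1)) -?e ?addrK ?clamp_id// /unit_I; lra.
by rewrite (@clamp1 _ (2 * t)) ?[p 1 + _]addrC ?addrK ?clamp_id// /unit_I; lra.
Qed.

Lemma pth_concat X p q : pth X p -> pth X q -> p 1 = q 0 -> pth X (concat p q).
Proof.
move=> [cp hp] [cq hq] e; split.
  apply/contI_ctp => t.
  apply: (@ctp_ext _ _ _ (fun w => p (clamp (2 * clamp w)) + q (clamp (2 * clamp w - 1)) - p 1)).
    by move=> w; rewrite concat_sum//; exact: clampI.
  have hc : ct t (fun w : R => clamp w) by apply: ct_clamp; exact: ct_id.
  apply: ctpD; [apply: ctpD|exact: ctp_cst].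
    by apply: ctp_path => //; apply: ctM => //; exact: ct_cst.
  by apply: ctp_path => //; apply: ctD; [apply: ctM => //|]; exact: ct_cst.
move=> t /andP[t0 t1]; rewrite /concat; case: ifPn => [h|]; [|rewrite -ltNge => h].
  by apply: hp; rewrite /unit_I; lra.
by apply: hq; rewrite /unit_I; lra.
Qed.

Lemma near_pt_refl x r : 0 < r -> near_pt x r x.
Proof. by move=> r0 i; rewrite subrr normr0. Qed.

(** A Lebesgue number argument on the compact unit square. All large [n] are allowed, so that
    several subdivisions can be taken with the same [n]. *)
Lemma fine_grid2 (X : region) (Gd : pt -> R -> Prop) h :
  (forall x, X x -> exists2 r, 0 < r & Gd x r) -> sqr_in X h ->
  exists N, forall n, (N <= n)%N -> (0 < n)%N ->
    forall i j, (i < n)%N -> (j < n)%N ->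
    exists x r, Gd x r /\ forall s t,
      i%:R / n%:R <= s <= i.+1%:R / n%:R -> j%:R / n%:R <= t <= j.+1%:R / n%:R ->
      near_pt x r (h s t).
Proof.
move=> hG [/contI2_ctp ch hX].
pose K : set (R * R) := `[0, 1] `*` `[0, 1].
have cK : compact K by apply: compact_setX; exact: segment_compact.
pose P n (z : R * R) := exists x r, Gd x r /\ forall w : R * R,
  `|w.1 - z.1| <= n.+1%:R^-1 -> `|w.2 - z.2| <= n.+1%:R^-1 ->
  near_pt x r (h (clamp w.1) (clamp w.2)).
have [N _ hN] : \forall n \near \oo, K `<=` P n.
  move/compact_near_coveringP: cK; apply => z zK.
  have [r r0 hr] := hG _ (hX _ _ (clampI z.1) (clampI z.2)).
  have /nbhs2P[d d0 hd] := ctp_near r0 (ch z).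
  have d20 : 0 < d / 2 by lra.
  exists ([set w : R * R | `|w.1 - z.1| < d / 2 /\ `|w.2 - z.2| < d / 2],
          [set n : nat | n.+1%:R^-1 < d / 2]) => /=.
    split; last exact: near_infty_natSinv_lt (PosNum d20).
    by apply/nbhs2P; exists (d / 2).
  (* Half of [d] pays for the distance from [z] to [z'], the other half for the mesh. *)
  move=> [z' n] /= [[z1 z2] nd]; exists (h (clamp z.1) (clamp z.2)), r; split=> // w w1 w2.
  have aux (a b c : R) : `|b - c| < d / 2 -> `|a - b| <= n.+1%:R^-1 -> `|a - c| < d.
    move=> bc ab; have -> : a - c = (a - b) + (b - c) by ring.
    apply: le_lt_trans (ler_normD _ _) _.
    by rewrite [ltRHS]splitr addrC ltrD// (le_lt_trans ab).
  by apply: hd; [apply: aux z1 w1|apply: aux z2 w2].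
exists N.+1 => -[//|n] Nn _ i j ni nj.
have n0 : 0 < n.+1%:R :> R by rewrite ltr0n.
have cell (k : nat) (s : R) : (k < n.+1)%N -> k%:R / n.+1%:R <= s <= k.+1%:R / n.+1%:R ->
    unit_I s /\ `|s - k%:R / n.+1%:R| <= n.+1%:R^-1.
  move=> kn; have -> : k.+1%:R / n.+1%:R = k%:R / n.+1%:R + n.+1%:R^-1 :> R.
    by rewrite -natr1 mulrDl mul1r.
  move=> /andP[s1 s2]; split; last by rewrite ger0_norm ?subr_ge0// lerBlDl.
  apply/andP; split; first by apply: le_trans s1; rewrite divr_ge0.
  by apply: le_trans s2 _; rewrite -[X in _ + X]mul1r -mulrDl ler_pdivrMr// mul1r natr1 ler_nat.
have ui (k : nat) : (k < n.+1)%N -> unit_I (k%:R / n.+1%:R : R).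
  move=> kn; have hk : k%:R / n.+1%:R <= k.+1%:R / n.+1%:R :> R.
    by apply: ler_wpM2r; rewrite ?invr_ge0 ?ler_nat.
  by case: (cell k (k%:R / n.+1%:R) kn); rewrite ?lexx.
have [x [r [Gxr hr]]] : P n (i%:R / n.+1%:R, j%:R / n.+1%:R).
  by apply: hN => //=; split=> /=; rewrite in_itv/=; apply: ui.
exists x, r; split=> // s t hs ht.
have [sI sd] := cell _ _ ni hs; have [tI td] := cell _ _ nj ht.
by have := hr (s, t) sd td; rewrite /= !clamp_id.
Qed.

Lemma contI2_cst_l (p : R -> pt) : continuous_on_I p -> continuous_on_I2 (fun _ : R => p).
Proof. by move=> cp; apply/contI2_ctp => z; apply: ctp_path => //; exact: ct_snd. Qed.

Lemma sqr_hor X h s : sqr_in X h -> unit_I s -> pth X (h s).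
Proof.
move=> [/contI2_ctp ch hX] sI; split=> [|t tI]; last exact: hX.
apply/contI_ctp => t; rewrite -(clamp_id sI).
by apply: (ctp_comp2 (F := fun s t => h (clamp s) (clamp t))); first exact: ct_cst.
Qed.

Lemma sqr_ver X h t : sqr_in X h -> unit_I t -> pth X (h^~ t).
Proof.
move=> [/contI2_ctp ch hX] tI; split=> [|s sI]; last exact: hX.
apply/contI_ctp => s; rewrite -(clamp_id tI).
by apply: (ctp_comp2 (F := fun s t => h (clamp s) (clamp t))) => //; exact: ct_cst.
Qed.

Lemma fine_grid (X : region) (Gd : pt -> R -> Prop) p :
  (forall x, X x -> exists2 r, 0 < r & Gd x r) -> pth X p ->
  exists N, forall n, (N <= n)%N -> (0 < n)%N -> forall i, (i < n)%N ->
    exists x r, Gd x r /\ forall t,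
      i%:R / n%:R <= t <= i.+1%:R / n%:R -> near_pt x r (p t).
Proof.
move=> hG [cp hp].
have [|N hN] := @fine_grid2 X Gd (fun _ : R => p) hG.
  by split=> [|s t _ /hp//]; exact: contI2_cst_l.
exists N => n Nn n0 i ni; have [x [r [Gxr h]]] := hN n Nn n0 0%N i n0 ni.
exists x, r; split=> // t ht; apply: (h 0) => //.
by rewrite mul0r lexx divr_ge0.
Qed.

Section Fixed.
Variable H : grp.
Implicit Types c : pt -> pt -> H.

Definition cocycle_near c (x : pt) (r : R) : Prop :=
  forall y z w, near_pt x r y -> near_pt x r z -> near_pt x r w ->
    c y z ** c z w = c y w.

Definition LS (X : region) c : Prop :=
  forall x, X x -> exists2 r, 0 < r & cocycle_near c x r.

Lemma sub_LS (X Y : region) c : (forall x, X x -> Y x) -> LS Y c -> LS X c.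
Proof. by move=> XY lc x /XY /lc. Qed.

Lemma cocycle_id c x r y : cocycle_near c x r -> near_pt x r y -> c y y = gone.
Proof. by move=> hc yx; apply: gidem; apply: hc. Qed.

Lemma LS_id X c x : LS X c -> X x -> c x x = gone.
Proof. by move=> lc /lc[r r0 /cocycle_id]; apply; apply: near_pt_refl. Qed.

Fixpoint holn c (p : R -> pt) (n k : nat) : H :=
  if k is k'.+1 then holn c p n k' ** c (p (k'%:R / n%:R)) (p (k'.+1%:R / n%:R))
  else gone.

(** The products are eventually constant rather than merely convergent, because the cocycle identity
    is exact on small cells. *)
Definition is_hol c p (v : H) : Prop :=
  exists N, forall n, (N <= n)%N -> (0 < n)%N -> holn c p n n = v.

(** Total, with default [gone], so that [Hol c] can itself serve as the map in [is_pi1_hom]. *)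
Definition Hol c p : H :=
  if pselect (exists v, is_hol c p v) is left e then projT1 (cid e) else gone.

Lemma is_hol_unique c p v w : is_hol c p v -> is_hol c p w -> v = w.
Proof.
move=> [N hN] [M hM]; rewrite -(hN (maxn N M).+1) ?(hM (maxn N M).+1)//; lia.
Qed.

Lemma Hol_eq c p v : is_hol c p v -> Hol c p = v.
Proof.
move=> hv; rewrite /Hol; case: pselect => [e|]; last by case; exists v.
by case: cid => w /= hw; apply: is_hol_unique hw hv.
Qed.

Lemma holn_add c p n j k : holn c p n (j + k) =
  holn c p n j ** holn c (fun t => p (t + j%:R / n%:R)) n k.
Proof.
elim: k => [|k IH]; first by rewrite addn0 /= gmulr1.
rewrite addnS /= IH -!gmulA; congr (_ ** (_ ** c _ _)); congr p.
  by rewrite natrD mulrDl addrC.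
by rewrite -addnS natrD mulrDl addrC.
Qed.

Lemma holn_ext c p q n k :
  (forall i, (i <= k)%N -> p (i%:R / n%:R) = q (i%:R / n%:R)) ->
  holn c p n k = holn c q n k.
Proof.
elim: k => //= k IH h; rewrite IH => [|i ik]; last by apply: h; lia.
by rewrite !h.
Qed.

Lemma holn_cocycle c x r p n k : cocycle_near c x r ->
  (forall i, (i <= k)%N -> near_pt x r (p (i%:R / n%:R))) ->
  holn c p n k = c (p 0) (p (k%:R / n%:R)).
Proof.
move=> hc; elim: k => /= [|k IH] h.
  have := h 0%N (leqnn _); rewrite mul0r => h0.
  by rewrite (cocycle_id hc h0).
rewrite IH => [|i ik]; last by apply: h; lia.
apply: hc; [|exact: h|exact: h].
by have := h 0%N (leq0n _); rewrite mul0r.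
Qed.

(** The points inserted in one cell lie in one cube on which the cocycle identity holds, so their
    factors telescope to the factor of the cell. *)
Lemma holn_refine c p n m k : (0 < n)%N -> (0 < m)%N -> (k <= n)%N ->
  (forall i, (i < n)%N -> exists x r, cocycle_near c x r /\ forall t,
      i%:R / n%:R <= t <= i.+1%:R / n%:R -> near_pt x r (p t)) ->
  holn c p (n * m) (k * m) = holn c p n k.
Proof.
move=> n0 m0 kn h; elim: k kn => [|k IH] kn //=.
have n0' : n%:R != 0 :> R by rewrite pnatr_eq0; lia.
have m0' : m%:R != 0 :> R by rewrite pnatr_eq0; lia.
have m0'' : 0 < m%:R :> R by rewrite ltr0n.
have n0'' : 0 < n%:R :> R by rewrite ltr0n.
rewrite mulSn addnC holn_add IH; last lia.
congr (_ ** _); have [x [r [hc hr]]] := h k kn.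
rewrite (@holn_cocycle _ x r) => //.
- congr (c (p _) (p _)); rewrite natrM natrM; first by field; rewrite n0' m0'.
  by rewrite -[in RHS]natr1; field; rewrite n0' m0'.
- move=> i im; apply: hr.
  have -> : i%:R / (n * m)%:R + (k * m)%:R / (n * m)%:R
    = (k%:R + i%:R / m%:R) / n%:R :> R by rewrite !natrM; field; rewrite n0' m0'.
  have a0 : 0 <= i%:R / m%:R :> R by rewrite divr_ge0.
  have a1 : i%:R / m%:R <= 1 :> R by rewrite ler_pdivrMr// mul1r ler_nat.
  by rewrite !ler_pM2r ?invr_gt0// -natr1; apply/andP; split; lra.
Qed.

Lemma is_hol_ex X c p : LS X c -> pth X p -> exists v, is_hol c p v.
Proof.
move=> lc pp; have [N hN] := fine_grid lc pp.
exists (holn c p N.+1 N.+1), N => n Nn n0.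
(* The subdivisions into [n] and [N.+1] pieces are compared through their common refinement. *)
rewrite -(@holn_refine c p n N.+1 n)//; last exact: hN.
by rewrite mulnC; apply: holn_refine => //; apply: hN.
Qed.

Lemma HolP X c p : LS X c -> pth X p -> is_hol c p (Hol c p).
Proof. by move=> lc pp; have [v hv] := is_hol_ex lc pp; rewrite (Hol_eq hv). Qed.

Lemma holn_concat c p q n : (0 < n)%N -> p 1 = q 0 ->
  holn c (concat p q) (n + n) (n + n) = holn c p n n ** holn c q n n.
Proof.
move=> n0 e; rewrite holn_add.
have n0' : 0 < n%:R :> R by rewrite ltr0n.
have E i : 2 * (i%:R / (n + n)%:R) = i%:R / n%:R :> R.
  by rewrite natrD; field; rewrite (gt_eqF n0') (gt_eqF (addr_gt0 n0' n0')).
have I (i : nat) : i%:R / (n + n)%:R = i%:R / n%:R / 2 :> R.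
  by rewrite -E [RHS]mulrC mulKf ?pnatr_eq0.
have S k p' : holn c p' (n + n) k = holn c (fun t => p' (t / 2)) n k.
  by elim: k => //= k ->; rewrite !I.
have ok i : (i <= n)%N -> (0 : R) <= i%:R / n%:R <= (1 : R).
  by move=> ni; rewrite divr_ge0//= ler_pdivrMr// mul1r ler_nat.
rewrite !S I divff ?gt_eqF//; congr (_ ** _); apply: holn_ext => i /ok; rewrite /concat;
  move: (i%:R / n%:R) => x /andP[x0 x1].
  by rewrite ifT; [congr p; field|lra].
(* At the junction [concat] takes its first branch; there [p 1 = q 0] is used. *)
case: ifPn => [h|h]; last by congr q; field.
have -> : x = 0 by lra.
by rewrite mul0r add0r mul1r mulfV// pnatr_eq0.
Qed.

Lemma is_hol_ext c p q v : (forall t, unit_I t -> p t = q t) ->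
  is_hol c p v -> is_hol c q v.
Proof.
move=> pq [N hN]; exists N => n Nn n0; rewrite -(hN n Nn n0); apply: holn_ext => i ni.
apply/esym/pq; rewrite /unit_I divr_ge0//= ler_pdivrMr ?ltr0n//.
by rewrite mul1r ler_nat.
Qed.

Lemma Hol_ext X c p q : LS X c -> pth X p -> (forall t, unit_I t -> p t = q t) ->
  Hol c q = Hol c p.
Proof. by move=> lc pp pq; apply: Hol_eq; apply: is_hol_ext pq (HolP lc pp). Qed.

Lemma Hol_concat X c p q : LS X c -> pth X p -> pth X q -> p 1 = q 0 ->
  Hol c (concat p q) = Hol c p ** Hol c q.
Proof.
move=> lc pp pq e.
have [N hN] := HolP lc pp; have [M hM] := HolP lc pq.
have [K hK] := HolP lc (pth_concat pp pq e).
pose n := (N + M + K).+1.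
rewrite -(hN n) -?(hM n) -?(hK (n + n)%N); [|lia..].
by apply: holn_concat => //; lia.
Qed.

Lemma Hol_cst X c x : LS X c -> X x -> Hol c (fun=> x) = gone.
Proof.
move=> lc Xx; apply: Hol_eq; exists 0%N => n _ _.
by elim: {2}n => //= k ->; rewrite gmul1 (LS_id lc Xx).
Qed.

(** A discrete Stokes argument: the identity on small cells is accumulated along rows and then along
    columns. All four sides are free, so the lemma serves fixed-end homotopies, reversal of paths
    and deformations of regions alike. *)
Lemma Hol_square X c h : LS X c -> sqr_in X h ->
  Hol c (h 0) ** Hol c (h^~ 1) = Hol c (h^~ 0) ** Hol c (h 1).
Proof.
move=> lc hh; have [N hN] := fine_grid2 lc hh.
have [N1 h1] := HolP lc (sqr_hor hh unit_I0).
have [N2 h2] := HolP lc (sqr_hor hh unit_I1).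
have [N3 h3] := HolP lc (sqr_ver hh unit_I0).
have [N4 h4] := HolP lc (sqr_ver hh unit_I1).
have [n Nn n_gt0] : exists2 n, (N + N1 + N2 + N3 + N4 <= n)%N & (0 < n)%N.
  by exists (N + N1 + N2 + N3 + N4).+1.
rewrite -(h1 n) -?(h2 n) -?(h3 n) -?(h4 n); [|lia..].
have n0 : n%:R != 0 :> R by rewrite pnatr_eq0; lia.
have lei (i : nat) : i%:R / n%:R <= i.+1%:R / n%:R :> R.
  by rewrite ler_pM2r ?invr_gt0 ?ltr0n// ler_nat.
pose V i k := c (h (i%:R / n%:R) (k%:R / n%:R)) (h (i.+1%:R / n%:R) (k%:R / n%:R)).
have row i k : (i < n)%N -> (k <= n)%N ->
    holn c (h (i%:R / n%:R)) n k ** V i k = V i 0%N ** holn c (h (i.+1%:R / n%:R)) n k.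
  move=> ni; elim: k => [|k IH] kn /=; first by rewrite gmul1 gmulr1.
  have [x [r [hc hr]]] := hN n (ltac:(lia)) n_gt0 i k ni kn.
  rewrite gmulA -IH; last exact: ltnW.
  by rewrite -!gmulA /V !hc//; apply: hr; rewrite !(lexx, lei).
have col i : (i <= n)%N -> holn c (h 0) n n ** holn c (h^~ 1) n i
    = holn c (h^~ 0) n i ** holn c (h (i%:R / n%:R)) n n.
  elim: i => [|i IH] ni /=; first by rewrite mul0r gmul1 gmulr1.
  rewrite gmulA IH 1?ltnW// -!gmulA; congr (_ ** _).
  by have := row i n ni (leqnn _); rewrite /V (divff n0) mul0r.
by rewrite col// (divff n0).
Qed.

(** The gauge factors cancel between consecutive cells, leaving those at the two ends. *)
Lemma is_hol_gauge (X : region) c1 c2 (g : pt -> H) p v : pth X p ->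
  (forall x, X x -> exists2 r, 0 < r & forall y z, near_pt x r y -> near_pt x r z ->
     c2 y z = ginv (g y) ** c1 y z ** g z) ->
  is_hol c1 p v -> is_hol c2 p (ginv (g (p 0)) ** v ** g (p 1)).
Proof.
move=> pp hg [N hN]; have [M hM] := fine_grid hg pp.
exists (N + M)%N => n Nn n0; rewrite -(hN n)//; last lia.
have n0' : n%:R != 0 :> R by rewrite pnatr_eq0; lia.
suff E k : (k <= n)%N ->
    holn c2 p n k = ginv (g (p 0)) ** holn c1 p n k ** g (p (k%:R / n%:R)).
  by rewrite E// divff.
elim: k => [|k IH] kn /=; first by rewrite mul0r gmulr1 gmulV.
rewrite IH; last lia.
have [x [r [hc hr]]] := hM n (ltac:(lia)) n0 k kn.
have lei : k%:R / n%:R <= k.+1%:R / n%:R :> R.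
  by rewrite ler_pM2r ?invr_gt0 ?ltr0n// ler_nat.
by rewrite hc ?gsimp//; apply: hr; rewrite !(lexx, lei).
Qed.

Lemma Hol_gauge (X : region) c1 c2 (g : pt -> H) p : pth X p -> LS X c1 ->
  (forall x, X x -> exists2 r, 0 < r & forall y z, near_pt x r y -> near_pt x r z ->
     c2 y z = ginv (g y) ** c1 y z ** g z) ->
  Hol c2 p = ginv (g (p 0)) ** Hol c1 p ** g (p 1).
Proof.
move=> pp lc hg; apply: Hol_eq; apply: is_hol_gauge hg _ => //.
exact: HolP lc pp.
Qed.

End Fixed.
End Holonomy.

(** * Deformations *)

Section LocalSystems.
Variable R : realType.
Notation pt := (Defs.point R).
Notation region := (pt -> Prop).
Hint Resolve unit_I0 unit_I1 : core.

Definition seg (y z : pt) (t : R) : pt := (1 - t) *: y + t *: z.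

Lemma segE y z t i : seg y z t ord0 i = (1 - t) * y ord0 i + t * z ord0 i.
Proof. by rewrite !mxE. Qed.

Lemma seg0 y z : seg y z 0 = y.
Proof. by rewrite /seg subr0 scale1r scale0r addr0. Qed.

Lemma seg1 y z : seg y z 1 = z.
Proof. by rewrite /seg subrr scale0r scale1r add0r. Qed.

Lemma seg_same y t : seg y y t = y.
Proof. by rewrite /seg -scalerDl subrK scale1r. Qed.

Lemma ctp_seg (T : topologicalType) (z : T) (F G : T -> pt) (a : T -> R) :
  ctp z F -> ctp z G -> ct z a -> ctp z (fun w => seg (F w) (G w) (a w)).
Proof.
move=> hF hG ha; apply: ctpD; apply: ctpZ => //.
by apply: ctD; [exact: ct_cst|apply: ctN].
Qed.

Lemma contI_seg y z : continuous_on_I (seg y z).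
Proof.
apply/contI_ctp => t; apply: ctp_seg; try exact: ctp_cst.
by apply: ct_clamp; exact: ct_id.
Qed.

Definition convex_region (X : region) : Prop :=
  forall y z t, X y -> X z -> unit_I t -> X (seg y z t).

Lemma pth_seg X y z : convex_region X -> X y -> X z -> pth X (seg y z).
Proof. by move=> cX Xy Xz; split=> [|t tI]; [exact: contI_seg|exact: cX]. Qed.

Lemma convex_comb_lt (a b t r : R) : unit_I t -> a < r -> b < r -> (1 - t) * a + t * b < r.
Proof.
move=> /andP[t0 t1] ar br; have [m [am bm mr]] : exists m, [/\ a <= m, b <= m & m < r].
  by exists (Num.max a b); rewrite !le_max !lexx orbT gt_max ar br.
by apply: le_lt_trans mr; nra.
Qed.

Lemma near_pt_convex x r : convex_region (near_pt x r).
Proof.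
move=> y z t hy hz tI i; rewrite segE.
have -> : (1 - t) * y ord0 i + t * z ord0 i - x ord0 i =
  (1 - t) * (y ord0 i - x ord0 i) + t * (z ord0 i - x ord0 i) by ring.
move: (hy i) (hz i); rewrite !ltr_norml => /andP[a b] /andP[c d].
apply/andP; split; last exact: convex_comb_lt.
have a' : - (y ord0 i - x ord0 i) < r by lra.
have c' : - (z ord0 i - x ord0 i) < r by lra.
by have := convex_comb_lt tI a' c'; lra.
Qed.

Definition rev (p : R -> pt) (t : R) : pt := p (1 - t).

Lemma unit_I_onem (t : R) : unit_I t -> unit_I (1 - t).
Proof. by rewrite /unit_I => /andP[? ?]; apply/andP; split; lra. Qed.

Lemma pth_rev (X : region) p : pth X p -> pth X (rev p).
Proof.
move=> [cp hp]; split=> [|t tI]; last exact/hp/unit_I_onem.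
apply/contI_ctp => t; rewrite /rev.
apply: (@ctp_ext _ _ _ (fun w => p (clamp (1 - clamp w)))).
  by move=> w; rewrite (@clamp_id _ (1 - clamp w))//; apply/unit_I_onem/clampI.
apply: ctp_path => //; apply: ctD; first exact: ct_cst.
by apply/ctN/ct_clamp; exact: ct_id.
Qed.

Lemma contI_cst (x : pt) : continuous_on_I (fun _ : R => x).
Proof. by apply/contI_ctp => t; exact: ctp_cst. Qed.

Lemma pth_cst (X : region) x : X x -> pth X (fun _ : R => x).
Proof. by split; first exact: contI_cst. Qed.

Lemma pth_ext (X : region) (p q : R -> pt) : (forall t, unit_I t -> p t = q t) -> pth X p ->
    pth X q.
Proof.
move=> pq [cp hp]; split=> [|t tI]; last by rewrite -pq//; apply: hp.
move/contI_ctp: cp => cp; apply/contI_ctp => t.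
by apply: ctp_ext (cp t) => w; rewrite pq//; exact: clampI.
Qed.

Lemma pth_loop (X : region) x0 g : loop X x0 g -> pth X g.
Proof. by move=> [? [? [? ?]]]. Qed.

Lemma loop_pth (X : region) x0 g : pth X g -> g 0 = x0 -> g 1 = x0 -> loop X x0 g.
Proof. by move=> [? ?]. Qed.

Lemma sub_loop (X Y : region) x0 g : (forall x, X x -> Y x) -> loop X x0 g -> loop Y x0 g.
Proof. by move=> XY [? [? [? h]]]; split=> //; split=> //; split=> // t /h /XY. Qed.

Lemma concat0 (p q : R -> pt) : concat p q 0 = p 0.
Proof. by rewrite /concat mulr0 invr_ge0 ler0n. Qed.

Lemma concat1 (p q : R -> pt) : concat p q 1 = q 1.
Proof.
rewrite /concat ifF ?mulr1; first by congr q; lra.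
by apply/negbTE; rewrite -ltNge; lra.
Qed.

Lemma rev0 p : rev p 0 = p 1. Proof. by rewrite /rev subr0. Qed.
Lemma rev1 p : rev p 1 = p 0. Proof. by rewrite /rev subrr. Qed.

Section HolPaths.
Variables (H : grp) (X : region) (c : pt -> pt -> H).
Hypothesis lc : LS X c.

(** The square [p (clamp (t - s))] has [p] and its reversal on two consecutive sides and is constant
    on the other two. *)
Lemma Hol_rev p : pth X p -> Hol c (rev p) = ginv (Hol c p).
Proof.
move=> pp; have [cp hp] := pp; pose h s t := p (clamp (t - s)).
have hh : sqr_in X h.
  split=> [|s t sI tI]; last exact/hp/clampI.
  apply/contI2_ctp => z; apply: ctp_path => //.
  by apply: ctD; [|apply: ctN]; apply: ct_clamp; [exact: ct_snd|exact: ct_fst].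
have := Hol_square lc hh.
have -> : Hol c (h 0) = Hol c p.
  by apply: (Hol_ext lc) => // t tI; rewrite /h subr0 clamp_id.
have -> : Hol c (h^~ 1) = Hol c (rev p).
  apply: (Hol_ext lc) => [|t tI]; first exact: pth_rev.
  by rewrite /h /rev clamp_id//; apply: unit_I_onem.
have e0 t : unit_I t -> p 0 = p (clamp (t - 1)).
  by move=> /andP[? ?]; rewrite clamp0//; lra.
have e1 t : unit_I t -> p 0 = p (clamp (0 - t)).
  by move=> /andP[? ?]; rewrite clamp0//; lra.
have Xp : X (p 0) by exact: hp.
rewrite (@Hol_ext _ _ _ _ (fun=> p 0) (h 1) lc) ?(@Hol_ext _ _ _ _ (fun=> p 0) (h^~ 0) lc);
  rewrite ?(Hol_cst lc)// ?gmul1; try exact: pth_cst.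
by move/ginv_eq.
Qed.

(** A local system is recovered from its holonomies along short segments; comparisons of local
    systems thereby reduce to comparisons along paths. *)
Lemma Hol_seg_near x r y z : cocycle_near c x r -> near_pt x r y -> near_pt x r z ->
  Hol c (seg y z) = c y z.
Proof.
move=> hc hy hz; apply: Hol_eq; exists 0%N => n _ n0.
rewrite (@holn_cocycle _ _ _ x r)//.
  by rewrite divff ?seg0 ?seg1// pnatr_eq0; lia.
move=> i ni; apply: near_pt_convex => //; rewrite /unit_I divr_ge0//=.
by rewrite ler_pdivrMr ?ltr0n// mul1r ler_nat.
Qed.

End HolPaths.

Definition joined (X : region) x y : Prop :=
  exists p, [/\ pth X p, p 0 = x & p 1 = y].

(* Freeness of pi_1, with homomorphisms replaced by holonomies of local systems. *)
Definition LSfree (X : region) (x0 : pt) : Prop :=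
  [/\ X x0, forall y, X y -> joined X x0 y &
   exists (I : Type) (gen : I -> R -> pt), (forall i, loop X x0 (gen i)) /\
   forall (H : grp) (a : I -> H),
     (exists c, LS X c /\ forall i, Hol c (gen i) = a i) /\
     (forall c1 c2 : pt -> pt -> H, LS X c1 -> LS X c2 ->
        (forall i, Hol c1 (gen i) = Hol c2 (gen i)) ->
        forall g, loop X x0 g -> Hol c1 g = Hol c2 g)].

Lemma near_nbhs (x : pt) (P : pt -> Prop) : (\forall y \near x, P y) ->
  exists2 r, 0 < r & forall y, near_pt x r y -> P y.
Proof.
move=> /nbhs_ballP[r /= r0 h]; exists r => // y hy.
by apply: h; split=> // i j; rewrite (ord1 i) /ball/= distrC; exact: hy.
Qed.

Lemma ctp_id (x : pt) : ctp x (fun y => y).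
Proof. by move=> i; apply: coord_continuous. Qed.

(* Joint continuity of [D] at the points of [unit_I x U], tested on families of
   points so that no topology on the product of the line and the space is needed. *)
Definition cth (U : region) (D : R -> pt -> pt) : Prop :=
  forall (T : topologicalType) (z : T) (u : T -> R) (F : T -> pt),
    ct z u -> ctp z F -> unit_I (u z) -> U (F z) -> ctp z (fun w => D (u w) (F w)).

Lemma cth_square (U Y : region) D p : cth U D -> pth U p ->
  (forall u x, unit_I u -> U x -> Y (D u x)) -> sqr_in Y (fun s t => D s (p t)).
Proof.
move=> cD [cp hp] UY; split=> [|s t sI tI]; last by apply: UY => //; apply: hp.
apply/contI2_ctp => z; apply: cD.
- by apply: ct_clamp; exact: ct_fst.
- by apply: ctp_path => //; exact: ct_snd.
- exact: clampI.
- exact/hp/clampI.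
Qed.

Lemma cth_near (U : region) D u x r : cth U D -> unit_I u -> U x -> 0 < r ->
  exists2 d, 0 < d & forall y, near_pt x d y -> near_pt (D u x) r (D u y).
Proof.
move=> cD uI Ux r0.
have h : ctp x (fun y => D u y).
  by apply: (cD _ x (fun=> u)) => //; [exact: ct_cst|exact: ctp_id].
exact: near_nbhs (ctp_near r0 h).
Qed.

Lemma LS_pull (U Y : region) D u (H : grp) (c : pt -> pt -> H) : cth U D -> unit_I u ->
  (forall x, U x -> Y (D u x)) -> LS Y c -> LS U (fun y z => c (D u y) (D u z)).
Proof.
move=> cD uI UY lc x Ux; have [r r0 hc] := lc _ (UY _ Ux).
have [d d0 hd] := cth_near cD uI Ux r0.
by exists d => // y z w /hd ? /hd ? /hd ?; apply: hc.
Qed.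

(** The finite products agree term by term; the case analysis covers paths on which both sides take
    the default value. *)
Lemma Hol_pull (H : grp) (c : pt -> pt -> H) (phi : pt -> pt) p :
  Hol (fun y z => c (phi y) (phi z)) p = Hol c (fun t => phi (p t)).
Proof.
have E n k : holn (fun y z => c (phi y) (phi z)) p n k = holn c (fun t => phi (p t)) n k.
  by elim: k => //= k ->.
have E' v : is_hol (fun y z => c (phi y) (phi z)) p v <-> is_hol c (fun t => phi (p t)) v.
  by split=> -[N hN]; exists N => n Nn n0; rewrite -?(hN n Nn n0) E.
have [[v hv]|nv] := pselect (exists v, is_hol c (fun t => phi (p t)) v).
  by rewrite (Hol_eq hv) (Hol_eq (proj2 (E' v) hv)).
rewrite /Hol; case: pselect => [e|_]; last by case: pselect.
by case: nv; case: e => v /E' hv; exists v.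
Qed.

Section Deformation.
Variables (U N : region) (x0 : pt) (D : R -> pt -> pt).
Hypotheses (cD : cth U D) (NU : forall x, N x -> U x)
  (D0 : forall x, U x -> D 0 x = x) (DU : forall u x, unit_I u -> U x -> U (D u x))
  (DN : forall u x, unit_I u -> N x -> N (D u x)) (D1 : forall x, U x -> N (D 1 x))
  (Dx0 : forall u, unit_I u -> D u x0 = x0).

(** The two sides of the square traced by the base point are constant. The region [Y] is a parameter
    because the lemma is applied both to [U] and to [N]. *)
Lemma Hol_deform (Y : region) (H : grp) (c : pt -> pt -> H) g :
  (forall x, Y x -> U x) -> (forall u x, unit_I u -> Y x -> Y (D u x)) ->
  LS Y c -> loop Y x0 g -> Hol c (fun t => D 1 (g t)) = Hol c g.
Proof.
move=> YU DY lc lg; have pg := pth_loop lg; have [_ [g0 [g1 hg]]] := lg.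
have cDY : cth Y D by move=> T z u F hu hF uI /YU; apply: cD.
have Yx0 : Y x0 by rewrite -g0; apply: hg.
have hh := cth_square cDY pg DY.
have := Hol_square lc hh.
rewrite (@Hol_ext _ _ _ _ g (D 0 \o g) lc) => [||t /hg /YU /D0 //]; last by [].
rewrite (@Hol_ext _ _ _ _ (fun=> x0) (fun t => D t (g 1)) lc);
    [|exact: pth_cst|by move=> t /Dx0; rewrite g1].
rewrite (@Hol_ext _ _ _ _ (fun=> x0) (fun t => D t (g 0)) lc);
    [|exact: pth_cst|by move=> t /Dx0; rewrite g0].
by rewrite !(Hol_cst lc Yx0) gmulr1 gmul1 => ->.
Qed.

(** A weak deformation retraction suffices: [D] keeps [N] inside itself, possibly moving its points,
    and [D 1] is a homotopy inverse of the inclusion of [N] into [U]. The generators stay the same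
    loops. *)
Lemma LSfree_deform : LSfree N x0 -> LSfree U x0.
Proof.
move=> [Nx0 jN [I [gen [lgen ugen]]]]; split; first exact: NU.
  move=> y Uy; have [p [pp p0 p1]] := jN _ (D1 Uy).
  have pD : pth U (fun s => D s y).
    by have [] := sqr_ver (cth_square cD (pth_cst Uy) DU) (unit_I0 _).
  have pU := sub_pth NU pp.
  exists (concat p (rev (fun s => D s y))); split.
  - by apply: pth_concat => //; [exact: pth_rev|rewrite rev0 p1].
  - by rewrite concat0.
  - by rewrite concat1 rev1 D0.
exists I, gen; split=> [i|H a]; first exact: sub_loop (lgen i).
have [[c [lc hc]] u] := ugen H a; split.
  exists (fun y z => c (D 1 y) (D 1 z)); split=> [|i]; first exact: LS_pull lc.
  by rewrite Hol_pull -hc; apply: Hol_deform lc _.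
move=> c1 c2 l1 l2 e g lg.
rewrite -(@Hol_deform U _ c1)// -(@Hol_deform U _ c2)//.
apply: (u c1 c2) => //; [exact: sub_LS l1|exact: sub_LS l2|].
have [cg [g0 [g1 hg]]] := lg.
apply: loop_pth; rewrite ?g0 ?g1 ?Dx0//.
have [cs _] := sqr_hor (cth_square cD (pth_loop lg) DU) (unit_I1 _).
by split=> // t tI; apply/D1/hg.
Qed.

End Deformation.

End LocalSystems.

(** * A van Kampen theorem *)

Section VanKampen.
Variable R : realType.
Notation pt := (Defs.point R).
Notation region := (pt -> Prop).
Hint Resolve unit_I0 unit_I1 : core.

Lemma seg_seg (y z : pt) s t : seg y (seg y z t) s = seg y z (s * t).
Proof. by apply/rowP => i; rewrite !segE; ring. Qed.

Lemma unit_IM (s t : R) : unit_I s -> unit_I t -> unit_I (s * t).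
Proof. by rewrite /unit_I => /andP[? ?] /andP[? ?]; apply/andP; split; nra. Qed.

Lemma Hol_trivial (H : grp) (p : R -> pt) : Hol (fun _ _ => gone : H) p = gone.
Proof.
by apply: Hol_eq; exists 0%N => n _ _; elim: {2}n => //= k ->; rewrite gmul1.
Qed.

(** The [C k] are the components of the intersection of [A] and [B]; [None] is the reference one and
    each of the others creates one free generator. The contraction [E k] runs in [A], not in [C k]:
    a component may carry loops as long as they die in [A]. The removal of the ray relies on this,
    with [K] empty. *)
Variables (A B : region) (x0 : pt) (K : Type) (C : option K -> region)
  (b e : option K -> pt) (E : option K -> R -> pt -> pt).
Hypotheses (oA : open_region A) (oB : open_region B) (cB : convex_region B)
  (Cb : forall k, C k (b k)) (CA : forall k y, C k y -> A y)
  (CB : forall k y, C k y -> B y) (ABC : forall y, A y -> B y -> exists k, C k y)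
  (Cdisj : forall k k' y, C k y -> C k' y -> k = k')
  (Cj : forall k y, C k y -> joined (C k) (b k) y)
  (Csep : forall k y z, C k y ->
     (forall t, unit_I t -> A (seg y z t) /\ B (seg y z t)) -> C k z)
  (cE : forall k, cth (C k) (E k)) (E0 : forall k y, C k y -> E k 0 y = y)
  (E1 : forall k y, C k y -> E k 1 y = e k)
  (EA : forall k u y, unit_I u -> C k y -> A (E k u y)).

Let X : region := fun x => A x \/ B x.
Let AX x : A x -> X x. Proof. by left. Qed.
Let BX x : B x -> X x. Proof. by right. Qed.

Let C_seg k y z : C k y -> (forall t, unit_I t -> A (seg y z t)) -> B z ->
  pth (C k) (seg y z).
Proof.
move=> Cy hA Bz; split=> [|t tI]; first exact: contI_seg.
apply: (Csep Cy) => s sI; rewrite seg_seg; split.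
  by apply/hA/unit_IM.
by apply: cB (CB Cy) Bz _; apply: unit_IM.
Qed.

Section Existence.
Variables (H : grp) (cA : pt -> pt -> H) (a : K -> H) (tau : option K -> R -> pt).
Hypotheses (lA : LS A cA) (ptau : forall k, pth A (tau k))
  (tau1 : forall k, tau k 1 = b k).

(** A potential of [cA] on the component [C k]: transport along the contraction track of [y]. *)
Let theta k y := Hol cA (fun u => E k u y).

Let theta_seg k y z : pth (C k) (seg y z) -> Hol cA (seg y z) ** theta k z = theta k y.
Proof.
move=> ps; have [_ hs] := ps.
have Cy : C k y by rewrite -(seg0 y z); apply: hs.
have Cz : C k z by rewrite -(seg1 y z); apply: hs.
have hh : sqr_in A (fun s t => E k s (seg y z t)).
  by apply: (cth_square (@cE k) ps) => u x; apply: EA.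
have := Hol_square lA hh; rewrite seg0 seg1.
have Ae : A (e k) by rewrite -(E1 Cy); apply: EA.
rewrite (@Hol_ext _ _ _ _ (seg y z) (fun t => E k 0 (seg y z t)) lA); first last.
- by move=> t /hs /E0.
- exact: sub_pth (CA (k := k)) ps.
rewrite (@Hol_ext _ _ _ _ (fun=> e k) (fun t => E k 1 (seg y z t)) lA); first last.
- by move=> t /hs /E1.
- exact: pth_cst.
by rewrite (Hol_cst lA Ae) gmulr1.
Qed.

(** Over the convex [B] the extension is the coboundary of a function [beta]. On each component the
    potential [theta] determines [beta] up to a left factor [m k], and this freedom realizes the
    prescribed value [a k]. *)
Lemma vk_exists : exists c : pt -> pt -> H, LS X c /\
  (forall p, pth A p -> Hol c p = Hol cA p) /\
  (forall k, Hol c (concat (tau None) (concat (seg (b None) (b (Some k))) (rev (tau (Some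
      k))))) = a k).
Proof.
pose a' k := if k is Some k' then a k' else gone.
(* With this factor [beta (b k)] equals [a' k ** Hol cA (tau k)], so the loop through the component
   [Some k] has holonomy [a k]. *)
pose m k := a' k ** Hol cA (tau k) ** theta k (b k).
have /choice[beta hbeta] (y : pt) :
    exists v, forall k, C k y -> v = m k ** ginv (theta k y).
  have [[k Cy]|nC] := pselect (exists k, C k y); last by exists gone => k Cy; case: nC; exists k.
  by exists (m k ** ginv (theta k y)) => k' /(Cdisj Cy) <-.
pose SA y z := forall t, unit_I t -> A (seg y z t).
(* The two branches agree for endpoints in [B] whose segment lies in [A]: by convexity of [B] the
   segment then stays in one component. *)
pose c y z := if pselect (SA y z) is left _ then Hol cA (seg y z) else ginv (beta y) ** beta z.
have cinA x : A x -> exists2 r, 0 < r & cocycle_near cA x r /\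
    forall y z, near_pt x r y -> near_pt x r z -> c y z = cA y z.
  move=> Ax; have [r1 r10 h1] := oA Ax; have [r2 r20 h2] := lA Ax.
  exists (Num.min r1 r2); first by rewrite lt_min r10.
  have n1 y : near_pt x (Num.min r1 r2) y -> near_pt x r1 y.
    by move=> h i; have := h i; rewrite lt_min => /andP[].
  have n2 y : near_pt x (Num.min r1 r2) y -> near_pt x r2 y.
    by move=> h i; have := h i; rewrite lt_min => /andP[].
  split=> [y z w /n2 ? /n2 ? /n2 ?|y z yx zx]; first exact: h2.
  rewrite /c; case: pselect => [_|]; first by apply: (Hol_seg_near h2); apply: n2.
  by case=> t tI; apply: h1; apply: near_pt_convex => //; apply: n1.
have cinB y z : B y -> B z -> c y z = ginv (beta y) ** beta z.
  move=> By Bz; rewrite /c; case: pselect => // yz.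
  have Ay : A y by rewrite -(seg0 y z); apply: yz.
  have [k Cy] := ABC Ay By; have ps := C_seg Cy yz Bz.
  have Cz : C k z by rewrite -(seg1 y z); apply: (proj2 ps).
  by rewrite (hbeta _ _ Cy) (hbeta _ _ Cz) !gsimp -(theta_seg ps) !gsimp.
have lc : LS X c.
  move=> x [/cinA[r r0 [h hr]]|/oB[r r0 hr]]; exists r => //.
    by move=> y z w yx zx wx; rewrite !hr//; apply: h.
  by move=> y z w /hr ? /hr ? /hr ?; rewrite !cinB// !gsimp.
have HA p : pth A p -> Hol c p = Hol cA p.
  move=> pp; rewrite (@Hol_gauge _ _ A cA c (fun=> gone)) ?gsimp//.
  by move=> x /cinA[r r0 [_ h]]; exists r => // y z yx zx; rewrite !gsimp h.
exists c; split=> //; split=> // k.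
have ps : pth B (seg (b None) (b (Some k))) by apply: pth_seg cB (CB (Cb _)) (CB (Cb _)).
have p1 := sub_pth AX (ptau None); have p2 := sub_pth BX ps.
have p3 := sub_pth AX (pth_rev (ptau (Some k))).
have j1 : seg (b None) (b (Some k)) 1 = rev (tau (Some k)) 0 by rewrite seg1 rev0 tau1.
rewrite (Hol_concat lc p1 (pth_concat p2 p3 j1)) ?concat0 ?seg0// (Hol_concat lc p2 p3 j1).
rewrite (HA _ (ptau None)) (HA _ (pth_rev (ptau (Some k)))).
rewrite (Hol_rev lA)// (@Hol_gauge _ _ B (fun _ _ => gone) c beta)//; first last.
- by move=> x /oB[r r0 hr]; exists r => // y z /hr By /hr Bz; rewrite cinB// gmulr1.
- by move=> x _; exists 1 => // y z w _ _ _; rewrite gmul1.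
by rewrite Hol_trivial seg0 seg1 (hbeta _ _ (Cb _)) (hbeta _ _ (Cb _)) /m /= !gsimp.
Qed.

End Existence.

Section Uniqueness.
Variables (H : grp) (c1 c2 : pt -> pt -> H) (tau : pt -> R -> pt).
Hypotheses (l1 : LS X c1) (l2 : LS X c2) (ptau : forall y, A y -> pth A (tau y))
  (tau0 : forall y, A y -> tau y 0 = x0) (tau1 : forall y, A y -> tau y 1 = y)
  (Ax0 : A x0)
  (eqA : forall g, loop A x0 g -> Hol c1 g = Hol c2 g)
  (eqK : forall k, let g := concat (tau (b None)) (concat (seg (b None) (b (Some k))) (rev (tau
      (b (Some k)))))
     in Hol c1 g = Hol c2 g).

(** The gauge transformation that must carry [c1] to [c2], found by transport from the base point.
    Agreement on the loops of [A] makes it compatible with every path in [A]; [gB] continues it from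
    [b None] across the convex [B]. *)
Let gA y := ginv (Hol c1 (tau y)) ** Hol c2 (tau y).
Let gB y := ginv (Hol c1 (seg (b None) y)) ** gA (b None) ** Hol c2 (seg (b None) y).

Let lA1 := sub_LS AX l1.
Let lA2 := sub_LS AX l2.
Let lB1 := sub_LS BX l1.
Let lB2 := sub_LS BX l2.

Let gA_path p : pth A p -> Hol c2 p = ginv (gA (p 0)) ** Hol c1 p ** gA (p 1).
Proof.
move=> pp; have [_ hp] := pp; have A0 := hp _ (unit_I0 _); have A1 := hp _ (unit_I1 _).
have p3 := pth_rev (ptau A1).
have j : p 1 = rev (tau (p 1)) 0 by rewrite rev0 tau1.
have p23 := pth_concat pp p3 j.
have j' : tau (p 0) 1 = concat p (rev (tau (p 1))) 0 by rewrite concat0 tau1.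
have := @eqA (concat (tau (p 0)) (concat p (rev (tau (p 1))))).
rewrite (Hol_concat lA1 (ptau A0) p23 j') (Hol_concat lA2 (ptau A0) p23 j').
rewrite (Hol_concat lA1 pp p3 j) (Hol_concat lA2 pp p3 j).
rewrite (Hol_rev lA1 (ptau A1)) (Hol_rev lA2 (ptau A1)) => h.
have {}h := h (loop_pth (pth_concat (ptau A0) p23 j') _ _).
rewrite !concat0 !concat1 rev1 !tau0// in h.
have {h} := h erefl erefl.
move=> /(congr1 (fun v => ginv (Hol c2 (tau (p 0))) ** v ** Hol c2 (tau (p 1)))).
by rewrite /gA !gsimp => <-.
Qed.

Let gB_path p : pth B p -> Hol c2 p = ginv (gB (p 0)) ** Hol c1 p ** gB (p 1).
Proof.
move=> pp; have [cp hp] := pp; have B0 := hp _ (unit_I0 _); have B1 := hp _ (unit_I1 _).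
have Bb : B (b None) := CB (Cb None).
have hh : sqr_in B (fun s t => seg (b None) (p s) t).
  split=> [|s t /hp ? tI]; last exact: cB.
  apply/contI2_ctp => z; apply: ctp_seg; first exact: ctp_cst.
    by apply: ctp_path => //; exact: ct_fst.
  by apply: ct_clamp; exact: ct_snd.
have S (c : pt -> pt -> H) : LS B c ->
    Hol c (seg (b None) (p 0)) ** Hol c p = Hol c (seg (b None) (p 1)).
  move=> lc; have := Hol_square lc hh.
  rewrite (@Hol_ext _ _ _ _ p (fun s => seg (b None) (p s) 1) lc) => [||t _]; first last.
  - by rewrite seg1.
  - by [].
  rewrite (@Hol_ext _ _ _ _ (fun=> b None) (fun s => seg (b None) (p s) 0) lc) => [||t _];
      first last.
  - by rewrite seg0.
  - exact: pth_cst.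
  by rewrite (Hol_cst lc Bb) gmul1 => ->.
by rewrite /gB -(S _ lB1) -(S _ lB2) !gsimp.
Qed.

(** Both gauges transform alike along paths in a component, so it is enough to compare them at
    [b k]. For [None] they agree by construction, for [Some k] because [c1] and [c2] agree on the
    new generator. *)
Let gAB y : A y -> B y -> gA y = gB y.
Proof.
move=> Ay By; have [k Cy] := ABC Ay By.
have [p [pp p0 p1]] := Cj Cy.
have pA := sub_pth (CA (k := k)) pp; have pB := sub_pth (CB (k := k)) pp.
suff bk : gA (b k) = gB (b k).
  have := gB_path pB; rewrite (gA_path pA) p0 p1 bk !gsimp.
  by do 5!move/gmul_cancel.
case: k {Cy pp p0 pA pB} => [k|]; last first.
  have Bb : B (b None) := CB (Cb None).
  rewrite /gB (@Hol_ext _ _ _ _ (fun=> b None) _ lB1) => [||t _]; first last.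
  - by rewrite seg_same.
  - exact: pth_cst.
  rewrite (@Hol_ext _ _ _ _ (fun=> b None) _ lB2) => [||t _]; first last.
  - by rewrite seg_same.
  - exact: pth_cst.
  by rewrite !(Hol_cst _ Bb)// !gsimp.
have ps : pth B (seg (b None) (b (Some k))) by apply: pth_seg cB (CB (Cb _)) (CB (Cb _)).
have A0 : A (b None) := CA (Cb _); have A1 : A (b (Some k)) := CA (Cb _).
have q1 := sub_pth AX (ptau A0); have q2 := sub_pth BX ps.
have q3 := sub_pth AX (pth_rev (ptau A1)).
have j : seg (b None) (b (Some k)) 1 = rev (tau (b (Some k))) 0 by rewrite seg1 rev0 tau1.
have j' : tau (b None) 1 = concat (seg (b None) (b (Some k))) (rev (tau (b (Some k)))) 0.
  by rewrite concat0 seg0 tau1.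
have := eqK k; rewrite /= (Hol_concat l1 q1 (pth_concat q2 q3 j) j').
rewrite (Hol_concat l2 q1 (pth_concat q2 q3 j) j') (Hol_concat l1 q2 q3 j) (Hol_concat l2 q2 q3 j).
rewrite (Hol_rev lA1 (ptau A1)) (Hol_rev lA2 (ptau A1)) /gB /gA => h.
have := congr1 (fun v => ginv (Hol c1 (seg (b None) (b (Some k)))) ** (ginv (Hol c1 (tau (b
    None))) ** v ** Hol c2 (tau (b (Some k))))) h.
by rewrite !gsimp.
Qed.

Lemma vk_unique g : loop X x0 g -> Hol c1 g = Hol c2 g.
Proof.
move=> lg; pose G y := if pselect (A y) is left _ then gA y else gB y.
have GA y : A y -> G y = gA y by rewrite /G; case: pselect.
have GB y : B y -> G y = gB y.
  by move=> By; rewrite /G; case: pselect => // Ay; apply: gAB.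
have near_min x r1 r2 y : near_pt x (Num.min r1 r2) y -> near_pt x r1 y /\ near_pt x r2 y.
  by move=> h; split=> i; have := h i; rewrite lt_min => /andP[].
rewrite (@Hol_gauge _ _ X c1 c2 G _ (pth_loop lg))//.
  have [_ [-> [-> _]]] := lg; rewrite GA//.
  (* The path chosen for [x0] is a loop in [A], on which [c1] and [c2] agree; hence the gauge is
     trivial at the base point. *)
  have lt : loop A x0 (tau x0) by apply: loop_pth; [exact: ptau|exact: tau0|exact: tau1].
  by rewrite /gA (eqA lt) !gsimp.
move=> x Xx; have [r1 r10 h1] := l1 Xx; have [r2 r20 h2] := l2 Xx.
have [r3 r30 h3] : exists2 r, 0 < r & (forall y, near_pt x r y ->
    A y) \/ (forall y, near_pt x r y -> B y).
  by case: Xx => [/oA|/oB][r r0 hr]; exists r => //; [left|right].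
exists (Num.min r1 (Num.min r2 r3)); first by rewrite !lt_min r10 r20.
move=> y z /near_min[y1 /near_min[y2 y3]] /near_min[z1 /near_min[z2 z3]].
rewrite -(Hol_seg_near h2 y2 z2) -(Hol_seg_near h1 y1 z1).
case: h3 => h3.
  have ps : pth A (seg y z).
    by split=> [|t tI]; [exact: contI_seg|apply/h3/near_pt_convex].
  by rewrite (gA_path ps) seg0 seg1 !GA//; apply: h3.
have ps : pth B (seg y z).
  by split=> [|t tI]; [exact: contI_seg|apply/h3/near_pt_convex].
by rewrite (gB_path ps) seg0 seg1 !GB//; apply: h3.
Qed.

End Uniqueness.

Theorem LSfree_union : LSfree A x0 -> LSfree (fun x => A x \/ B x) x0.
Proof.
move=> [Ax0 jA [I [gen [lgen ugen]]]].
have /choice[tau htau] (y : pt) :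
    exists p, A y -> [/\ pth A p, p 0 = x0 & p 1 = y].
  have [Ay|nA] := pselect (A y); last by exists (fun=> y).
  by have [p hp] := jA _ Ay; exists p.
have ptau y : A y -> pth A (tau y) by move=> /htau[].
have tau0 y : A y -> tau y 0 = x0 by move=> /htau[].
have tau1 y : A y -> tau y 1 = y by move=> /htau[].
have Ab k : A (b k) := CA (Cb k); have Bb k : B (b k) := CB (Cb k).
have pseg y : B y -> pth X (seg (b None) y) by move=> By; apply: sub_pth BX _; apply: pth_seg.
split; first by left.
  move=> y [Ay|By].
    by exists (tau y); split; [exact: sub_pth AX (ptau _ Ay)|exact: tau0|exact: tau1].
  exists (concat (tau (b None)) (seg (b None) y)); split.
  - apply: pth_concat; [exact: sub_pth AX (ptau _ (Ab _))|exact: pseg|].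
    by rewrite seg0 tau1.
  - by rewrite concat0 tau0.
  - by rewrite concat1 seg1.
pose nw k := concat (tau (b None)) (concat (seg (b None) (b (Some k))) (rev (tau (b (Some k))))).
exists (I + K)%type, (fun i => match i with inl i => gen i | inr k => nw k end); split.
  case=> [i|k]; first exact: sub_loop AX (lgen i).
  have q1 := sub_pth AX (ptau _ (Ab None)); have q2 := pseg _ (Bb (Some k)).
  have q3 := sub_pth AX (pth_rev (ptau _ (Ab (Some k)))).
  rewrite /nw; apply: loop_pth; rewrite ?concat0 ?concat1 ?rev1 ?tau0//.
  apply: pth_concat => //; last by rewrite concat0 seg0 tau1.
  by apply: pth_concat => //; rewrite seg1 rev0 tau1.
move=> H a; split.
  have [[cA [lA hA]] _] := ugen H (fun i => a (inl i)).
  have [||c [lc [hc hk]]] := @vk_exists H cA (fun k => a (inr k)) (fun k => tau (b k)) lA.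
  - by move=> k; apply: ptau.
  - by move=> k; apply: tau1.
  exists c; split=> // -[i|k]; last exact: hk.
  by rewrite hc ?hA//; apply: pth_loop (lgen i).
move=> c1 c2 l1 l2 h g lg.
apply: (@vk_unique H c1 c2 tau) => //.
  apply: (proj2 (ugen H (fun i => a (inl i)))); [exact: sub_LS AX l1|exact: sub_LS AX l2|].
  by move=> i; apply: (h (inl i)).
by move=> k; apply: (h (inr k)).
Qed.

End VanKampen.

(** * Path homotopies *)

Section PathHomotopy.
Variable R : realType.
Notation pt := (Defs.point R).
Notation region := (pt -> Prop).
Hint Resolve unit_I0 unit_I1 : core.
Variable X : region.
Implicit Types p q : R -> pt.

Definition phom p q : Prop :=
  exists h, [/\ sqr_in X h, forall t, unit_I t -> h 0 t = p t,
    forall t, unit_I t -> h 1 t = q t,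
    forall s, unit_I s -> h s 0 = p 0 & forall s, unit_I s -> h s 1 = p 1].

Lemma phom_pthl p q : phom p q -> pth X p.
Proof. by move=> [h [hh e _ _ _]]; apply: pth_ext e _; apply: sqr_hor. Qed.

Lemma phom_pthr p q : phom p q -> pth X q.
Proof. by move=> [h [hh _ e _ _]]; apply: pth_ext e _; apply: sqr_hor. Qed.

Lemma phom0 p q : phom p q -> q 0 = p 0.
Proof. by move=> [h [_ _ e1 e _]]; rewrite -e1// e. Qed.

Lemma phom1 p q : phom p q -> q 1 = p 1.
Proof. by move=> [h [_ _ e1 _ e]]; rewrite -e1// e. Qed.

(** The parameters are interpolated linearly. Associativity, units and inverses below are all
    comparisons of two reparametrizations of a single path. *)
Lemma phom_reparam p (al be : R -> R) : pth X p ->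
  (forall t, ct t (fun w => al (clamp w))) -> (forall t, ct t (fun w => be (clamp w))) ->
  (forall t, unit_I t -> unit_I (al t)) -> (forall t, unit_I t -> unit_I (be t)) ->
  al 0 = be 0 -> al 1 = be 1 -> phom (p \o al) (p \o be).
Proof.
move=> [cp hp] ca cb aI bI e0 e1.
exists (fun s t => p (clamp ((1 - s) * al t + s * be t))); split.
- split=> [|s t _ _]; last exact/hp/clampI.
  apply/contI2_ctp => z; apply: ctp_path => //.
  have hs : ct z (fun w : R * R => clamp w.1) by apply: ct_clamp; exact: ct_fst.
  have hc (f : R -> R) : (forall t, ct t (fun w => f (clamp w))) ->
      ct z (fun w : R * R => f (clamp w.2)).
    by move=> hf; apply: (@ct_comp _ _ _ snd (fun w => f (clamp w))) => //; exact: ct_snd.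
  by apply: ctD; apply: ctM; rewrite ?hs//; [apply: ctD;
      [exact: ct_cst|exact: ctN]|exact: hc|exact: hc].
- by move=> t tI; rewrite subr0 mul1r mul0r addr0 clamp_id//; apply: aI.
- by move=> t tI; rewrite subrr mul1r mul0r add0r clamp_id//; apply: bI.
- by move=> s _; rewrite -e0 -mulrDl subrK mul1r clamp_id//; apply: aI.
- by move=> s _; rewrite -e1 -mulrDl subrK mul1r clamp_id//; apply: aI.
Qed.

Lemma phom_ext p q p' q' : (forall t, unit_I t -> p t = p' t) ->
  (forall t, unit_I t -> q t = q' t) -> phom p q -> phom p' q'.
Proof.
move=> pp qq [h [hh e0 e1 e2 e3]]; exists h; split=> //.
- by move=> t tI; rewrite e0// pp.
- by move=> t tI; rewrite e1// qq.
- by move=> s sI; rewrite e2// pp.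
- by move=> s sI; rewrite e3// pp.
Qed.

Lemma phom_refl p : pth X p -> phom p p.
Proof.
have ci t : ct t (fun w : R => clamp w) by apply: ct_clamp; exact: ct_id.
by move=> pp; apply: (phom_reparam pp ci ci).
Qed.

Lemma phom_concat p p' q q' : phom p p' -> phom q q' -> p 1 = q 0 ->
  phom (concat p q) (concat p' q').
Proof.
move=> [h [[ch hX] h0 h1 h2 h3]] [k [[ck kX] k0 k1 k2 k3]] e.
have ehk s : unit_I s -> h s 1 = k s 0 by move=> sI; rewrite h3// k2.
exists (fun s => concat (h s) (k s)); split.
- split; last first.
    move=> s t sI /andP[t0 t1]; rewrite /concat; case: ifPn => [?|]; [|rewrite -ltNge => ?].
      by apply: hX => //; rewrite /unit_I; lra.
    by apply: kX => //; rewrite /unit_I; lra.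
  apply/contI2_ctp => z.
  apply: (@ctp_ext _ _ _ (fun w => h (clamp w.1) (clamp (2 * clamp w.2)) +
      k (clamp w.1) (clamp (2 * clamp w.2 - 1)) - h (clamp w.1) (clamp 1))).
    by move=> w; rewrite concat_sum ?(@clamp_id _ 1)//; [apply: ehk|]; exact: clampI.
  have c2 : ct z (fun w : R * R => clamp w.2) by apply: ct_clamp; exact: ct_snd.
  apply: ctpD; [apply: ctpD|apply: ctpN]; apply: ctp_square => //; try exact: ct_fst.
  + by apply: ctM => //; exact: ct_cst.
  + by apply: ctD; [apply: ctM => //|]; exact: ct_cst.
  + exact: ct_cst.
- move=> t /andP[t0 t1]; rewrite /concat; case: ifPn => [?|]; [|rewrite -ltNge => ?].
    by apply: h0; rewrite /unit_I; lra.
  by apply: k0; rewrite /unit_I; lra.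
- move=> t /andP[t0 t1]; rewrite /concat; case: ifPn => [?|]; [|rewrite -ltNge => ?].
    by apply: h1; rewrite /unit_I; lra.
  by apply: k1; rewrite /unit_I; lra.
- by move=> s sI; rewrite !concat0 h2.
- by move=> s sI; rewrite !concat1 k3.
Qed.

Let ct_cl (t : R) : ct t (fun w : R => clamp w).
Proof. by apply: ct_clamp; exact: ct_id. Qed.

Let ct_aff (a d t : R) : ct t (fun w => a * clamp w + d).
Proof. by apply: ctD; [apply: ctM; [exact: ct_cst|exact: ct_cl]|exact: ct_cst]. Qed.

Lemma phom_assoc p q r : pth X p -> pth X q -> pth X r -> p 1 = q 0 -> q 1 = r 0 ->
  phom (concat (concat p q) r) (concat p (concat q r)).
Proof.
move=> pp pq pr e1 e2.
(* The piecewise linear map with slopes 1/2, 1, 2 and breakpoints 1/2, 3/4 that changes one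
   bracketing into the other. It is convex, hence a maximum of its affine pieces, which makes its
   continuity immediate. *)
pose al t : R := Num.max (Num.max (2^-1 * t + 0) (1 * t + - 4^-1)) (2 * t + - 1).
have P : pth X (concat (concat p q) r).
  by apply: pth_concat => //; [apply: pth_concat|rewrite concat1].
have alE t : unit_I t -> [\/ [/\ t <= 2^-1 & al t = 2^-1 * t],
    [/\ 2^-1 < t, t <= 3/4 & al t = t - 4^-1] | [/\ 3/4 < t & al t = 2 * t - 1]].
  move=> /andP[t0 t1]; have [h|h] := leP t 2^-1; [constructor 1|have [h'|h'] := leP t (3/4);
      [constructor 2|constructor 3]];
    split=> //; rewrite /al.
  - by rewrite (max_idPl (_ : 1 * t + - 4^-1 <= 2^-1 * t + 0)) ?(max_idPl (_ : 2 * t + - 1 <=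
      2^-1 * t + 0)); lra.
  - by rewrite (max_idPr (_ : 2^-1 * t + 0 <= 1 * t + - 4^-1)) ?(max_idPl (_ : 2 * t + - 1 <= 1
      * t + - 4^-1)); lra.
  - by rewrite (max_idPr (_ : 2^-1 * t + 0 <= 1 * t + - 4^-1)) ?(max_idPr (_ : 1 * t + - 4^-1
      <= 2 * t + - 1)); lra.
have alI t : unit_I t -> unit_I (al t).
  by move=> tI; have := tI; rewrite /unit_I; case: (alE t tI) => -[] => [?|??|?] -> /andP[? ?]; lra.
apply: (@phom_ext (concat (concat p q) r \o id) (concat (concat p q) r \o al)) => //; first last.
- apply: phom_reparam => //.
  + by move=> t; rewrite /al; apply: ct_max; [apply: ct_max|]; exact: ct_aff.
  + by case: (alE 0) => //-[] => [?|??|?] ->; lra.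
  + by case: (alE 1) => //-[] => [?|??|?] ->; lra.
move=> t tI /=; have /andP[t0 t1] := tI.
case: (alE t tI) => -[] => [?|??|?] ->; rewrite /concat.
- rewrite ifT; last lra. rewrite ifT; last lra. rewrite ifT; last lra.
  by congr p; field.
- rewrite ifT; last lra. rewrite ifF; last lra. rewrite ifF; last lra. rewrite ifT; last lra.
  by congr q; field.
- rewrite ifF; last lra. rewrite ifF; last lra. rewrite ifF; last lra.
  by congr r; field.
Qed.

Lemma phom_cst_l p x : pth X p -> p 0 = x -> phom (concat (fun=> x) p) p.
Proof.
move=> pp <-; apply: (@phom_ext (p \o (fun t => Num.max 0 (2 * t + - 1))) (p \o id)) => //.
  move=> t /andP[t0 t1] /=; rewrite /concat; case: ifPn => [?|]; [|rewrite -ltNge => ?].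
    by rewrite (max_idPl _)//; lra.
  by rewrite (max_idPr _)//; lra.
apply: phom_reparam => //.
- by move=> t; apply: ct_max; [exact: ct_cst|exact: ct_aff].
- by move=> t /andP[t0 t1]; rewrite /unit_I le_max lexx /= ge_max; lra.
- by rewrite (max_idPl _)//; lra.
- by rewrite (max_idPr _); lra.
Qed.

Lemma phom_revl p : pth X p -> phom (concat (rev p) p) (fun=> p 1).
Proof.
move=> pp; apply: (@phom_ext (p \o (fun t => `|2 * t + - 1|)) (p \o (fun=> 1))) => //.
  move=> t /andP[t0 t1] /=; rewrite /concat /rev; case: ifPn => [?|]; [|rewrite -ltNge => ?].
    by rewrite ler0_norm; [congr p; lra|lra].
  by rewrite ger0_norm//; lra.
apply: phom_reparam => //.
- by move=> t; apply: ct_norm; exact: ct_aff.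
- by move=> t; exact: ct_cst.
- by move=> t /andP[t0 t1]; rewrite /unit_I normr_ge0 ler_norml; lra.
- by rewrite mulr0 add0r normrN normr1.
- by rewrite ger0_norm; lra.
Qed.

Lemma phom_convex (W : region) p q : convex_region W -> (forall x, W x -> X x) ->
  pth W p -> pth W q -> p 0 = q 0 -> p 1 = q 1 -> phom p q.
Proof.
move=> cW WX [cp hp] [cq hq] e0 e1; exists (fun s t => seg (p t) (q t) s); split.
- split=> [|s t sI tI]; last by apply/WX/cW => //; [exact: hp|exact: hq].
  apply/contI2_ctp => z; apply: ctp_seg; try (by apply: ctp_path => //; exact: ct_snd).
  by apply: ct_clamp; exact: ct_fst.
- by move=> t _; rewrite seg0.
- by move=> t _; rewrite seg1.
- by move=> s _; rewrite -e0 seg_same.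
- by move=> s _; rewrite -e1 seg_same.
Qed.

Lemma phom_loop x0 p q : phom p q -> loop X x0 p -> loop_homotopic X x0 p q /\ loop X x0 q.
Proof.
move=> pq [_ [p0 [p1 _]]]; split; last first.
  by apply: loop_pth; [exact: phom_pthr pq|rewrite (phom0 pq)|rewrite (phom1 pq)].
have [h [[ch hX] h0 h1 h2 h3]] := pq; exists h; split=> //; split.
  by move=> t tI; rewrite h0 ?h1.
by split=> // s sI; rewrite h2 ?h3.
Qed.

End PathHomotopy.

(** * From local systems to the fundamental group *)

Section HomToLS.
Variable R : realType.
Notation pt := (Defs.point R).
Notation region := (pt -> Prop).
Hint Resolve unit_I0 unit_I1 : core.
Variables (X : region) (x0 : pt) (H : grp) (phi : (R -> pt) -> H) (tau : pt -> R -> pt).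
Hypotheses (oX : open_region X) (Xx0 : X x0) (hphi : is_pi1_hom X x0 (@gmul H) phi)
  (ptau : forall y, X y -> pth X (tau y)) (tau0 : forall y, X y -> tau y 0 = x0)
  (tau1 : forall y, X y -> tau y 1 = y) (taux0 : tau x0 = fun=> x0).

Let phiE p q : phom X p q -> loop X x0 p -> phi p = phi q.
Proof.
by move=> pq lp; have [h lq] := phom_loop pq lp; apply: (proj1 hphi).
Qed.

(** Closes an arbitrary path up to a loop at [x0], so that [phi] extends to a functor on all
    paths. *)
Let lp (p : R -> pt) := concat (tau (p 0)) (concat p (rev (tau (p 1)))).

Let pthX p t : pth X p -> unit_I t -> X (p t).
Proof. by move=> [_ h] /h. Qed.

Let lp_loop p : pth X p -> loop X x0 (lp p).
Proof.
move=> pp; have X0 := pthX pp (unit_I0 _); have X1 := pthX pp (unit_I1 _).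
rewrite /lp; apply: loop_pth; rewrite ?concat0 ?concat1 ?rev1 ?tau0//.
apply: pth_concat; [exact: ptau| |by rewrite concat0 tau1].
by apply: pth_concat => //; [exact/pth_rev/ptau|rewrite rev0 tau1].
Qed.

Let lp_phom p q : phom X p q -> phi (lp p) = phi (lp q).
Proof.
move=> pq; have pp := phom_pthl pq.
have X0 := pthX pp (unit_I0 _); have X1 := pthX pp (unit_I1 _).
apply: phiE; last exact: lp_loop.
rewrite /lp (phom0 pq) (phom1 pq); apply: phom_concat;
    [exact/phom_refl/ptau| |by rewrite concat0 tau1].
by apply: phom_concat => //; [exact/phom_refl/pth_rev/ptau|rewrite rev0 tau1].
Qed.

(** The return trip to [x0] in the middle cancels. The path [r] stands for any representative of the
    concatenation, such as a straight segment or an initial piece of a loop. *)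
Let lp_mul p q r : pth X p -> pth X q -> p 1 = q 0 -> phom X (concat p q) r ->
  phi (lp p) ** phi (lp q) = phi (lp r).
Proof.
move=> pp pq e hr; have X0 := pthX pp (unit_I0 _); have X1 := pthX pp (unit_I1 _).
have Xq := pthX pq (unit_I1 _).
rewrite -(lp_phom hr) -(proj2 hphi) ?/lp; [|exact: lp_loop..].
rewrite concat0 concat1 -e.
set T := tau (p 0); set s := tau (p 1); set w := rev (tau (q 1)).
have pT : pth X T by apply: ptau.
have ps : pth X s by apply: ptau.
have prs := pth_rev ps.
have pw : pth X w by apply/pth_rev/ptau.
have T1 : T 1 = p 0 by apply: tau1.
have T0 : T 0 = x0 by apply: tau0.
have s1 : s 1 = p 1 by apply: tau1.
have s0 : s 0 = x0 by apply: tau0.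
have w0 : w 0 = q 1 by rewrite /w rev0 tau1.
have w1 : w 1 = x0 by rewrite /w rev1 tau0.
have pqw : pth X (concat q w) by apply: pth_concat.
have psqw : pth X (concat s (concat q w)) by apply: pth_concat; rewrite ?concat0 -?e.
have ends := (concat0, concat1, rev0, rev1).
have lo a : pth X a -> a 0 = p 0 -> a 1 = x0 -> loop X x0 (concat T a).
  by move=> pa a0 a1; apply: loop_pth; rewrite ?ends//; apply: pth_concat; rewrite ?a0.
have p1 : pth X (concat p (rev s)) by apply: pth_concat; rewrite ?ends.
have p2 : pth X (concat (rev s) s) by apply: pth_concat; rewrite ?ends.
have p3 : pth X (concat (rev s) (concat s (concat q w))) by apply: pth_concat; rewrite ?ends.
have Tc a b : phom X a b -> a 0 = p 0 -> a 1 = x0 -> phi (concat T a) = phi (concat T b).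
  move=> ab a0 a1; apply: phiE; last exact: lo (phom_pthl ab) a0 a1.
  by apply: phom_concat => //; [exact: phom_refl|rewrite a0].
have pc a b : phom X a b -> a 0 = p 1 -> phom X (concat p a) (concat p b).
  by move=> ab a0; apply: phom_concat => //; exact: phom_refl.
transitivity (phi (concat T (concat (concat p (rev s)) (concat s (concat q w))))).
  apply: phiE; first by apply: phom_assoc; rewrite ?ends.
  apply: loop_pth; rewrite ?ends//; apply: pth_concat; rewrite ?ends//.
  by apply: pth_concat; rewrite ?ends//.
transitivity (phi (concat T (concat p (concat (rev s) (concat s (concat q w)))))).
  by apply: Tc; rewrite ?ends//; apply: phom_assoc; rewrite ?ends.
transitivity (phi (concat T (concat p (concat (concat (rev s) s) (concat q w))))).
  apply/esym/Tc; rewrite ?ends//; apply: pc; rewrite ?ends//.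
  by apply: phom_assoc; rewrite ?ends -?e.
transitivity (phi (concat T (concat p (concat (fun=> s 1) (concat q w))))).
  apply: Tc; rewrite ?ends//; apply: pc; rewrite ?ends//.
  by apply: phom_concat; rewrite ?ends -?e//; [exact: phom_revl|exact: phom_refl].
transitivity (phi (concat T (concat p (concat q w)))).
  apply: Tc; rewrite ?ends//; apply: pc; rewrite ?ends//.
  by apply: phom_cst_l; rewrite ?ends -?e.
apply/esym/Tc; rewrite ?ends//.
exact: phom_assoc.
Qed.

(** The segment may leave [X] when [y] and [z] are far apart; only the values at nearby points
    matter to [LS] and [Hol]. *)
Let c y z := phi (lp (seg y z)).

Lemma hom_LS : LS X c.
Proof.
move=> x Xx; have [r r0 hr] := oX Xx; exists r => // y z w hy hz hw.
have ps a b : near_pt x r a -> near_pt x r b -> pth (near_pt x r) (seg a b).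
  by move=> ha hb; apply: pth_seg => //; exact: near_pt_convex.
apply: lp_mul; try (by apply: sub_pth hr _; apply: ps); rewrite ?seg0 ?seg1//.
apply: (phom_convex (@near_pt_convex _ x r) hr); rewrite ?concat0 ?concat1 ?seg0 ?seg1//.
  by apply: pth_concat; rewrite ?seg0 ?seg1//; apply: ps.
exact: ps.
Qed.

Let phi_cst : phi (fun=> x0) = gone.
Proof.
apply: gidem; rewrite -(proj2 hphi).
- by congr phi; apply/funext => t; rewrite /concat; case: ifP.
- by apply: loop_pth => //; exact: pth_cst.
- by apply: loop_pth => //; exact: pth_cst.
Qed.

Lemma hom_Hol g : loop X x0 g -> Hol c g = phi g.
Proof.
move=> lg; have pg := pth_loop lg; have [cg [g0 [g1 hg]]] := lg.
have [N hN] := fine_grid oX pg; have [M hM] := HolP hom_LS pg.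
pose n := (N + M).+1; rewrite -(hM n)//; last by rewrite /n; lia.
have {}hN := hN n (ltac:(rewrite /n; lia)) isT.
have n0 : (0 < n)%N by []. 
move: n n0 hN => n n0 hN {hM}.
have nR0 : 0 < n%:R :> R by rewrite ltr0n.
pose sub a d t := g (a + t * (d - a)).
have psub a d : unit_I a -> unit_I d -> pth X (sub a d).
  move=> aI dI.
  have sI t : unit_I t -> unit_I (a + t * (d - a)).
    move: aI dI; rewrite /unit_I => /andP[? ?] /andP[? ?] /andP[? ?]; apply/andP; split; nra.
  split=> [|t /sI /hg//]; apply/contI_ctp => t.
  apply: (@ctp_ext _ _ _ (fun w => g (clamp (a + clamp w * (d - a))))).
    by move=> w; rewrite (@clamp_id _ (a + _))//; apply/sI/clampI.
  apply: ctp_path => //; apply: ctD; first exact: ct_cst.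
  by apply: ctM; [apply: ct_clamp; exact: ct_id|exact: ct_cst].
have kI k : (k <= n)%N -> unit_I (k%:R / n%:R : R).
  by move=> kn; rewrite /unit_I divr_ge0//= ler_pdivrMr// mul1r ler_nat.
(* Partial products correspond to initial pieces of [g]. At the end the closing paths are constant
   because of [taux0]. *)
suff E k : (k <= n)%N -> holn c g n k = phi (lp (sub 0 (k%:R / n%:R))).
  rewrite E// divff ?gt_eqF//.
  have -> : sub 0 1 = g by apply/funext => t; rewrite /sub add0r subr0 mulr1.
  have lr : loop X x0 (fun=> x0) by apply: loop_pth => //; exact: pth_cst.
  rewrite /lp g0 g1 taux0 /rev !(proj2 hphi) ?phi_cst ?gsimp//.
  apply: loop_pth; rewrite ?concat0 ?concat1//.
  by apply: pth_concat => //; exact: pth_loop lr.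
elim: k => [_|k IH kn] /=.
  have -> : sub 0 (0%:R / n%:R) = fun=> x0.
    by apply/funext => t; rewrite /sub mul0r subr0 mulr0 addr0.
  have pc := pth_cst Xx0; apply/esym/gidem/lp_mul => //.
  by apply: phom_cst_l.
rewrite IH 1?ltnW//; set a := k%:R / n%:R; set d := k.+1%:R / n%:R.
have aI : unit_I a by apply/kI/ltnW.
have dI : unit_I d by apply/kI.
have ad : a <= d by rewrite ler_pM2r ?invr_gt0// ler_nat.
have [x [r [hX hr]]] := hN _ kn.
have e0 : sub a d 0 = g a by rewrite /sub mul0r addr0.
have e1 : sub a d 1 = g d by rewrite /sub mul1r addrC subrK.
have -> : c (g a) (g d) = phi (lp (sub a d)).
  apply: lp_phom; apply: (phom_convex (@near_pt_convex _ x r) hX); rewrite ?seg0 ?seg1 ?e0 ?e1//.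
    by apply: pth_seg; [exact: near_pt_convex|apply: hr; rewrite lexx ad|apply: hr;
        rewrite lexx ad].
  split=> [|t /andP[t0 t1]]; first by have [] := psub _ _ aI dI.
  by apply: hr; rewrite -/a -/d; apply/andP; split; nra.
apply: lp_mul; [exact: psub|exact: psub| |].
  by rewrite e0 /sub mul1r add0r subr0.
(* Running through the piece from 0 to [a] and then the one from [a] to [d] is a reparametrization
   of the piece from 0 to [d]. *)
apply: (@phom_ext _ _ (g \o (fun t => a * clamp (2 * t) + (d - a) * clamp (2 * t - 1)))
  (g \o (fun t => t * d))).
- move=> t /andP[t0 t1] /=; rewrite /concat; case: ifPn => [?|]; [|rewrite -ltNge => ?].
    rewrite (@clamp0 _ (2 * t - 1)) ?clamp_id /unit_I; [|lra..].
    by rewrite /sub; congr g; ring.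
  rewrite (@clamp1 _ (2 * t)) ?clamp_id /unit_I; [|lra..].
  by rewrite /sub; congr g; ring.
- by move=> t _ /=; rewrite /sub add0r subr0.
have cl t : ct t (fun w : R => clamp w) by apply: ct_clamp; exact: ct_id.
apply: phom_reparam => //.
- move=> t; apply: ctD; (apply: ctM; [exact: ct_cst|apply: ct_clamp]).
    by apply: ctM => //; exact: ct_cst.
  by apply: ctD; [apply: ctM => //|]; exact: ct_cst.
- by move=> t; apply: ctM => //; exact: ct_cst.
- move=> t _; have := clampI (2 * t); have := clampI (2 * t - 1); move: aI dI.
  move: (clamp _) (clamp _) => u v.
  rewrite /unit_I => /andP[? ?] /andP[? ?] /andP[? ?] /andP[? ?]; apply/andP; split; nra.
- move=> t; move: dI; rewrite /unit_I => /andP[? ?] /andP[? ?]; apply/andP; split; nra.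
- by rewrite mulr0 !clamp0 ?mulr0 ?addr0 ?mul0r//; lra.
- by rewrite !clamp1 ?mulr1 ?mul1r; lra.
Qed.

End HomToLS.

(** * Freeness of the fundamental group; change of base point and of region *)

Section FreePi1.
Variable R : realType.
Notation pt := (Defs.point R).
Notation region := (pt -> Prop).
Hint Resolve unit_I0 unit_I1 : core.

Lemma Hol_pi1_hom (X : region) (H : grp) (c : pt -> pt -> H) x0 :
  LS X c -> is_pi1_hom X x0 (@gmul H) (Hol c).
Proof.
move=> lc; split=> g1 g2 l1 l2; last first.
  apply: (Hol_concat lc); [exact: pth_loop l1|exact: pth_loop l2|].
  by have [_ [_ [-> _]]] := l1; have [_ [-> _]] := l2.
move=> [h [ch [h01 [hb hX]]]].
have Xx0 : X x0 by have [_ [<- [_ hg]]] := l1; apply: hg.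
have hh : sqr_in X h by split.
have := Hol_square lc hh.
rewrite (@Hol_ext _ _ _ _ g1 (h 0) lc (pth_loop l1)) => [|t /h01[]//].
rewrite (@Hol_ext _ _ _ _ g2 (h 1) lc (pth_loop l2)) => [|t /h01[]//].
rewrite (@Hol_ext _ _ _ _ (fun=> x0) (h^~ 0) lc (pth_cst Xx0)) => [|t /hb[]//].
rewrite (@Hol_ext _ _ _ _ (fun=> x0) (h^~ 1) lc (pth_cst Xx0)) => [|t /hb[]//].
by rewrite (Hol_cst lc Xx0) gmulr1 gmul1.
Qed.

(** Existence takes the holonomy of a local system as homomorphism. For uniqueness both
    homomorphisms are first turned into local systems, with a common choice of paths that is
    constant at [x0]. *)
Lemma LSfree_pi1_free (X : region) x0 : open_region X -> LSfree X x0 -> pi1_free X x0.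
Proof.
move=> oX [Xx0 jX [I [gen [lgen ugen]]]]; exists I, gen; split=> // H mul one inv mA m1 mV a.
pose G := Grp mA m1 mV.
have [[c [lc hc]] u] := ugen G a; split.
  by exists (Hol c); split; [exact: (@Hol_pi1_hom X G)|exact: hc].
move=> phi1 phi2 h1 e1 h2 e2 g lg.
have /choice[tau htau] (y : pt) : exists p, X y ->
    [/\ pth X p, p 0 = x0, p 1 = y & y = x0 -> p = fun=> x0].
  have [->|yx] := pselect (y = x0); first by exists (fun=> x0) => _; split=> //; exact: pth_cst.
  have [Xy|nX] := pselect (X y); last by exists (fun=> y).
  by have [p [? ? ?]] := jX _ Xy; exists p.
have t1 y : X y -> pth X (tau y) by move=> /htau[].
have t2 y : X y -> tau y 0 = x0 by move=> /htau[].
have t3 y : X y -> tau y 1 = y by move=> /htau[].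
have t4 : tau x0 = fun=> x0 by have [_ _ _] := htau _ Xx0; apply.
have l1 := @hom_LS R X x0 G phi1 tau oX h1 t1 t2 t3.
have l2 := @hom_LS R X x0 G phi2 tau oX h2 t1 t2 t3.
have E1 := @hom_Hol R X x0 G phi1 tau oX Xx0 h1 t1 t2 t3 t4.
have E2 := @hom_Hol R X x0 G phi2 tau oX Xx0 h2 t1 t2 t3 t4.
rewrite -E1// -E2//; apply: (u _ _ l1 l2) => // i.
by rewrite E1// E2// e1 e2.
Qed.

Lemma LS_conj (X : region) (H : grp) (c : pt -> pt -> H) (v : H) : LS X c ->
  LS X (fun y z => ginv v ** c y z ** v) /\
  forall p, pth X p -> Hol (fun y z => ginv v ** c y z ** v) p = ginv v ** Hol c p ** v.
Proof.
move=> lc; split=> [x /lc[r r0 h]|p pp].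
  by exists r => // y z w ? ? ?; rewrite -(h y z w)// !gsimp.
by rewrite (@Hol_gauge _ _ X c _ (fun=> v))// => x _; exists 1.
Qed.

(** Moving the generators along [d] conjugates their holonomies by [Hol c d]; a constant gauge
    transformation undoes this. *)
Lemma LSfree_base (X : region) x0 x1 : X x1 -> LSfree X x0 -> LSfree X x1.
Proof.
move=> Xx1 [Xx0 jX [I [gen [lgen ugen]]]].
have [d [pd d0 d1]] := jX _ Xx1; have pr := pth_rev pd.
split=> //.
  move=> y /jX[p [pp p0 p1]]; exists (concat (rev d) p); split.
  - by apply: pth_concat => //; rewrite rev1 d0 p0.
  - by rewrite concat0 rev0.
  - by rewrite concat1.
pose gen' i := concat (rev d) (concat (gen i) d).
have pg i : pth X (gen i) := pth_loop (lgen i).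
have g0 i : gen i 0 = x0 by have [_ [-> _]] := lgen i.
have g1 i : gen i 1 = x0 by have [_ [_ [-> _]]] := lgen i.
have pgd i : pth X (concat (gen i) d) by apply: pth_concat => //; rewrite g1.
have j i : rev d 1 = concat (gen i) d 0 by rewrite rev1 concat0 g0.
have HG (H : grp) (c : pt -> pt -> H) i : LS X c ->
    Hol c (gen' i) = ginv (Hol c d) ** Hol c (gen i) ** Hol c d.
  move=> lc; rewrite (Hol_concat lc pr (pgd i) (j i)) (Hol_concat lc) ?g1//.
  by rewrite (Hol_rev lc) ?gsimp.
exists I, gen'; split=> [i|H a].
  by rewrite /gen'; apply: loop_pth; rewrite ?concat0 ?concat1 ?rev0//; exact: pth_concat (j i).
have [[c [lc hc]] u] := ugen H a; split.
  have [lc' hc'] := LS_conj (ginv (Hol c d)) lc.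
  exists (fun y z => ginv (ginv (Hol c d)) ** c y z ** ginv (Hol c d)); split=> // i.
  by rewrite HG// !hc'// hc !gsimp.
move=> c1 c2 l1 l2 e g lg.
have [l1' h1] := LS_conj (Hol c1 d) l1; have [l2' h2] := LS_conj (Hol c2 d) l2.
have pg' := pth_loop lg; have [_ [gg0 [gg1 _]]] := lg.
have jg : g 1 = rev d 0 by rewrite rev0 d1.
have jd : d 1 = concat g (rev d) 0 by rewrite concat0 gg0.
have := u _ _ l1' l2' _ (concat d (concat g (rev d))).
have pgr := pth_concat pg' pr jg; have pall := pth_concat pd pgr jd.
rewrite (h1 _ pall) (h2 _ pall).
rewrite (Hol_concat l1 pd pgr jd) (Hol_concat l2 pd pgr jd) (Hol_concat l1 pg' pr jg)
    (Hol_concat l2 pg' pr jg).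
rewrite (Hol_rev l1 pd) (Hol_rev l2 pd) !gsimp; apply.
  by move=> i; rewrite h1// h2// -!HG.
by apply: loop_pth; rewrite ?concat0 ?concat1 ?rev1.
Qed.

Lemma LSfree_homeo (X Y : region) (phi psi : pt -> pt) y0 :
  cth X (fun _ => phi) -> cth Y (fun _ => psi) ->
  (forall x, X x -> Y (phi x)) -> (forall y, Y y -> X (psi y)) ->
  (forall x, X x -> psi (phi x) = x) -> (forall y, Y y -> phi (psi y) = y) ->
  LSfree Y y0 -> LSfree X (psi y0).
Proof.
move=> cphi cpsi XY YX fK Kf [Yy0 jY [I [gen [lgen ugen]]]].
have push p : pth Y p -> pth X (fun t => psi (p t)).
  move=> pp; apply: (@sqr_hor _ X (fun _ t => psi (p t)) 0) => //.
  by apply: (cth_square cpsi pp) => _ y _; apply: YX.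
have pull p : pth X p -> pth Y (fun t => phi (p t)).
  move=> pp; apply: (@sqr_hor _ Y (fun _ t => phi (p t)) 0) => //.
  by apply: (cth_square cphi pp) => _ y _; apply: XY.
split; first exact: YX.
  move=> x Xx; have [p [pp p0 p1]] := jY _ (XY _ Xx).
  by exists (fun t => psi (p t)); rewrite p0 p1 fK//; split=> //; apply: push.
exists I, (fun i t => psi (gen i t)); split=> [i|H a].
  have [_ [g0 [g1 _]]] := lgen i.
  by apply: loop_pth; rewrite ?g0 ?g1//; apply: push (pth_loop (lgen i)).
have [[c [lc hc]] u] := ugen H a; split.
  exists (fun y z => c (phi y) (phi z)); split.
    exact: (@LS_pull _ X Y (fun _ => phi) 0 H c cphi (unit_I0 _) XY lc).
  move=> i; rewrite Hol_pull -hc; apply: (Hol_ext lc (pth_loop (lgen i))) => t tI.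
  by rewrite Kf//; have [_ [_ [_]]] := lgen i; apply.
move=> c1 c2 l1 l2 e g lg.
have l1' : LS Y (fun y z => c1 (psi y) (psi z)) 
  by exact: (@LS_pull _ Y X (fun _ => psi) 0 H c1 cpsi (unit_I0 _) YX l1).
have l2' : LS Y (fun y z => c2 (psi y) (psi z)) 
  by exact: (@LS_pull _ Y X (fun _ => psi) 0 H c2 cpsi (unit_I0 _) YX l2).
have := u _ _ l1' l2' _ (fun t => phi (g t)).
have [_ [g0 [g1 hg]]] := lg.
have E (c' : pt -> pt -> H) : LS X c' -> Hol c' (fun t => psi (phi (g t))) = Hol c' g.
  by move=> lc'; apply: (Hol_ext lc' (pth_loop lg)) => t /hg /fK.
rewrite (Hol_pull c1) (Hol_pull c2) !E//; apply.
  by move=> i; rewrite (Hol_pull c1) (Hol_pull c2).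
by apply: loop_pth; [exact: pull (pth_loop lg)|rewrite g0 Kf|rewrite g1 Kf].
Qed.

Lemma LSfree_convex (X : region) x0 : convex_region X -> X x0 -> LSfree X x0.
Proof.
move=> cX Xx0; split=> //.
  by move=> y Xy; exists (seg x0 y); rewrite seg0 seg1; split=> //; exact: pth_seg.
exists void, (fun i : void => match i with end); split=> [[]|H a]; split.
  by exists (fun _ _ => gone); split=> [x _|[]]; exists 1 => // y z w _ _ _; rewrite gmul1.
have triv (c : pt -> pt -> H) g : LS X c -> loop X x0 g -> Hol c g = gone.
  move=> lc lg; rewrite -(Hol_cst lc Xx0).
  have pg := pth_loop lg; have [_ [g0 [g1 _]]] := lg.
  have hg : phom X g (fun=> x0).
    by apply: (@phom_convex _ X X) => //; exact: pth_cst.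
  have [lh ll] := phom_loop hg lg.
  exact: (proj1 (Hol_pi1_hom x0 lc)).
by move=> c1 c2 l1 l2 _ g lg; rewrite !triv.
Qed.

End FreePi1.

(** * Passing a level *)

Section Coordinates.
Variable R : realType.
Notation pt := (Defs.point R).
Notation region := (pt -> Prop).

Definition i1 : 'I_3 := @Ordinal 3 1 isT.
Definition i2 : 'I_3 := @Ordinal 3 2 isT.
Definition px (p : pt) : R := p ord0 ord0.
Definition py (p : pt) : R := p ord0 i1.
Definition ph (p : pt) : R := p ord0 i2.
Definition mk (a b d : R) : pt := \row_(i < 3) nth 0 [:: a; b; d] i.

Lemma px_mk a b d : px (mk a b d) = a. Proof. by rewrite /px mxE. Qed.
Lemma py_mk a b d : py (mk a b d) = b. Proof. by rewrite /py mxE. Qed.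
Lemma ph_mk a b d : ph (mk a b d) = d. Proof. by rewrite /ph mxE. Qed.

Lemma ord3 (i : 'I_3) : [\/ i = ord0, i = i1 | i = i2].
Proof.
by case: i => -[|[|[|//]]] h; [constructor 1|constructor 2|constructor 3]; apply: val_inj.
Qed.

Lemma mkE p : mk (px p) (py p) (ph p) = p.
Proof. by apply/rowP => i; rewrite mxE; have [->|->|->] := ord3 i. Qed.

Lemma px_seg p q t : px (seg p q t) = (1 - t) * px p + t * px q.
Proof. exact: segE. Qed.
Lemma py_seg p q t : py (seg p q t) = (1 - t) * py p + t * py q.
Proof. exact: segE. Qed.
Lemma ph_seg p q t : ph (seg p q t) = (1 - t) * ph p + t * ph q.
Proof. exact: segE. Qed.

Lemma ctp_mk (T : topologicalType) (z : T) (a b d : T -> R) :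
  ct z a -> ct z b -> ct z d -> ctp z (fun w => mk (a w) (b w) (d w)).
Proof.
move=> ha hb hd i; have [->|->|->] := ord3 i.
- by apply: ct_ext ha => w; rewrite mxE.
- by apply: ct_ext hb => w; rewrite mxE.
- by apply: ct_ext hd => w; rewrite mxE.
Qed.

Lemma open_pos (f : pt -> R) : (forall x, ct x f) -> open_region (fun x => 0 < f x).
Proof. by move=> cf x fx; apply: near_nbhs; apply: ct_gt. Qed.

Lemma open_and (X Y : region) : open_region X -> open_region Y ->
  open_region (fun x => X x /\ Y x).
Proof.
move=> oX oY x [/oX[r r0 h] /oY[r' r0' h']].
exists (Num.min r r'); first by rewrite lt_min r0.
by move=> y hy; split; [apply: h|apply: h'] => i; have := hy i; rewrite lt_min => /andP[].
Qed.

Lemma open_or (X Y : region) : open_region X -> open_region Y ->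
  open_region (fun x => X x \/ Y x).
Proof.
move=> oX oY x [/oX|/oY] [r r0 h]; exists r => // y hy; [left|right]; exact: h.
Qed.

Lemma open_forall (J : finType) (X : J -> region) : (forall j, open_region (X j)) ->
  open_region (fun x => forall j, X j x).
Proof.
move=> oX x Xx.
have /choice[r hr] (j : J) : exists r, 0 < r /\ forall y, near_pt x r y -> X j y.
  by have [r r0 h] := oX j x (Xx j); exists r.
pose m := \big[Num.min/1]_j r j.
exists m; first by apply: lt_bigmin => // j _; exact: (proj1 (hr j)).
move=> y hy j; apply: (proj2 (hr j)) => i; apply: (lt_le_trans (hy i)).
exact: bigmin_le_cond.
Qed.

Lemma open_ext (X Y : region) : (forall x, X x <-> Y x) -> open_region X -> open_region Y.
Proof.
by move=> XY oX x /XY/oX[r r0 h]; exists r => // y /h/XY.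
Qed.

Lemma LSfree_ext (X Y : region) x0 : (forall x, X x <-> Y x) -> LSfree X x0 -> LSfree Y x0.
Proof. by move=> XY; have -> : X = Y by apply/funext => x; apply/propext. Qed.

(** A one-handle: the convex [B] meets [A] in two convex pieces, giving one new generator. That no
    segment in [A] joins the pieces replaces a connectedness argument. *)
Lemma LSfree_handle (A B C1 C2 : region) b1 b2 x0 :
  open_region A -> open_region B -> convex_region B ->
  convex_region C1 -> convex_region C2 -> C1 b1 -> C2 b2 ->
  (forall x, A x /\ B x <-> C1 x \/ C2 x) -> (forall x, C1 x -> ~ C2 x) ->
  (forall y z, C1 y -> C2 z -> exists2 t, unit_I t & ~ A (seg y z t)) ->
  LSfree A x0 -> LSfree (fun x => A x \/ B x) x0.
Proof.
move=> oA oB cB cC1 cC2 Cb1 Cb2 AB dC sepC.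
pose C (k : option unit) : region := if k is Some _ then C2 else C1.
pose b (k : option unit) : pt := if k is Some _ then b2 else b1.
have cC k : convex_region (C k) by case: k.
have Cb k : C k (b k) by case: k.
have CAB k y : C k y -> A y /\ B y by case: k => [?|] h; apply/AB; [right|left].
apply: (@LSfree_union R A B x0 unit C b b (fun k u y => seg y (b k) u)) => //.
- by move=> k y /CAB[].
- by move=> k y /CAB[].
- by move=> y Ay By; have /AB[?|?] := conj Ay By; [exists None|exists (Some tt)].
- by move=> [[]|] [[]|] y //= h1 h2; case: (dC y).
- by move=> k y Cy; exists (seg (b k) y); rewrite seg0 seg1; split=> //; exact: pth_seg.
- move=> k y z Cy h.
  have [Az Bz] : A z /\ B z by rewrite -(seg1 y z); apply: h; exact: unit_I1.
  have /AB[Cz|Cz] := conj Az Bz; case: k Cy => [[]|] //= Cy.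
    have [t tI] := sepC _ _ Cz Cy; case.
    have -> : seg z y t = seg y z (1 - t) by apply/rowP => i; rewrite !segE; ring.
    by apply: (proj1 (h _ _)); apply: unit_I_onem.
  by have [t tI] := sepC _ _ Cy Cz; case; apply: (proj1 (h _ _)).
- by move=> k T z u F hu hF _ _; apply: ctp_seg => //; exact: ctp_cst.
- by move=> k y _; rewrite seg0.
- by move=> k y _; rewrite seg1.
- by move=> k u y uI Cy; apply: (proj1 (CAB k _ _)); apply: cC.
Qed.

End Coordinates.

(** * Gauges of rectangles *)

Section Gauge.
Variable R : realType.
Variables (al be ga de : R).
Hypotheses (al0 : 0 < al) (be0 : 0 < be) (ga0 : 0 < ga) (de0 : 0 < de).

(* Gauge of the rectangle ]-be, al[ x ]-de, ga[ about the origin. *)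
Definition gau (x y : R) : R :=
  Num.max (Num.max (x / al) (- x / be)) (Num.max (y / ga) (- y / de)).

Lemma gau_lt x y t : gau x y < t <->
  [/\ x < t * al, - x < t * be, y < t * ga & - y < t * de].
Proof.
rewrite /gau !gt_max !ltr_pdivrMr//; split.
  by move=> /andP[/andP[-> ->] /andP[-> ->]].
by move=> [-> -> -> ->].
Qed.

Lemma gau_le x y t : gau x y <= t <->
  [/\ x <= t * al, - x <= t * be, y <= t * ga & - y <= t * de].
Proof.
rewrite /gau !ge_max !ler_pdivrMr//; split.
  by move=> /andP[/andP[-> ->] /andP[-> ->]].
by move=> [-> -> -> ->].
Qed.

Lemma gau_ge0 x y : 0 <= gau x y.
Proof.
rewrite leNgt; apply/negP => /gau_lt[]; rewrite !mul0r; lra.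
Qed.

Lemma gau_eq0 x y : gau x y = 0 -> x = 0 /\ y = 0.
Proof.
move=> e; have /gau_le[] : gau x y <= 0 by rewrite e.
by rewrite !mul0r => ? ? ? ?; split; lra.
Qed.

Lemma gau_scale c x y : 0 <= c -> gau (c * x) (c * y) = c * gau x y.
Proof.
move=> c0; rewrite /gau (maxr_pMr _ _ c0) (maxr_pMr (x / al) _ c0) (maxr_pMr (y / ga) _ c0).
by rewrite !mulNr !mulrN !mulrA.
Qed.

(** Moving away from a point of an interval never leads back into the interval; used for the push
    away from a strand inside the cone. *)
Lemma norm_away (A w x c : R) : 1 <= c -> `|w| < A -> A < `|x| -> A < `|w + c * (x - w)|.
Proof.
rewrite ltr_norml => c1 /andP[w1 w2]; have [x0|x0] := leP 0 x.
  rewrite ger0_norm// => Ax; apply: lt_le_trans (ler_norm _); nra.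
rewrite ltr0_norm// => Ax; rewrite -normrN; apply: lt_le_trans (ler_norm _); nra.
Qed.

End Gauge.

Ltac ctt := lazymatch goal with
  | |- ct _ (fun w => Num.max (@?f w) (@?g w)) => apply: (@ct_max _ _ _ f g); ctt
  | |- ct _ (fun w => Num.min (@?f w) (@?g w)) => apply: (@ct_min _ _ _ f g); ctt
  | |- ct _ (fun w => @?f w + @?g w) => apply: (@ctD _ _ _ f g); ctt
  | |- ct _ (fun w => @?f w * @?g w) => apply: (@ctM _ _ _ f g); ctt
  | |- ct _ (fun w => - @?f w) => apply: (@ctN _ _ _ f); ctt
  | |- ct _ (fun w => `| @?f w |) => apply: (@ct_norm _ _ _ f); ctt
  | _ => first [assumption | exact: ct_cst | idtac]
  end.

Section Level.
Variable R : realType.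
Notation pt := (Defs.point R).
Notation region := (pt -> Prop).
Hint Resolve unit_I0 unit_I1 : core.

(* The conical shape of [G] in the slab of width [eps] around the level [t0]: from the
   centre [j] start upper strands with slopes [up j] and [k j] lower strands with
   slopes (with respect to the depth) [wx j n, wy j n], ordered by their first
   coordinate. *)
Variables (G : region) (t0 eps r M dl : R) (J : finType) (zx zy : J -> R)
  (up : J -> R -> R -> Prop) (k : J -> nat) (wx wy : J -> nat -> R) (x0 : pt).
Hypotheses (oG : open_region (fun p => ~ G p))
  (eps0 : 0 < eps) (M0 : 0 < M) (dl0 : 0 < dl) (Mr : 4 * (M * eps) < r)
  (zsep : forall i j, i != j -> 2 * r <= Num.max `|zx i - zx j| `|zy i - zy j|)
  (upM : forall j u v, up j u v -> `|u| < M /\ `|v| < M)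
  (loM : forall j n, (n < k j)%N -> `|wx j n| < M /\ `|wy j n| < M)
  (k0 : forall j, (0 < k j)%N)
  (wgap : forall j n, (n.+1 < k j)%N -> wx j n + 2 * dl <= wx j n.+1)
  (G_up : forall p, t0 < ph p < t0 + eps -> (G p <-> exists j u v,
     [/\ up j u v, px p = zx j + (ph p - t0) * u & py p = zy j + (ph p - t0) * v]))
  (G_at : forall p, ph p = t0 -> (G p <-> exists j, px p = zx j /\ py p = zy j))
  (G_lo : forall p, t0 - eps < ph p < t0 -> (G p <-> exists j n,
     [/\ (n < k j)%N, px p = zx j + (t0 - ph p) * wx j n &
       py p = zy j + (t0 - ph p) * wy j n]))
  (x0_high : t0 + eps <= ph x0).

Definition above (t : R) : region := fun p => t < ph p /\ ~ G p.

Let rho (j : J) (p : pt) : R := Num.max `|px p - zx j| `|py p - zy j|.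

Let r0 : 0 < r. Proof. by have := mulr_gt0 M0 eps0; have := Mr; lra. Qed.

Ltac slra := have := eps0; have := M0; have := dl0; have := Mr; have := r0;
    have := mulr_gt0 M0 eps0; have := x0_high; move=> *; lra.


Let rho_sep i j p : i != j -> 2 * r <= rho i p + rho j p.
Proof.
move=> /zsep h; apply: (le_trans h); rewrite ge_max; apply/andP; split.
  have -> : zx i - zx j = (px p - zx j) - (px p - zx i) by ring.
  by apply: (le_trans (ler_normB _ _)); rewrite addrC lerD// le_max lexx.
have -> : zy i - zy j = (py p - zy j) - (py p - zy i) by ring.
by apply: (le_trans (ler_normB _ _)); rewrite addrC lerD// le_max lexx orbT.
Qed.

Let rho_ge0 j p : 0 <= rho j p.
Proof. by rewrite le_max normr_ge0. Qed.

(* The complement of [G] with a closed cone removed below each centre. *)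
Definition cored : region := fun p =>
  [/\ t0 - eps / 2 < ph p, ~ G p & forall j, ph p <= t0 -> M * (t0 - ph p) < rho j p].

Let ct_px (T : topologicalType) (z : T) (F : T -> pt) : ctp z F -> ct z (fun w => px (F w)).
Proof. by move=> h; apply: h. Qed.
Let ct_py (T : topologicalType) (z : T) (F : T -> pt) : ctp z F -> ct z (fun w => py (F w)).
Proof. by move=> h; apply: h. Qed.
Let ct_ph (T : topologicalType) (z : T) (F : T -> pt) : ctp z F -> ct z (fun w => ph (F w)).
Proof. by move=> h; apply: h. Qed.

Let ct_rho (T : topologicalType) (z : T) (F : T -> pt) j :
  ctp z F -> ct z (fun w => rho j (F w)).
Proof. by move=> h; have := ct_px h; have := ct_py h => h1 h2; rewrite /rho; ctt. Qed.

Lemma open_cored : open_region cored.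
Proof.
(* The condition imposed at or below the level becomes positivity of a maximum whose first entry is
   positive exactly above the level. *)
apply: (@open_ext _ (fun p => (0 < ph p - (t0 - eps / 2) /\ ~ G p) /\
    forall j, 0 < Num.max (ph p - t0) (rho j p - M * (t0 - ph p)))).
  move=> p; split=> [[[h1 h2] h3]|[h1 h2 h3]]; split=> //; try lra.
  - by move=> j hp; have := h3 j; rewrite lt_max; case/orP; lra.
  - by split=> //; lra.
  - move=> j; rewrite lt_max; have [hp|hp] := leP (ph p) t0; last by rewrite subr_gt0 hp.
    by rewrite [X in _ || X]subr_gt0 (h3 j hp) orbT.
apply: open_and.
  apply: open_and => //; apply: (@open_pos _ (fun p => ph p - (t0 - eps / 2))) => x.
  by have := ct_ph (@ctp_id R x) => h; ctt.
apply: open_forall => j.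
apply: (@open_pos _ (fun p => Num.max (ph p - t0) (rho j p - M * (t0 - ph p)))) => x.
by have := ct_ph (@ctp_id R x) => h; have := @ct_rho _ _ _ j (@ctp_id R x) => h'; ctt.
Qed.

Let cyl p : (forall j, r <= rho j p) \/
  exists i, rho i p < r /\ forall j, j != i -> r <= rho j p.
Proof.
have [[i hi]|h] := pselect (exists i, rho i p < r); [right|left].
  exists i; split=> // j ji; have := rho_sep p ji; lra.
by move=> j; rewrite leNgt; apply/negP => hj; apply: h; exists j.
Qed.

Let rho_mk j a b d : rho j (mk a b d) = Num.max `|a - zx j| `|b - zy j|.
Proof. by rewrite /rho px_mk py_mk. Qed.

Let up_lt j u v s x y : up j u v -> 0 < s -> x = zx j + s * u -> y = zy j + s * v ->
  Num.max `|x - zx j| `|y - zy j| < M * s.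
Proof.
move=> /upM[hu hv] s0 -> ->; rewrite ![_ + _ * _ - _]addrAC !subrr !add0r !normrM (gtr0_norm s0).
by rewrite gt_max [M * s]mulrC !ltr_pM2l// hu.
Qed.

Let lo_lt j n s x y : (n < k j)%N -> 0 < s -> x = zx j + s * wx j n ->
  y = zy j + s * wy j n -> Num.max `|x - zx j| `|y - zy j| < M * s.
Proof.
move=> /loM[hu hv] s0 -> ->; rewrite ![_ + _ * _ - _]addrAC !subrr !add0r !normrM (gtr0_norm s0).
by rewrite gt_max [M * s]mulrC !ltr_pM2l// hu.
Qed.

(** * Raising the cored region above the level *)

Section Lift.
Variable t1 : R.
Hypotheses (t01 : t0 <= t1) (t1e : t1 < t0 + eps).

(** Strictly between [t1 - t0] and [eps]: raising all relative heights below [c] to [c] lands above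
    [t1] and fixes everything from height [eps] on, in particular the base point. *)
Let c : R := (t1 - t0 + eps) / 2.
Let sg (u s : R) : R := s + u * Num.max 0 (c - s).
Let cut0 (s : R) : R := M * Num.min (Num.max s 0) eps.
(** Let a and b be the values of [cut0] before and after the rise. Then [1 + fac] is b/a within
    radius a, and outside it makes the new radius the affine function of the old one that takes a to
    b and fixes [r]. The removed cone keeps the points at or below the level off the axis, so that
    the denominator is positive on [cored]. *)
Let fac (u : R) (j : J) (p : pt) : R :=
  let s := ph p - t0 in let m := Num.max (rho j p) (cut0 s) in
  (cut0 (sg u s) - cut0 s) * Num.max (r - m) 0 / (m * (r - cut0 s)).

(* At height [s] above the level, the square annulus between radii [M s^+] and [r]
   around each centre is stretched onto the one between [M sg^+] and [r], and its
   inside, which contains the upper strands, is rescaled. *)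
Definition lift (u : R) (p : pt) : pt :=
  mk (px p + \sum_j (px p - zx j) * fac u j p) (py p + \sum_j (py p - zy j) * fac u j p)
     (t0 + sg u (ph p - t0)).

Ltac clra := have := t01; have := t1e; rewrite ?/c; slra.

Let cut0_ge0 s : 0 <= cut0 s.
Proof. by apply: mulr_ge0; [exact: ltW|rewrite le_min le_max lexx orbT ltW]. Qed.

Let cut0_lt s : cut0 s < r.
Proof.
have h : cut0 s <= M * eps by rewrite ler_pM2l// ge_min lexx orbT.
by apply: le_lt_trans h _; slra.
Qed.

Let cut0E s : 0 <= s -> s <= eps -> cut0 s = M * s.
Proof. by move=> s0 s1; rewrite /cut0 (max_idPl s0) (min_idPl s1). Qed.

Let cut0_neg s : s <= 0 -> cut0 s = 0.
Proof. by move=> s0; rewrite /cut0 (max_idPr s0) (min_idPl (ltW eps0)) mulr0. Qed.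

Let cut0_le s s' : s <= s' -> cut0 s <= cut0 s'.
Proof.
move=> ss; rewrite ler_pM2l// le_min ge_min ge_min lexx orbT andbT.
by rewrite ge_max !le_max ss lexx orbT.
Qed.

Let sg_ge u s : unit_I u -> s <= sg u s.
Proof. by move=> /andP[u0 _]; rewrite lerDl mulr_ge0// le_max lexx. Qed.

Let sg_high u s : eps <= s -> sg u s = s.
Proof. by move=> es; rewrite /sg (max_idPl _) ?mulr0 ?addr0//; rewrite /c; clra. Qed.

Let sg_lt u s : unit_I u -> s < eps -> sg u s < eps.
Proof.
move=> /andP[u0 u1] se; rewrite /sg; have [cs|cs] := leP (c - s) 0; first clra.
have ce : c < eps by rewrite /c; clra.
have := t01; have := t1e; nra.
Qed.

Let fac_id u j p : cut0 (sg u (ph p - t0)) = cut0 (ph p - t0) -> fac u j p = 0.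
Proof. by move=> e; rewrite /fac e subrr !mul0r. Qed.

Let lift_fix u p : sg u (ph p - t0) = ph p - t0 -> lift u p = p.
Proof.
move=> e; rewrite /lift; rewrite !big1 => [|j _|j _]; try by rewrite fac_id ?mulr0// e.
by rewrite !addr0 e addrC subrK mkE.
Qed.

Let lift_low u p : sg u (ph p - t0) <= 0 -> unit_I u ->
  lift u p = mk (px p) (py p) (t0 + sg u (ph p - t0)).
Proof.
move=> e uI; have s0 := le_trans (sg_ge _ uI) e.
by rewrite /lift; rewrite !big1 ?addr0// => j _; rewrite fac_id ?mulr0// !cut0_neg.
Qed.

Let fac_far u j p : r <= rho j p -> fac u j p = 0.
Proof.
move=> h; rewrite /fac /=; set m := Num.max (rho j p) _.
have hm : r <= m by rewrite le_max h.
by rewrite (max_idPr _) ?mulr0 ?mul0r//; clra.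
Qed.

Let lift_cyl u p : (forall j, r <= rho j p) ->
  lift u p = mk (px p) (py p) (t0 + sg u (ph p - t0)).
Proof.
by move=> h; rewrite /lift !big1 ?addr0// => j _; rewrite fac_far ?mulr0.
Qed.

Let lift_in u p i : (forall j, j != i -> r <= rho j p) ->
  lift u p = mk (zx i + (px p - zx i) * (1 + fac u i p))
    (zy i + (py p - zy i) * (1 + fac u i p)) (t0 + sg u (ph p - t0)).
Proof.
move=> h.
have S (a : J -> R) : \sum_j a j * fac u j p = a i * fac u i p.
  by rewrite (bigD1 i)//= big1 ?addr0// => j ji; rewrite fac_far ?mulr0// h.
by rewrite /lift !S; congr mk; ring.
Qed.

Let m_gt0 p j : cored p -> 0 < Num.max (rho j p) (cut0 (ph p - t0)).
Proof.
move=> [_ _ h]; rewrite lt_max; have [hp|hp] := leP (ph p) t0.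
  have := h j hp; have : 0 <= M * (t0 - ph p) by apply: mulr_ge0; clra.
  by move=> h1 h2; apply/orP; left; clra.
apply/orP; right; apply: mulr_gt0 => //; rewrite lt_min eps0 andbT lt_max; apply/orP; left; clra.
Qed.

Let fac_ge0 u j p : unit_I u -> cored p -> 0 <= fac u j p.
Proof.
move=> uI cp; have m0 := m_gt0 j cp.
have h1 := cut0_le (sg_ge (ph p - t0) uI); have h2 := cut0_lt (ph p - t0).
rewrite /fac; apply: divr_ge0; apply: mulr_ge0; try clra.
by rewrite le_max lexx orbT.
Qed.

Let fac_bound u i p : unit_I u -> cored p -> rho i p < r ->
  [/\ rho i p * (1 + fac u i p) <= r,
   cut0 (ph p - t0) <= rho i p -> cut0 (sg u (ph p - t0)) <= rho i p * (1 + fac u i p) &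
   rho i p <= cut0 (ph p - t0) ->
     cut0 (ph p - t0) * (1 + fac u i p) = cut0 (sg u (ph p - t0))].
Proof.
move=> uI cp hr; have m0 := m_gt0 i cp.
have ab := cut0_le (sg_ge (ph p - t0) uI); have ar := cut0_lt (ph p - t0).
have br := cut0_lt (sg u (ph p - t0)); have a0 := cut0_ge0 (ph p - t0).
rewrite /fac /=.
have p0 := rho_ge0 i p.
move: (rho i p) (cut0 (ph p - t0)) (cut0 (sg u (ph p - t0))) hr m0 ab ar br a0 p0
  => q a b hr m0 ab ar br a0 p0.
have mr : Num.max q a < r by rewrite gt_max hr.
have qm : q <= Num.max q a by rewrite le_max lexx.
rewrite (max_idPl (_ : 0 <= r - Num.max q a)); last lra.
have ra : 0 < r - a by lra.
split.
- have [qa|aq] := leP q a.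
    rewrite (max_idPr qa) in m0 mr qm *.
    have -> : q * (1 + (b - a) * (r - a) / (a * (r - a))) = q / a * b.
      by field; rewrite !gt_eqF.
    have : q / a <= 1 by rewrite ler_pdivrMr// mul1r.
    have : 0 <= q / a by rewrite divr_ge0// ltW.
    by move: (q / a) => x xp x1; nra.
  rewrite (max_idPl (ltW aq)) in m0 mr qm *.
  have -> : q * (1 + (b - a) * (r - q) / (q * (r - a))) = q + (b - a) / (r - a) * (r - q).
    by field; rewrite !gt_eqF.
  have : (b - a) / (r - a) <= 1 by rewrite ler_pdivrMr// mul1r; lra.
  by move: ((b - a) / (r - a)) => x x1; nra.
- move=> aq; rewrite (max_idPl aq) in m0 mr qm *.
  have -> : q * (1 + (b - a) * (r - q) / (q * (r - a))) = b + (1 - (b - a) / (r - a)) * (q - a).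
    by field; rewrite !gt_eqF.
  have : (b - a) / (r - a) <= 1 by rewrite ler_pdivrMr// mul1r; lra.
  by move: ((b - a) / (r - a)) => x x1; nra.
- move=> qa; rewrite (max_idPr qa) in m0 mr qm *.
  by field; rewrite !gt_eqF.
Qed.

(** At heights up to the level only the height changes, and the removed cone narrows upwards. Above
    the level an image point on [G] would lie in the inner cone; there the lift is a homothety from
    the centre, which preserves the conical upper strands, so the point itself would lie on [G]. *)
Let lift_ok u p : unit_I u -> cored p -> cored (lift u p).
Proof.
move=> uI cp; have [hp nG hc] := cp; pose s := ph p - t0; pose s' := sg u s.
have ss : s <= s' by apply: sg_ge.
have sE : s = ph p - t0 by [].
have [es|es] := leP eps s; first by rewrite lift_fix// sg_high.
have s'e : s' < eps by apply: sg_lt.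
have h' : ph (lift u p) = t0 + s' by rewrite ph_mk.
have [s'0|s'0] := leP s' 0.
  have sh : 0 <= - s' by lra.
  have E : lift u p = mk (px p) (py p) (t0 + s') by apply: lift_low.
  have rE j : rho j (lift u p) = rho j p by rewrite E rho_mk.
  have hc' j : M * - s' < rho j (lift u p).
    rewrite rE; apply: le_lt_trans (hc j _); last by clra.
    by rewrite ler_pM2l//; lra.
  split; first by rewrite h'; clra.
  - move=> GL; have s'lo : - eps < s' by clra.
    have [s'00|s'00] := eqVneq s' 0.
      have ht : ph (lift u p) = t0 by rewrite h' s'00 addr0.
      have [j [ex ey]] := proj1 (G_at ht) GL.
      have := hc' j; rewrite /rho ex ey !subrr normr0 maxxx s'00 oppr0 mulr0; lra.
    have s'neg : s' < 0 by rewrite lt_neqAle s'00.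
    have ht : t0 - eps < ph (lift u p) < t0 by rewrite h'; apply/andP; split; clra.
    have [j [n [hn ex ey]]] := proj1 (G_lo ht) GL.
    have := hc' j; rewrite ltNge => /negP; apply; apply: ltW.
    rewrite h' in ex ey; have e : t0 - (t0 + s') = - s' by ring.
    rewrite e in ex ey; apply: (lo_lt hn _ ex ey).
    by rewrite oppr_gt0 lt_neqAle s'00.
  - by move=> j _; rewrite h' (_ : t0 - (t0 + s') = - s')//; ring.
split; [by rewrite h'; clra| |by move=> j; rewrite h'; lra].
move=> GL.
have ht : t0 < ph (lift u p) < t0 + eps by rewrite h'; apply/andP; split; lra.
have [j [a [b [hab ex ey]]]] := proj1 (G_up ht) GL.
rewrite h' (_ : t0 + s' - t0 = s') in ex ey; last ring.
have hb : cut0 s' = M * s' by apply: cut0E; lra.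
have rj : rho j (lift u p) < cut0 s'.
  by rewrite hb; apply: up_lt hab _ ex ey.
have br := cut0_lt s'.
have [far|[i [hi far]]] := cyl p.
  have : rho j (lift u p) = rho j p by rewrite lift_cyl// rho_mk.
  by have := far j; lra.
have LE := lift_in u far.
have [b1 b2 b3] := fac_bound uI cp hi.
have f0 := fac_ge0 i uI cp.
have ri : rho i (lift u p) = rho i p * (1 + fac u i p).
  rewrite LE rho_mk ![_ + _ * _ - _]addrAC !subrr !add0r !normrM (ger0_norm (_ : 0 <= 1 + fac u
      i p)); last lra.
  by rewrite -maxr_pMl//; lra.
have [ij|ij] := eqVneq i j; last first.
  by have := rho_sep (lift u p) ij; lra.
rewrite -{j}ij in hab ex ey rj.
have [ia|ia] := leP (cut0 s) (rho i p).
  by have := b2 ia; rewrite -ri; rewrite /s' /s in rj; lra.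
have {}b3 := b3 (ltW ia); rewrite -!sE -/s' in b3.
have s0 : 0 < s.
  rewrite ltNge; apply/negP => s0; have := rho_ge0 i p; rewrite cut0_neg// in ia; lra.
have as_ : cut0 s = M * s by apply: cut0E; lra.
(* The horizontal factor equals the ratio of the heights, as a homothety from the centre
   requires. *)
have fE : s * (1 + fac u i p) = s'.
  by apply: (mulfI (lt0r_neq0 M0)); rewrite mulrA -as_ b3 hb.
have F0 : 1 + fac u i p != 0 by apply: lt0r_neq0; lra.
apply: nG; apply/G_up; first by apply/andP; split; lra.
exists i, a, b; split=> //; rewrite LE in ex ey; rewrite -?sE.
  move: ex; rewrite px_mk => /addrI; rewrite -fE => e.
  have {}e : px p - zx i = s * a by apply: (mulIf F0); rewrite e; ring.
  by rewrite -e; ring.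
move: ey; rewrite py_mk => /addrI; rewrite -fE => e.
have {}e : py p - zy i = s * b by apply: (mulIf F0); rewrite e; ring.
by rewrite -e; ring.
Qed.

Lemma cth_lift : cth cored lift.
Proof.
move=> T z u F hu hF uI cF.
have hx := ct_px hF; have hy := ct_py hF; have hh := ct_ph hF.
have hs : ct z (fun w => ph (F w) - t0) by ctt.
have hsg : ct z (fun w => sg (u w) (ph (F w) - t0)) by rewrite /sg; ctt.
have hfac j : ct z (fun w => fac (u w) j (F w)).
  have hr := @ct_rho _ _ _ j hF; rewrite /fac /cut0.
  apply: ctM; first by ctt.
  apply: ctV; last by ctt.
  apply: lt0r_neq0; apply: mulr_gt0; first exact: m_gt0.
  by have := cut0_lt (ph (F z) - t0); rewrite /cut0; clra.
by apply: ctp_mk; [| |by ctt]; apply: ctD => //; apply: ct_sum => j; ctt.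
Qed.

Lemma LSfree_cored : LSfree (above t1) x0 -> LSfree cored x0.
Proof.
have sub p : above t1 p -> cored p by move=> [h1 h2]; split=> // [|j h]; clra.
have lift_h u p : ph (lift u p) = t0 + sg u (ph p - t0) by rewrite ph_mk.
apply: (@LSfree_deform R cored (above t1) x0 lift) => //.
- exact: cth_lift.
- by move=> p _; rewrite lift_fix// /sg mul0r addr0.
- move=> u p uI ap; have [_ nG _] := lift_ok uI (sub _ ap); split=> //.
  by rewrite lift_h; have := sg_ge (ph p - t0) uI; have [h _] := ap; clra.
- move=> p cp; have [_ nG _] := lift_ok (unit_I1 R) cp; split=> //.
  rewrite lift_h /sg mul1r; have [h|h] := leP (c - (ph p - t0)) 0; rewrite /c in h *; clra.
- by move=> u _; apply: lift_fix; apply: sg_high; clra.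
Qed.

End Lift.

(** * Handles between neighbouring lower strands *)

Let mm : R := 3 / 2 * M.

(** The inner walls run midway between neighbouring strands, the outer ones at slopes [- mm] and
    [mm]. The constant [mm] lies strictly between the radius [M] of the removed cone and the extent
    [2 * M] of a handle in the second coordinate: the boxes cover the cone, and the handles reach
    beyond the boxes. *)
Definition cut (j : J) (n : nat) : R :=
  if n == 0%N then - mm else if (k j <= n)%N then mm else (wx j n.-1 + wx j n) / 2.

Let wgap2 j n m : (n < m)%N -> (m < k j)%N -> wx j n + 2 * dl <= wx j m.
Proof.
elim: m => // m IH; rewrite ltnS leq_eqVlt => /orP[/eqP->|nm] mk; first exact: wgap.
by have := wgap mk; have := IH nm (ltnW mk); slra.
Qed.

Let loM' j n : (n < k j)%N -> - M < wx j n < M.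
Proof. by move=> /loM[]; rewrite ltr_norml. Qed.

Let cutE j n : (0 < n)%N -> (n < k j)%N -> cut j n = (wx j n.-1 + wx j n) / 2.
Proof. by move=> n0 nk; rewrite /cut eqn0Ngt n0 /= leqNgt nk. Qed.

Let cut_in j n : (0 < n)%N -> (n < k j)%N ->
  [/\ wx j n.-1 + dl <= cut j n, cut j n + dl <= wx j n & - M + dl <= cut j n <= M - dl].
Proof.
move=> n0 nk; have nk' : (n.-1 < k j)%N := leq_ltn_trans (leq_pred n) nk.
have l1 : (n.-1 < n)%N by rewrite prednK.
have := loM' nk; have := loM' nk'; have := wgap2 l1 nk.
by rewrite cutE// => h /andP[h1 h2] /andP[h3 h4]; split; [slra..|apply/andP; split; slra].
Qed.

Let cut_wx j n : (n < k j)%N -> cut j n < wx j n < cut j n.+1.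
Proof.
move=> nk; have /andP[h1 h2] := loM' nk; apply/andP; split.
  case: n nk h1 h2 => [|n] nk h1 h2; first by rewrite /cut /= /mm; slra.
  by have [_ h _] := @cut_in j n.+1 isT nk; slra.
have [nk'|nk'] := ltnP n.+1 (k j); first by have [h _ _] := @cut_in j n.+1 isT nk'; slra.
by rewrite /cut /= nk' /mm; slra.
Qed.

Let cut_mono j n m : (n <= m)%N -> (m <= k j)%N -> cut j n <= cut j m.
Proof.
elim: m => [|m IH]; first by rewrite leqn0 => /eqP->.
rewrite leq_eqVlt => /orP[/eqP->//|nm] mk; apply: le_trans (IH nm (ltnW mk)) _.
by have /andP[h1 h2] := cut_wx mk; apply: ltW; apply: lt_trans h1 h2.
Qed.

Let cut_gap j n m : (0 < n)%N -> (n < m)%N -> (m < k j)%N -> cut j n + 2 * dl <= cut j m.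
Proof.
move=> n0 nm mk; have [_ h1 _] := @cut_in j n n0 (ltn_trans nm mk).
have [h2 _ _] := @cut_in j m (leq_ltn_trans (leq0n _) nm) mk.
have [e|e] := eqVneq n m.-1; first by rewrite -e in h2; slra.
have l1 : (n < m.-1)%N by clear -nm e; lia.
by have := wgap2 l1 (leq_ltn_trans (leq_pred m) mk); slra.
Qed.

Let dd (p : pt) : R := t0 - ph p.
(** Positive on a wedge of half-width [dl] times the depth about an inner wall; by the choice of
    [dl] this wedge misses all strands. The form as a minimum makes openness a matter of
    continuity. *)
Let hf (j : J) (n : nat) (p : pt) : R :=
  Num.min (Num.min (eps / 2 - dd p) (dd p))
    (Num.min (dl * dd p - `|px p - zx j - cut j n * dd p|) (2 * (M * dd p) - `|py p - zy j|)).

Definition handle (j : J) (n : nat) : region := fun p => 0 < hf j n p.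

Let handleP j n p : handle j n p <-> [/\ 0 < dd p < eps / 2,
  `|px p - zx j - cut j n * dd p| < dl * dd p & `|py p - zy j| < 2 * (M * dd p)].
Proof.
rewrite /handle /hf !lt_min !subr_gt0; split.
  by move=> /andP[/andP[h1 h2] /andP[h3 h4]]; rewrite h1 h2.
by move=> [/andP[-> ->] -> ->].
Qed.

Let open_handle j n : open_region (handle j n).
Proof.
apply: open_pos => x; have hh := ct_ph (@ctp_id R x); have hx := ct_px (@ctp_id R x).
by have hy := ct_py (@ctp_id R x); rewrite /hf /dd; ctt.
Qed.

Let convex_pos (t x y : R) : unit_I t -> 0 < x -> 0 < y -> 0 < (1 - t) * x + t * y.
Proof.
move=> tI x0' y0'; have := @convex_comb_lt _ (- x) (- y) t 0 tI.
by rewrite !oppr_lt0 => /(_ x0' y0'); lra.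
Qed.

Let dd_seg p q t : dd (seg p q t) = (1 - t) * dd p + t * dd q.
Proof. by rewrite /dd ph_seg; ring. Qed.

Let convex_handle j n : convex_region (handle j n).
Proof.
move=> p q t /handleP[/andP[a1 a2] a3 a4] /handleP[/andP[b1 b2] b3 b4] tI; apply/handleP.
rewrite px_seg py_seg dd_seg.
move: a3 a4 b3 b4; rewrite !ltr_norml => /andP[a3 a4] /andP[a5 a6] /andP[b3 b4] /andP[b5 b6].
split; apply/andP; split; rewrite -subr_gt0.
- by rewrite subr0; apply: convex_pos.
- have := @convex_pos t (eps / 2 - dd p) (eps / 2 - dd q) tI; rewrite !subr_gt0 => /(_ a2 b2); lra.
- have := convex_pos tI (_ : 0 < px p - zx j - cut j n * dd p + dl * dd p) (_ : 0 < px q - zx j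
    - cut j n * dd q + dl * dd q).
  have u1 : 0 < px p - zx j - cut j n * dd p + dl * dd p by lra.
  have u2 : 0 < px q - zx j - cut j n * dd q + dl * dd q by lra.
  move=> /(_ u1 u2); congr (0 < _); ring.
- have u1 : 0 < dl * dd p - (px p - zx j - cut j n * dd p) by lra.
  have u2 : 0 < dl * dd q - (px q - zx j - cut j n * dd q) by lra.
  have := convex_pos tI u1 u2; congr (0 < _); ring.
- have u1 : 0 < py p - zy j + 2 * (M * dd p) by lra.
  have u2 : 0 < py q - zy j + 2 * (M * dd q) by lra.
  have := convex_pos tI u1 u2; congr (0 < _); ring.
- have u1 : 0 < 2 * (M * dd p) - (py p - zy j) by lra.
  have u2 : 0 < 2 * (M * dd q) - (py q - zy j) by lra.
  have := convex_pos tI u1 u2; congr (0 < _); ring.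
Qed.

Let valid (jn : J * nat) : bool := (0 < jn.2)%N && (jn.2 < k jn.1)%N.

Let Meps d : d < eps / 2 -> M * d < M * eps / 2.
Proof. by move=> h; rewrite -mulrA ltr_pM2l. Qed.

Let handle_x j n p : valid (j, n) -> handle j n p -> `|px p - zx j| < M * dd p.
Proof.
move=> /andP[/= n0 nk] /handleP[/andP[d0 d1] hx _].
have [_ _ /andP[c1 c2]] := cut_in n0 nk.
have := ler_wpM2r (ltW d0) c1; have := ler_wpM2r (ltW d0) c2.
by move: hx; rewrite !ltr_norml => /andP[h1 h2]; rewrite !mulrDl !mulNr => ? ?; apply/andP;
    split; lra.
Qed.

Let handle_rho j n p : valid (j, n) -> handle j n p -> rho j p < r / 2.
Proof.
move=> v h; have hx := handle_x v h; have /handleP[/andP[d0 d1] _ hy] := h.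
have := Meps d1; have := mulr_gt0 M0 d0; rewrite /rho gt_max => h1 h2.
by apply/andP; split; slra.
Qed.

Let handle_disj j n j' n' p : valid (j, n) -> valid (j', n') -> handle j n p ->
  handle j' n' p -> (j, n) = (j', n').
Proof.
move=> v v' h h'; have [e|ne] := eqVneq j j'; last first.
  by exfalso; have := rho_sep p ne; have := handle_rho v h; have := handle_rho v' h'; slra.
rewrite -{j'}e in v' h' *; congr pair.
have /handleP[/andP[d0 d1] hx _] := h; have /handleP[_ hx' _] := h'.
have/andP[/= n0 nk] := v; have/andP[/= n0' nk'] := v'.
move: hx hx'; rewrite !ltr_norml => /andP[h1 h2] /andP[h3 h4].
have [nn|nn|//] := ltngtP n n'; exfalso.
  have := ler_wpM2r (ltW d0) (cut_gap n0 nn nk'); rewrite mulrDl; lra.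
have := ler_wpM2r (ltW d0) (cut_gap n0' nn nk); rewrite mulrDl; lra.
Qed.

Let cored_neg p : 0 < dd p < eps / 2 -> (forall j, M * dd p < rho j p) -> cored p.
Proof.
move=> /andP[d0 d1] h; rewrite /dd in d0 d1; split=> //; first lra.
move=> /G_lo[|j [n [nk ex ey]]]; first by apply/andP; split; slra.
by have := lo_lt nk d0 ex ey; have := h j; rewrite /rho /dd; lra.
Qed.

Definition with_handles (L : seq (J * nat)) : region := fun p =>
  cored p \/ exists2 jn, jn \in L & handle jn.1 jn.2 p.

Let open_with_handles L : open_region (with_handles L).
Proof.
elim: L => [|jn L IH].
  by apply: (open_ext _ open_cored) => p; split=> [|[|[]]//]; left.
apply: (open_ext _ (open_or IH (@open_handle jn.1 jn.2))) => p; split.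
  case=> [[cp|[b bL hb]]|hp]; [by left|right; exists b => //|right; exists jn => //].
    by rewrite inE bL orbT.
  by rewrite inE eqxx.
case=> [cp|[b]]; first by left; left.
rewrite inE => /orP[/eqP->|bL] hb; [by right|by left; right; exists b].
Qed.

(** In the first coordinate a handle stays within the cone, so it can meet [cored] only beyond the
    cone in the second coordinate: once on either side. Different handles are disjoint, so those
    already attached do not interfere. *)
Let add_handle L j n : valid (j, n) -> (j, n) \notin L -> all valid L ->
  LSfree (with_handles L) x0 -> LSfree (with_handles ((j, n) :: L)) x0.
Proof.
move=> v nL vL fL.
pose C1 : region := fun p => handle j n p /\ M * dd p < py p - zy j.
pose C2 : region := fun p => handle j n p /\ M * dd p < zy j - py p.
have AB p : with_handles L p -> handle j n p -> C1 p \/ C2 p.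
  move=> [cp|[[j' n'] bL hb]] hp; last first.
    by have e := handle_disj v (allP vL _ bL) hp hb; rewrite e bL in nL.
  have /handleP[/andP[d0 d1] _ _] := hp; have [_ _ hc] := cp.
  have := hc j (ltac:(rewrite /dd in d0; lra)); rewrite -/(dd p) /rho lt_max => /orP[|h].
    by move=> ?; exfalso; have := handle_x v hp; lra.
  have [y0'|y0'] := leP 0 (py p - zy j); [left|right]; split=> //.
    by rewrite ger0_norm in h.
  by rewrite ltr0_norm// opprB in h.
have BA p : handle j n p -> M * dd p < `|py p - zy j| -> cored p.
  move=> hp hy; have /handleP[hd _ _] := hp; have /andP[d0 d1] := hd; apply: cored_neg => // i.
  have [->|ne] := eqVneq i j; first by rewrite /rho lt_max hy orbT.
  by have := rho_sep p ne; have := handle_rho v hp; have := Meps d1; slra.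
have C1A p : C1 p -> cored p.
  move=> [hp h]; apply: BA => //; rewrite ger0_norm//; apply: ltW; apply: le_lt_trans h.
  by have /handleP[/andP[d0 d1] _ _] := hp; apply: ltW; apply: mulr_gt0.
have C2A p : C2 p -> cored p.
  move=> [hp h]; apply: BA => //; rewrite distrC ger0_norm//; apply: ltW; apply: le_lt_trans h.
  by have /handleP[/andP[d0 d1] _ _] := hp; apply: ltW; apply: mulr_gt0.
(* The middle of the depths from 0 to [eps / 2]; the offset [y1] below is taken midway between
   [M * e4] and [2 * (M * e4)]. *)
pose e4 := eps / 4.
have e40 : 0 < e4 by rewrite /e4; slra.
have bh y : `|y| < 2 * (M * e4) -> handle j n (mk (zx j + cut j n * e4) (zy j + y) (t0 - e4)).
  move=> hy; apply/handleP; rewrite /dd px_mk py_mk ph_mk opprB addrCA subrr addr0.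
  rewrite [zx j + _ - _ ]addrAC subrr add0r subrr normr0 [zy j + _]addrC addrK.
  split=> //; last exact: mulr_gt0; apply/andP; split=> //; rewrite /e4; slra.
have Me : 0 < M * e4 by apply: mulr_gt0.
pose y1 := 3 / 2 * (M * e4).
have y1b : `|y1| < 2 * (M * e4) by rewrite ger0_norm /y1; lra.
have y2b : `|- y1| < 2 * (M * e4) by rewrite normrN.
apply: (@LSfree_ext _ (fun p => with_handles L p \/ handle j n p)).
  move=> p; split.
    case=> [[cp|[b bL hb]]|hp]; [by left|right; exists b => //|by right; exists (j, n);
        rewrite ?inE ?eqxx].
    by rewrite inE bL orbT.
  case=> [cp|[b]]; first by left; left.
  by rewrite inE => /orP[/eqP->|bL] hb; [right|left; right; exists b].
apply: (@LSfree_handle R (with_handles L) (handle j n) C1 C2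
  (mk (zx j + cut j n * e4) (zy j + y1) (t0 - e4))
  (mk (zx j + cut j n * e4) (zy j - y1) (t0 - e4))) => //.
- move=> p q t [hp p1] [hq q1] tI; split; first exact: convex_handle.
  have u1 : 0 < py p - zy j - M * dd p by lra.
  have u2 : 0 < py q - zy j - M * dd q by lra.
  rewrite -subr_gt0 dd_seg py_seg; have := convex_pos tI u1 u2; congr (0 < _); ring.
- move=> p q t [hp p1] [hq q1] tI; split; first exact: convex_handle.
  have u1 : 0 < zy j - py p - M * dd p by lra.
  have u2 : 0 < zy j - py q - M * dd q by lra.
  rewrite -subr_gt0 dd_seg py_seg; have := convex_pos tI u1 u2; congr (0 < _); ring.
- by split; [exact: bh|rewrite /dd py_mk ph_mk opprB addrCA subrr addr0 /y1; lra].
- by split; [exact: bh|rewrite /dd py_mk ph_mk opprB addrCA subrr addr0 /y1; lra].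
- move=> p; split=> [[] //|[cp|cp]]; first exact: AB.
    by split; [left; exact: C1A|case: cp].
  by split; [left; exact: C2A|case: cp].
- move=> p [hp h1] [_ h2]; have /handleP[/andP[d0 d1] _ _] := hp.
  by have := mulr_gt0 M0 d0; lra.
- move=> p q [hp h1] [hq h2].
  have /handleP[/andP[d0 d1] _ _] := hp; have /handleP[/andP[d0' d1'] _ _] := hq.
  have a0 := mulr_gt0 M0 d0; have b0 := mulr_gt0 M0 d0'.
  pose a := py p - zy j; pose b := zy j - py q.
  have a0' : 0 < a by rewrite /a; lra.
  have b0' : 0 < b by rewrite /b; lra.
  have ab0 : 0 < a + b by lra.
  have tI : unit_I (a / (a + b)).
    apply/andP; split; first by apply: divr_ge0; apply: ltW.
    by rewrite ler_pdivrMr// mul1r lerDl ltW.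
  (* At this parameter the segment crosses the plane [py = zy j], which meets neither [C1] nor
     [C2]. *)
  exists (a / (a + b)) => //.
  have hs := convex_handle hp hq tI.
  have ys : py (seg p q (a / (a + b))) - zy j = 0.
    rewrite py_seg; have -> : py p = zy j + a by rewrite /a; ring.
    have -> : py q = zy j - b by rewrite /b; ring.
    by field; rewrite gt_eqF.
  have /handleP[/andP[d2 _] _ _] := hs; have := mulr_gt0 M0 d2.
  by move=> m0 /AB/(_ hs)[[_]|[_]]; [|rewrite -opprB]; rewrite ys; lra.
Qed.

Let all_handles : seq (J * nat) := [seq jn <- allpairs pair (enum J) (iota 0 (\max_j k j)) |
    valid jn].

Let mem_all_handles jn : (jn \in all_handles) = valid jn.
Proof.
rewrite mem_filter; case: jn => j n; case v: (valid _) => //=.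
apply/allpairsP; exists (j, n); split=> //=; first by rewrite mem_enum.
by have /andP[/= _ nk] := v; rewrite mem_iota /= add0n (leq_trans nk)// leq_bigmax.
Qed.

Lemma LSfree_with_handles : LSfree cored x0 -> LSfree (with_handles all_handles) x0.
Proof.
move=> fc; have u : uniq all_handles.
  by apply/filter_uniq/allpairs_uniq; rewrite ?enum_uniq ?iota_uniq// => -[a b] [c d] _ _ [-> ->].
have v : all valid all_handles by apply/allP => jn; rewrite mem_all_handles.
elim: all_handles u v => [_ _|[j n] L IH /andP[nL uL] /andP[vj vL]].
  by apply: LSfree_ext fc => p; split=> [|[|[]]//]; left.
exact: add_handle (IH uL vL).
Qed.

(** * Pushing away from the lower strands *)

Let sh (p : pt) : R := Num.max (dd p) 0.
Let dx j n p : R := px p - zx j - sh p * wx j n.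
Let dy j n p : R := py p - zy j - sh p * wy j n.
Let gj (j : J) (n : nat) (p : pt) : R :=
  gau (cut j n.+1 - wx j n) (wx j n - cut j n) (mm - wy j n) (mm + wy j n) (dx j n p) (dy j n p).
(** Inside a box [1 + pf] is [sh p / gj j n p], which carries the point to the boundary of the box.
    Above the level the numerator vanishes, and the entry [ph p - t0] keeps the denominator
    positive, so the formula is continuous across the level. *)
Let pf j n p : R := Num.max (sh p - gj j n p) 0 / Num.max (gj j n p) (ph p - t0).

(* In each box [cut n, cut (n+1)] x [-mm, mm] (scaled by the depth) below a centre,
   push radially away from the one strand that runs through it. *)
Definition push (u : R) (p : pt) : pt :=
  mk (px p + u * \sum_j \sum_(n < k j) dx j n p * pf j n p)
     (py p + u * \sum_j \sum_(n < k j) dy j n p * pf j n p) (ph p).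

Let sides j n : (n < k j)%N -> [/\ 0 < cut j n.+1 - wx j n, 0 < wx j n - cut j n,
  0 < mm - wy j n & 0 < mm + wy j n].
Proof.
move=> nk; have /andP[h1 h2] := cut_wx nk; have [_] := loM nk.
by rewrite ltr_norml => /andP[h3 h4]; rewrite /mm; split; slra.
Qed.

Let gj_ge0 j n p : (n < k j)%N -> 0 <= gj j n p.
Proof. by move=> /sides[*]; apply: gau_ge0. Qed.

Let gj_lt j n p : (n < k j)%N -> gj j n p < sh p ->
  [/\ 0 < sh p, sh p = dd p, cut j n * sh p < px p - zx j < cut j n.+1 * sh p &
    `|py p - zy j| < mm * sh p].
Proof.
move=> nk h; have s0 : 0 < sh p := le_lt_trans (gj_ge0 p nk) h.
have [h1 h2 h3 h4] := sides nk; move: h => /(gau_lt h1 h2 h3 h4)[].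
rewrite /dx /dy ltr_norml => *; split=> //.
- by move: s0; rewrite /sh lt_max ltxx orbF => /ltW/max_idPl.
- by apply/andP; split; lra.
- by apply/andP; split; lra.
Qed.

Let gj_le j n p : (n < k j)%N -> gj j n p <= sh p ->
  cut j n * sh p <= px p - zx j <= cut j n.+1 * sh p /\ `|py p - zy j| <= mm * sh p.
Proof.
move=> nk h.
have [h1 h2 h3 h4] := sides nk; move: h => /(gau_le h1 h2 h3 h4)[].
by rewrite /dx /dy ler_norml => *; split; apply/andP; split; lra.
Qed.

Let cut_mm j n : (n <= k j)%N -> - mm <= cut j n <= mm.
Proof.
move=> nk; have := cut_mono (leq0n n) nk; have := cut_mono nk (leqnn _).
by rewrite /cut /= leqnn (gtn_eqF (k0 j)) => -> ->.
Qed.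

Let box_rho j n p : (n < k j)%N -> 0 < dd p < eps / 2 -> sh p = dd p ->
  gj j n p <= sh p -> rho j p < r.
Proof.
move=> nk /andP[d0 d1] e h; have [/andP[h1 h2] h3] := gj_le nk h.
have /andP[c1 _] := cut_mm (ltnW nk); have /andP[_ c2] := cut_mm nk.
have := ler_wpM2r (ltW d0) c1; have := ler_wpM2r (ltW d0) c2.
have := Meps d1; have := mulr_gt0 M0 d0; rewrite e in h1 h2 h3.
rewrite mulNr; rewrite /mm -mulrA in h3 * => v1 v2 v3 v4.
rewrite /rho gt_max ltr_norml; apply/andP; split; last by slra.
by apply/andP; split; slra.
Qed.

Let push_cases p : t0 - eps / 2 < ph p ->
  (forall j n, (n < k j)%N -> sh p <= gj j n p) \/
  exists j n, [/\ (n < k j)%N, gj j n p < sh p &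
    forall j' n', (n' < k j')%N -> (j', n') != (j, n) -> sh p <= gj j' n' p].
Proof.
move=> hp; have [[j [n [nk h]]]|no] := pselect (exists j n, (n < k j)%N /\ gj j n p < sh p);
    last first.
  by left=> j n nk; rewrite leNgt; apply/negP => h; apply: no; exists j, n.
right; exists j, n; split=> // j' n' nk' ne; rewrite leNgt; apply/negP => h'.
have [s0 e /andP[h1 h2] _] := gj_lt nk h; have [_ _ /andP[h1' h2'] _] := gj_lt nk' h'.
have hd : 0 < dd p < eps / 2 by rewrite -e s0 e /dd; lra.
have [ej|nj] := eqVneq j' j; last first.
  by have := rho_sep p nj; have := box_rho nk hd e (ltW h); have := box_rho nk' hd e (ltW h'); lra.
rewrite {j'}ej in h' ne nk' h1' h2'.
have [nn|nn|nn] := ltngtP n n'; last by rewrite nn eqxx in ne.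
  by have := ler_wpM2r (ltW s0) (cut_mono nn (ltnW nk')); lra.
by have := ler_wpM2r (ltW s0) (cut_mono nn (ltnW nk)); lra.
Qed.

Let pf0 j n p : sh p <= gj j n p -> pf j n p = 0.
Proof. by move=> h; rewrite /pf (max_idPr _) ?mul0r//; lra. Qed.

Let push_fix u p : (forall j n, (n < k j)%N -> sh p <= gj j n p) -> push u p = p.
Proof.
move=> h; rewrite /push !big1 ?mulr0 ?addr0 ?mkE// => j _; rewrite big1// => -[n nk] _ /=.
  by rewrite pf0 ?mulr0// h.
by rewrite pf0 ?mulr0// h.
Qed.

Let push_one u p j n : (n < k j)%N ->
  (forall j' n', (n' < k j')%N -> (j', n') != (j, n) -> sh p <= gj j' n' p) ->
  push u p = mk (zx j + sh p * wx j n + (1 + u * pf j n p) * dx j n p)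
    (zy j + sh p * wy j n + (1 + u * pf j n p) * dy j n p) (ph p).
Proof.
move=> nk h.
have S (a : J -> nat -> R) : \sum_j \sum_(n < k j) a j n * pf j n p = a j n * pf j n p.
  rewrite (bigD1 j)//= [X in _ + X]big1 => [|j' jj]; last first.
    by rewrite big1// => -[n' nk'] _ /=; rewrite pf0 ?mulr0// h// xpair_eqE (negbTE jj).
  rewrite addr0 (bigD1 (Ordinal nk))//= big1 ?addr0// => -[n' nk'] /= nn.
  rewrite pf0 ?mulr0// h// xpair_eqE eqxx /=.
  by apply: contraNneq nn => e; apply/eqP/val_inj.
by rewrite /push (S (fun j n => dx j n p)) (S (fun j n => dy j n p)) /dx /dy; congr mk; ring.
Qed.

Let gj_pos j n p : (n < k j)%N -> above (t0 - eps / 2) p -> ph p <= t0 -> 0 < gj j n p.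
Proof.
move=> nk [hp nG] h0; rewrite lt_neqAle gj_ge0// andbT eq_sym; apply/negP => /eqP e.
have [h1 h2 h3 h4] := sides nk; have [ex ey] := gau_eq0 h1 h2 h3 h4 e.
have se : sh p = t0 - ph p by rewrite /sh /dd; apply/max_idPl; lra.
rewrite /dx /dy se in ex ey; apply: nG.
have [h00|h00] := eqVneq (ph p) t0.
  by apply/G_at => //; exists j; rewrite h00 subrr !mul0r in ex ey; split; lra.
have hlt : ph p < t0 by rewrite lt_neqAle h00.
apply/G_lo; first by apply/andP; split; slra.
by exists j, n; split=> //; lra.
Qed.

Let push_box u p j n : unit_I u -> above (t0 - eps / 2) p -> (n < k j)%N -> gj j n p < sh p ->
  (forall j' n', (n' < k j')%N -> (j', n') != (j, n) -> sh p <= gj j' n' p) ->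
  let p' := push u p in
  [/\ ph p' = ph p /\ sh p' = sh p, 0 < gj j n p' <= sh p, u = 1 -> gj j n p' = sh p,
   rho j p' < r & exists2 c, 1 <= c & dx j n p' = c * dx j n p /\ dy j n p' = c * dy j n p].
Proof.
move=> uI ap nk h ho p'; have [hp nG] := ap; have [s0 e _ _] := gj_lt nk h.
have hd : 0 < dd p < eps / 2 by rewrite -e s0 e /dd; lra.
have g0 : 0 < gj j n p by apply: gj_pos => //; rewrite e /dd in s0; lra.
have pfE : pf j n p = (sh p - gj j n p) / gj j n p.
  rewrite /pf (max_idPl _); last lra.
  by rewrite (max_idPl _)//; rewrite e /dd in s0; lra.
have E : p' = _ := push_one u nk ho.
have hh : ph p' = ph p by rewrite E ph_mk.
have shE : sh p' = sh p by rewrite /sh /dd hh.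
pose c := 1 + u * pf j n p.
have f0 : 0 <= pf j n p by rewrite pfE divr_ge0//; lra.
have c1 : 1 <= c by rewrite /c; have /andP[u0 _] := uI; have := mulr_ge0 u0 f0; lra.
have Ex : dx j n p' = c * dx j n p by rewrite {1}/dx shE {1}E px_mk -/c; ring.
have Ey : dy j n p' = c * dy j n p by rewrite {1}/dy shE {1}E py_mk -/c; ring.
have Eg : gj j n p' = c * gj j n p by rewrite /gj Ex Ey gau_scale//; lra.
(* The gauge is homogeneous, so it grows linearly in [u] up to its value [sh p] on the boundary. *)
have cg : c * gj j n p = gj j n p + u * (sh p - gj j n p).
  by rewrite /c pfE; field; rewrite gt_eqF.
have /andP[u0 u1] := uI.
have gs : gj j n p' <= sh p by rewrite Eg cg; nra.
split=> //.
- by rewrite gs andbT Eg; apply: mulr_gt0 => //; lra.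
- by move=> ue; rewrite Eg cg ue; lra.
- by apply: (@box_rho j n); rewrite ?shE// /dd hh.
- by exists c.
Qed.

Lemma cth_push : cth (above (t0 - eps / 2)) push.
Proof.
move=> T z u F hu hF uI aF.
have hx := ct_px hF; have hy := ct_py hF; have hh := ct_ph hF.
have hs : ct z (fun w => sh (F w)) by rewrite /sh /dd; ctt.
have hdx j n : ct z (fun w => dx j n (F w)) by rewrite /dx; ctt.
have hdy j n : ct z (fun w => dy j n (F w)) by rewrite /dy; ctt.
have hg j n : ct z (fun w => gj j n (F w)).
  by have := hdx j n; have := hdy j n => hdy' hdx'; rewrite /gj /gau; ctt.
have hpf j (n : 'I_(k j)) : ct z (fun w => pf j n (F w)).
  have hg' := hg j n; rewrite /pf; apply: ctM; first by ctt.
  apply: ctV; last by ctt.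
  apply: lt0r_neq0; rewrite lt_max; have [h|h] := leP (ph (F z)) t0.
    by rewrite gj_pos.
  by rewrite subr_gt0 h orbT.
apply: ctp_mk => //; (apply: ctD => //; apply: ctM => //; apply: ct_sum => j;
  apply: ct_sum => n; apply: ctM => //).
Qed.

(** The scaling keeps the point in its closed box and off the strand of that box; every other strand
    runs strictly between the walls of another box. *)
Let push_above u p : unit_I u -> above (t0 - eps / 2) p -> above (t0 - eps / 2) (push u p).
Proof.
move=> uI ap; have [hp nG] := ap; have [h|[j [n [nk h ho]]]] := push_cases hp.
  by rewrite push_fix.
have [[hh shE] /andP[g0 gs] _ rj [c c1 [Ex Ey]]] := push_box uI ap nk h ho.
have [s0 e _ _] := gj_lt nk h; rewrite e /dd in s0.
split; first by rewrite hh.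
have ht : t0 - eps < ph (push u p) < t0 by rewrite hh; apply/andP; split; slra.
move=> /(G_lo ht)[j' [n' [nk' ex ey]]].
have se : sh (push u p) = t0 - ph (push u p) by rewrite shE e /dd hh.
have [ej|nj] := eqVneq j' j; last first.
  have := rho_sep (push u p) nj; have d0 : 0 < t0 - ph (push u p) by rewrite hh.
  have := lo_lt nk' d0 ex ey; rewrite -/(rho j' _).
  have := @Meps (t0 - ph p) (ltac:(lra)); rewrite hh; slra.
rewrite {j'}ej in nk' ex ey.
have [nn|nn] := eqVneq n' n.
  have z1 : dx j n (push u p) = 0 by rewrite /dx se ex nn; ring.
  have z2 : dy j n (push u p) = 0 by rewrite /dy se ey nn; ring.
  by move: g0; rewrite /gj z1 z2 /gau oppr0 !mul0r !maxxx ltxx.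
rewrite -shE in gs; have [/andP[b1 b2] _] := gj_le nk gs.
have X : px (push u p) - zx j = wx j n' * sh (push u p) by rewrite se ex; ring.
have s0' : 0 < sh (push u p) by rewrite shE e.
rewrite X !ler_pM2r// in b1 b2.
have /andP[w1 w2] := cut_wx nk'.
have [ln|ln|ln] := ltngtP n n'; last by rewrite ln eqxx in nn.
  by have := cut_mono ln (ltnW nk'); lra.
by have := cut_mono ln (ltnW nk); lra.
Qed.

Let cored_above p : cored p -> above (t0 - eps / 2) p.
Proof. by case. Qed.

Let handle_above j n p : valid (j, n) -> handle j n p -> above (t0 - eps / 2) p.
Proof.
move=> v hp; have /handleP[/andP[d0 d1] _ _] := hp; rewrite /dd in d0 d1; split; first lra.
have ht : t0 - eps < ph p < t0 by apply/andP; split; slra.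
move=> /(G_lo ht)[j' [n' [nk' ex ey]]].
have rj' := lo_lt nk' d0 ex ey; rewrite -/(rho j' p) in rj'.
have [ej|nj] := eqVneq j' j; last first.
  by have := rho_sep p nj; have := handle_rho v hp; have := Meps d1; slra.
rewrite {j'}ej in nk' ex ey rj'; have /andP[/= n0 nk] := v.
have /handleP[_ + _] := hp; rewrite /dd ltr_norml ex => /andP[h1 h2].
have [c1 c2 _] := cut_in n0 nk.
have [ln|ln] := leqP n n'.
  have w : cut j n + dl <= wx j n'.
    move: ln; rewrite leq_eqVlt => /orP[/eqP<-//|ln].
    by have := wgap2 ln nk'; slra.
  have := ler_wpM2l (ltW d0) w; lra.
have w : wx j n' + dl <= cut j n.
  have [->//|ne] := eqVneq n' n.-1.
  have l1 : (n' < n.-1)%N by clear -ln ne n0; lia.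
  by have := wgap2 l1 (leq_ltn_trans (leq_pred n) nk); slra.
have := ler_wpM2l (ltW d0) w; lra.
Qed.

(** The strand lies inside the cone and the point outside, so the coordinate that witnesses this
    keeps doing so when it moves away from the strand. *)
Let push_cored u p : unit_I u -> cored p -> cored (push u p).
Proof.
move=> uI cp; have ap := cored_above cp; have [hp nG] := ap.
have [h|[j [n [nk h ho]]]] := push_cases hp; first by rewrite push_fix.
have [[hh shE] _ _ rj [c c1 [Ex Ey]]] := push_box uI ap nk h ho.
have [s0 e _ _] := gj_lt nk h.
have ddE : dd (push u p) = dd p by rewrite /dd hh.
have d0 : 0 < dd p by rewrite -e.
have d1 : dd p < eps / 2 by rewrite /dd; lra.
apply: cored_neg; rewrite ddE ?d0// => i.
have [->|nj] := eqVneq i j; last by have := rho_sep (push u p) nj; have := Meps d1; slra.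
have [_ _ hc] := cp; have := hc j (ltac:(rewrite /dd in d0; lra)).
have [w1 w2] := loM nk; rewrite -/(dd p) /rho !lt_max => /orP[] hx; apply/orP; [left|right].
- have -> : px (push u p) - zx j = dd p * wx j n + c * (px p - zx j - dd p * wx j n).
    by move: Ex; rewrite /dx shE e => <-; ring.
  apply: norm_away => //; rewrite normrM (gtr0_norm d0) mulrC ltr_pM2r//.
- have -> : py (push u p) - zy j = dd p * wy j n + c * (py p - zy j - dd p * wy j n).
    by move: Ey; rewrite /dy shE e => <-; ring.
  apply: norm_away => //; rewrite normrM (gtr0_norm d0) mulrC ltr_pM2r//.
Qed.

(** Every strand is at least [dl] times the depth away from the wall of the handle. The push away
    from the strand of the current box thus moves the point towards that wall, and the box does not
    extend across it. *)
Let push_handle u p j n : unit_I u -> valid (j, n) -> handle j n p -> handle j n (push u p).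
Proof.
move=> uI v hp'; have ap := handle_above v hp'; have [hp nG] := ap.
have [h|[j' [m [mk h ho]]]] := push_cases hp; first by rewrite push_fix.
have [[hh shE] /andP[_ gs] _ rj [c c1 [Ex _]]] := push_box uI ap mk h ho.
have [s0 e /andP[b1 b2] _] := gj_lt mk h.
have ddE : dd (push u p) = dd p by rewrite /dd hh.
have /handleP[hd hx hy] := hp'; have /andP[d0 d1] := hd.
have ej : j' = j.
  apply/eqP/negPn/negP => nj; have := rho_sep p nj; have := handle_rho v hp'.
  by have := box_rho mk hd e (ltW h); slra.
rewrite {j'}ej in mk h ho gs rj Ex b1 b2.
rewrite -shE in gs; have [/andP[b3 b4] b5] := gj_le mk gs.
rewrite shE e in b1 b2 b3 b4 b5.
have /andP[/= n0 nk] := v; have [c2 c3 _] := cut_in n0 nk.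
apply/handleP; rewrite ddE hd; split=> //; last first.
  by apply: le_lt_trans b5 _; have := mulr_gt0 M0 d0; rewrite /mm -mulrA; lra.
move: hx; rewrite !ltr_norml => /andP[hx1 hx2].
have XE : px (push u p) - zx j - dd p * wx j m = c * (px p - zx j - dd p * wx j m).
  by move: Ex; rewrite /dx shE e.
have mono (a b : R) : a <= b -> a * dd p <= b * dd p by move=> ?; rewrite ler_pM2r.
have [ln|ln] := leqP n m.
  have w : cut j n + dl <= wx j m.
    move: ln; rewrite leq_eqVlt => /orP[/eqP<-//|ln].
    by have := wgap2 ln mk; slra.
  have q1 := mono _ _ w; have q2 := mono _ _ (cut_mono ln (ltnW mk)).
  have neg : px p - zx j - dd p * wx j m <= 0 by lra.
  have : c * (px p - zx j - dd p * wx j m) <= px p - zx j - dd p * wx j m by nra.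
  by move=> q3; apply/andP; split; [have := mulr_gt0 dl0 d0; lra|lra].
have w : wx j m + dl <= cut j n.
  have [me|ne] := eqVneq m n.-1; first by rewrite me.
  have l1 : (m < n.-1)%N by clear -ln ne n0; lia.
  by have := wgap2 l1 (leq_ltn_trans (leq_pred n) nk); slra.
have q1 := mono _ _ w; have q2 := mono _ _ (cut_mono ln (ltnW nk)).
have pos : 0 <= px p - zx j - dd p * wx j m by lra.
have : px p - zx j - dd p * wx j m <= c * (px p - zx j - dd p * wx j m) by nra.
by move=> q3; apply/andP; split; [lra|have := mulr_gt0 dl0 d0; lra].
Qed.

Let find_box j (x : R) : - mm <= x <= mm -> exists2 n, (n < k j)%N & cut j n <= x <= cut j n.+1.
Proof.
move=> /andP[x1 x2].
have [n nP nmin] := @ex_minnP (fun n => x <= cut j n) (ltac:(by exists (k j);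
    rewrite /cut leqnn (gtn_eqF (k0 j)))).
case: n nP nmin => [|n] nP nmin.
  by exists 0%N => //; rewrite {1}/cut /= x1 (le_trans nP)// cut_mono.
have nk : (n < k j)%N by apply: nmin; rewrite /cut leqnn (gtn_eqF (k0 j)).
exists n => //; rewrite nP andbT leNgt; apply/negP => /ltW /nmin; by rewrite ltnn.
Qed.

(** After the full push no point is left in the interior of a box. A point below the level that
    stays in the cone of a centre, which the boxes cover, must lie on a wall. Since [M < mm] this is
    an inner wall, hence the point is in a handle. *)
Let push_end p : above (t0 - eps / 2) p -> with_handles all_handles (push 1 p).
Proof.
move=> ap; have [hp nG] := ap; set p' := push 1 p.
have [hp' nG'] : above (t0 - eps / 2) p' by apply: push_above.
have [h0|h0] := leP t0 (ph p').
  left; split=> // j h1; have e : ph p' = t0 by lra.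
  rewrite e subrr mulr0 lt_neqAle rho_ge0 andbT eq_sym; apply/negP => /eqP z.
  apply: nG'; apply/G_at => //; exists j.
  have : rho j p' <= 0 by rewrite z.
  by rewrite /rho ge_max !normr_le0 !subr_eq0 => /andP[/eqP-> /eqP->].
have d0 : 0 < dd p' by rewrite /dd; lra.
have d1 : dd p' < eps / 2 by rewrite /dd; lra.
have she : sh p' = dd p' by apply/max_idPl/ltW.
have [hc|] := pselect (forall j, M * dd p' < rho j p'); first by left; apply: cored_neg;
    rewrite ?d0.
move=> /existsNP[j /negP]; rewrite -leNgt => hj; right.
have far n : (n < k j)%N -> dd p' <= gj j n p'.
  move=> nk; have [h|[j' [m [mk h ho]]]] := push_cases hp.
    by rewrite /p' push_fix// in she *; rewrite -she; apply: h.
  have [[hh shE] /andP[_ gs] g1 rj _] := push_box (unit_I1 R) ap mk h ho.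
  rewrite -/p' in hh shE gs g1 rj; rewrite -shE in gs g1.
  have ej : j' = j.
    apply/eqP/negPn/negP => nj; have := rho_sep p' nj; have := Meps d1; slra.
  rewrite {j'}ej in mk h ho gs g1 rj; have {}g1 := g1 erefl.
  have [->|nm] := eqVneq n m; first by rewrite g1 she.
  have [/andP[b1 b2] _] := gj_le mk gs.
  have [v1 v2 v3 v4] := sides nk.
  rewrite leNgt; apply/negP => /(gau_lt v1 v2 v3 v4)[q1 q2 _ _].
  rewrite /dx she in q1 q2 b1 b2.
  have [ln|ln|ln] := ltngtP n m; last by rewrite ln eqxx in nm.
    by have := ler_wpM2r (ltW d0) (cut_mono ln (ltnW mk)); lra.
  by have := ler_wpM2r (ltW d0) (cut_mono ln (ltnW nk)); lra.
have hxy : `|px p' - zx j| <= M * dd p' /\ `|py p' - zy j| <= M * dd p'.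
  by move: hj; rewrite /rho ge_max => /andP[].
have [hx hy] := hxy; move: hx; rewrite ler_norml => /andP[hx1 hx2].
pose x := (px p' - zx j) / dd p'.
have xE : px p' - zx j = x * dd p' by rewrite /x divfK// gt_eqF.
rewrite xE -mulNr !ler_pM2r// in hx1 hx2.
have [n nk /andP[n1 n2]] : exists2 n, (n < k j)%N & cut j n <= x <= cut j n.+1.
  by apply: find_box; rewrite /mm; apply/andP; split; slra.
have hdl x' : x = cut j x' -> valid (j, x') -> exists2 jn, jn \in all_handles & handle jn.1 jn.2 p'.
  move=> ex vx; exists (j, x'); rewrite ?mem_all_handles//; apply/handleP.
  rewrite d0 d1 xE ex subrr normr0 mulr_gt0//; split=> //.
  by apply: le_lt_trans hy _; have := mulr_gt0 M0 d0; lra.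
have := far n nk; rewrite leNgt => /negP nlt.
have [v1 v2 v3 v4] := sides nk.
have [xl|xl] := eqVneq x (cut j n).
  apply: (hdl n) => //; rewrite /valid /= nk andbT lt0n; apply: contraTneq (hx1) => n00.
  by rewrite xl n00 /cut /= -ltNge /mm; slra.
have [xr|xr] := eqVneq x (cut j n.+1).
  apply: (hdl n.+1) => //; rewrite /valid /= ltnNge; apply: contraTN hx2 => n00.
  by rewrite xr /cut /= n00 -ltNge /mm; slra.
exfalso; apply: nlt; apply/(gau_lt v1 v2 v3 v4); rewrite /dx /dy she xE.
have x1 : cut j n < x by rewrite lt_neqAle eq_sym xl.
have x2 : x < cut j n.+1 by rewrite lt_neqAle xr.
move: hy; rewrite ler_norml => /andP[y1 y2].
have Md := mulr_gt0 M0 d0.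
have e1 : x * dd p' < cut j n.+1 * dd p' by rewrite ltr_pM2r.
have e2 : cut j n * dd p' < x * dd p' by rewrite ltr_pM2r.
by rewrite /mm; split; lra.
Qed.

Lemma LSfree_push : LSfree (with_handles all_handles) x0 -> LSfree (above (t0 - eps / 2)) x0.
Proof.
apply: (@LSfree_deform R (above (t0 - eps / 2)) (with_handles all_handles) x0 push).
- exact: cth_push.
- move=> p [[]//|[[j n]]]; rewrite mem_all_handles => v /=; exact: handle_above.
- by move=> p _; rewrite /push !mul0r !addr0 mkE.
- exact: push_above.
- move=> u p uI [cp|[[j n] jn hp]]; first by left; apply: push_cored.
  by right; exists (j, n) => //; apply: push_handle => //; rewrite -mem_all_handles.
- exact: push_end.
- move=> u _; apply: push_fix => j n nk; apply: le_trans (gj_ge0 _ nk).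
  by rewrite /sh /dd ge_max lexx andbT; slra.
Qed.

Theorem LSfree_level t1 : t0 <= t1 -> t1 < t0 + eps -> LSfree (above t1) x0 ->
  LSfree (above (t0 - eps / 2)) x0.
Proof.
by move=> h1 h2 /(LSfree_cored h1 h2)/LSfree_with_handles/LSfree_push.
Qed.

End Level.

(** * Sweeping the graph *)

Lemma pos_lower_bound (R : realType) (T : finType) (F : T -> R) :
  (forall i, 0 < F i) -> exists2 e, 0 < e & forall i, e <= F i.
Proof.
move=> F0; exists (\big[Num.min/1]_i F i); first exact: lt_bigmin.
by move=> i; apply: bigmin_le_cond.
Qed.

Lemma le_sum_nonneg (R : realType) (T : finType) (F : T -> R) i :
  (forall j, 0 <= F j) -> F i <= \sum_j F j.
Proof. by move=> F0; rewrite (bigD1 i)//= lerDl sumr_ge0. Qed.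

Section Core.
Variable R : realType.
Notation pt := (Defs.point R).
Notation region := (pt -> Prop).
Hint Resolve unit_I0 unit_I1 : core.

(** Compactness of the segment enters through [fine_grid], applied in the complement of [x]: each of
    finitely many cells avoids a cube about [x]. *)
Lemma open_not_segment (a b : pt) : open_region (fun x => ~ on_segment a b x).
Proof.
move=> x nx.
have hG (y : pt) : y <> x -> exists2 r, 0 < r & forall z, near_pt y r z -> ~ near_pt x r z.
  move=> yx; have [i /eqP hi] : exists i, y ord0 i <> x ord0 i.
    by apply/existsNP => h; apply: yx; apply/rowP.
  exists (`|y ord0 i - x ord0 i| / 2); first by rewrite divr_gt0// normr_gt0 subr_eq0.
  move=> z /(_ i) hy /(_ i) hx.
  have : `|y ord0 i - x ord0 i| <= `|y ord0 i - z ord0 i| + `|z ord0 i - x ord0 i|.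
    by apply: le_trans (ler_normD _ _); rewrite addrA subrK.
  by rewrite distrC in hy; lra.
have ps : pth (fun y => y <> x) (seg a b).
  by split=> [|t tI e]; [exact: contI_seg|apply: nx; exists t; rewrite -e].
have [N /(_ N.+1 (leqnSn _) isT) hN] := fine_grid hG ps.
have n0 : 0 < N.+1%:R :> R by rewrite ltr0n.
have /choice[r hr] (i : 'I_N.+1) : exists r, 0 < r /\ forall t,
    i%:R / N.+1%:R <= t <= i.+1%:R / N.+1%:R -> ~ near_pt x r (seg a b t).
  have [y [r [Gr h]]] := hN i (ltn_ord i); exists r; split=> [|t /h /Gr//].
  have := h (i%:R / N.+1%:R); rewrite lexx ler_pM2r ?invr_gt0// ler_nat leqnSn => /(_ isT ord0).
  exact: le_lt_trans.
have [e e0 he] := pos_lower_bound (fun i => proj1 (hr i)).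
exists e => // y hy [t [/andP[t0 t1] ye]].
have ex : exists i, t <= i.+1%:R / N.+1%:R by exists N; rewrite divff ?gt_eqF.
have [i hi imin] := ex_minnP ex.
have iN : (i < N.+1)%N by rewrite ltnS; apply: imin; rewrite divff ?gt_eqF.
apply: (proj2 (hr (Ordinal iN)) t) => /=.
  rewrite hi andbT; case: i {hi iN} imin => [|i] imin; first by rewrite mul0r.
  by rewrite leNgt; apply/negP => /ltW /imin; rewrite ltnn.
by rewrite /seg -ye => l; apply: lt_le_trans (hy l) (he _).
Qed.

Variables (V : finType) (adj : rel V) (f : V -> pt) (v0 : V).
Hypotheses (sgr : simple_graph adj) (emb : linear_embedding adj f).
Let hv v := ph (f v).
Let sx v w := (px (f w) - px (f v)) / (hv w - hv v).
Let sy v w := (py (f w) - py (f v)) / (hv w - hv v).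
Hypotheses (gen_h : forall v w, adj v w -> hv v != hv w)
  (desc : forall v, v != v0 -> exists2 w, adj v w & hv w < hv v)
  (gen_x : forall v w w', adj v w -> adj v w' -> hv w < hv v -> hv w' < hv v ->
     w != w' -> sx v w != sx v w').

Let v0_min v : v != v0 -> hv v0 < hv v.
Proof.
have [m _ mmin] := arg_minP (P := xpredT) hv (erefl true : xpredT v0).
have m0 : m = v0.
  apply/eqP/negPn/negP => /desc[w _]; rewrite ltNge; by rewrite mmin.
move=> vv; have [w _ hw] := desc vv; apply: le_lt_trans hw.
by rewrite -m0; apply: mmin.
Qed.

Let v0_le v : hv v0 <= hv v.
Proof. by have [->//|/v0_min/ltW] := eqVneq v v0. Qed.

Definition graph_ray : region := fun p => image_graph adj f p \/
  [/\ px p = px (f v0), py p = py (f v0) & ph p <= hv v0].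

Let sxC v w : sx v w = sx w v.
Proof. by rewrite /sx -opprB -[hv w - _]opprB invrN mulrNN. Qed.
Let syC v w : sy v w = sy w v.
Proof. by rewrite /sy -opprB -[hv w - _]opprB invrN mulrNN. Qed.

Lemma on_segmentC (a b x : pt) : on_segment a b x -> on_segment b a x.
Proof.
move=> [t [/andP[t0 t1] ->]]; exists (1 - t); split; first by apply/andP; split; lra.
by rewrite opprB addrCA subrr addr0 addrC.
Qed.

Lemma pt_eq (p q : pt) : px p = px q -> py p = py q -> ph p = ph q -> p = q.
Proof. by move=> h1 h2 h3; rewrite -(mkE p) -(mkE q) h1 h2 h3. Qed.

Lemma on_edge b a p : hv b < hv a -> on_segment (f b) (f a) p <->
  [/\ hv b <= ph p <= hv a, px p = px (f b) + (ph p - hv b) * sx b a &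
   py p = py (f b) + (ph p - hv b) * sy b a].
Proof.
move=> ba; have d0 : 0 < hv a - hv b by lra.
have dn : hv a - hv b != 0 by rewrite gt_eqF.
split.
  move=> [t [/andP[t0 t1] e]]; have {e} -> : p = seg (f b) (f a) t by [].
  rewrite px_seg py_seg ph_seg -/(hv a) -/(hv b); split.
  - by apply/andP; split; nra.
  - by rewrite /sx; field.
  - by rewrite /sy; field.
move=> [/andP[h1 h2] ex ey]; pose t := (ph p - hv b) / (hv a - hv b).
have tE : ph p - hv b = t * (hv a - hv b) by rewrite /t divfK.
exists t; split.
  rewrite /t divr_ge0 ?subr_ge0//= ?ler_pdivrMr ?mul1r//; lra.
rewrite -/(seg _ _ _); apply: pt_eq; rewrite ?px_seg ?py_seg ?ph_seg.
- by rewrite ex tE /sx; field.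
- by rewrite ey tE /sy; field.
- by rewrite -/(hv a) -/(hv b); lra.
Qed.

Let edge_up v w p : adj v w -> on_segment (f v) (f w) p ->
  exists a b, [/\ adj a b, hv b < hv a & on_segment (f b) (f a) p].
Proof.
move=> vw s; have [h|h|h] := ltgtP (hv v) (hv w).
- by exists w, v; split=> //; rewrite (proj1 sgr).
- by exists v, w; split=> //; apply: on_segmentC.
- by have := gen_h vw; rewrite h eqxx.
Qed.

Let img_edge a b p : adj a b -> on_segment (f b) (f a) p -> image_graph adj f p.
Proof. by move=> ab s; right; exists b, a; rewrite (proj1 sgr). Qed.

Lemma open_not_graph : open_region (fun p => ~ image_graph adj f p).
Proof.
apply: (@open_ext _ (fun p => (forall v, ~ on_segment (f v) (f v) p) /\
   forall vw : V * V, ~ (adj vw.1 vw.2 /\ on_segment (f vw.1) (f vw.2) p))).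
  move=> p; split=> [[h1 h2] [[v e]|[v [w h]]]|h]; last split.
  - by apply: (h1 v); exists 0; rewrite lexx ler01; split=> //;
      rewrite e subr0 scale1r scale0r addr0.
  - exact: (h2 (v, w)).
  - move=> v [t [_ e]]; apply: h; left; exists v.
    by rewrite e -scalerDl subrK scale1r.
  - by move=> [v w] /= vw; apply: h; right; exists v, w.
apply: open_and; apply: open_forall; first by move=> v; exact: open_not_segment.
move=> [v w] /=.
case vw: (adj v w); last by move=> x _; exists 1 => // y _ [].
by apply: (open_ext _ (@open_not_segment (f v) (f w))) => p; split=> [h [_]|h s];
    [exact: h|apply: h].
Qed.

Let ctx (x : pt) : ct x (fun p : pt => px p). Proof. exact: (@ctp_id R x). Qed.
Let cty (x : pt) : ct x (fun p : pt => py p). Proof. exact: (@ctp_id R x). Qed.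
Let cth_ (x : pt) : ct x (fun p : pt => ph p). Proof. exact: (@ctp_id R x). Qed.

Lemma open_not_graph_ray : open_region (fun p => ~ graph_ray p).
Proof.
apply: (@open_ext _ (fun p => ~ image_graph adj f p /\
   0 < Num.max (Num.max `|px p - px (f v0)| `|py p - py (f v0)|) (ph p - hv v0))).
  move=> p; rewrite !lt_max !normr_gt0 !subr_eq0 subr_gt0; split.
    by move=> [h1 h2] [//|[e1 e2 e3]]; move: h2; rewrite e1 e2 !eqxx /= ltNge e3.
  move=> h; split; first by move=> i; apply: h; left.
  rewrite ltNge -!negb_and; apply/negP => /andP[/andP[/eqP e1 /eqP e2] e3].
  by apply: h; right.
apply: open_and; first exact: open_not_graph.
apply: (@open_pos _ (fun p => Num.max (Num.max `|px p - px (f v0)| `|py p - py (f v0)|) (ph p -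
    hv v0))) => x.
by have hx := @ctx x; have hy := @cty x; have hh := @cth_ x; ctt.
Qed.

(** * The conical shape of the graph near one level *)

Section AtLevel.
Variable ts : R.
Hypothesis (ts0 : hv v0 <= ts).

Let act (x : V + V * V) : bool := match x with
  | inl v => hv v == ts
  | inr (a, b) => [&& adj a b, hv b < ts & ts < hv a] end.
(* The points of the level [ts]: vertices, and edges [a, b] crossing it downwards. *)
Let J := {x : V + V * V | act x}.
Let cx (j : J) : R := match val j with
  | inl v => px (f v) | inr (a, b) => px (f b) + (ts - hv b) * sx b a end.
Let cy (j : J) : R := match val j with
  | inl v => py (f v) | inr (a, b) => py (f b) + (ts - hv b) * sy b a end.
Let up (j : J) (u1 u2 : R) : Prop := match val j with
  | inl v => exists w, [/\ adj v w, hv v < hv w, u1 = sx v w & u2 = sy v w]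
  | inr (a, b) => u1 = sx b a /\ u2 = sy b a end.
(* The slope [(0, 0)] at [v0] is that of the vertical ray. *)
Let lows (j : J) : seq (R * R) := match val j with
  | inl v => if v == v0 then [:: (0, 0)] else
      sort (fun p q => p.1 <= q.1) [seq (- sx v w, - sy v w) | w <- enum V & adj v w && (hv w <
          hv v)]
  | inr (a, b) => [:: (- sx b a, - sy b a)] end.
Let k j := size (lows j).
Let wx j n := (nth (0, 0) (lows j) n).1.
Let wy j n := (nth (0, 0) (lows j) n).2.
Let M : R := 1 + \sum_(vw : V * V) (`|sx vw.1 vw.2| + `|sy vw.1 vw.2|).

Let M0 : 0 < M.
Proof. by apply: ltr_wpDr => //; apply: sumr_ge0 => vw _; rewrite addr_ge0. Qed.

Let slopeM v w : `|sx v w| < M /\ `|sy v w| < M.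
Proof.
have := @le_sum_nonneg _ _ (fun vw : V * V => `|sx vw.1 vw.2| + `|sy vw.1 vw.2|) (v, w) (fun _
    => addr_ge0 (normr_ge0 _) (normr_ge0 _)).
by have := normr_ge0 (sx v w); have := normr_ge0 (sy v w); rewrite /M /= => *; split; lra.
Qed.

Let lowsP j uu : uu \in lows j -> [\/ val j = inl v0 /\ uu = (0, 0),
  (exists v w, [/\ val j = inl v, v != v0, adj v w, hv w < hv v & uu = (- sx v w, - sy v w)]) |
  exists a b, val j = inr (a, b) /\ uu = (- sx b a, - sy b a)].
Proof.
rewrite /lows; case: (val j) => [v|[a b]]; last first.
  by rewrite inE => /eqP->; constructor 3; exists a, b.
case: eqVneq => [->|vv]; first by rewrite inE => /eqP->; constructor 1.
rewrite mem_sort => /mapP[w]; rewrite mem_filter => /andP[/andP[vw hw] _] ->.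
by constructor 2; exists v, w.
Qed.

Let loM j n : (n < k j)%N -> `|wx j n| < M /\ `|wy j n| < M.
Proof.
move=> nk; have := mem_nth (0, 0) nk; rewrite /wx /wy; case: (nth _ _ _) => a b /lowsP[].
- by move=> [_ [-> ->]] /=; rewrite normr0.
- by move=> [v [w [_ _ _ _ [-> ->]]]] /=; rewrite !normrN.
- by move=> [v [w [_ [-> ->]]]] /=; rewrite !normrN.
Qed.

Let upM j u1 u2 : up j u1 u2 -> `|u1| < M /\ `|u2| < M.
Proof.
rewrite /up; case: (val j) => [v [w [_ _ -> ->]]|[a b] [-> ->]]; exact: slopeM.
Qed.

Let k0 j : (0 < k j)%N.
Proof.
rewrite /k /lows; case: (val j) => [v|[a b]//]; case: eqVneq => // vv.
have [w vw hw] := desc vv; rewrite size_sort size_map size_filter -has_count.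
by apply/hasP; exists w; rewrite ?mem_enum// vw.
Qed.

(** Sorting gives the weak inequality; [gen_x] makes it strict. *)
Let wlt j n : (n.+1 < k j)%N -> wx j n < wx j n.+1.
Proof.
rewrite /k /wx /lows; case: (val j) => [v|[a b]//]; case: eqVneq => // vv.
set s := [seq _ | _ <- _ & _]; move=> nk.
have so : sorted (fun p q : R * R => p.1 <= q.1) (sort (fun p q => p.1 <= q.1) s).
  by apply: sort_sorted => p q; exact: le_total.
have un : uniq (map fst (sort (fun p q : R * R => p.1 <= q.1) s)).
  rewrite (perm_uniq (perm_map fst (permEl (perm_sort _ s)))) -map_comp map_inj_in_uniq.
    by rewrite filter_uniq// enum_uniq.
  move=> w w'; rewrite !mem_filter /= => /andP[/andP[vw hw] _] /andP[/andP[vw' hw'] _] /oppr_inj e.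
  by apply/eqP/negPn/negP => ne; have := gen_x vw vw' hw hw' ne; rewrite e eqxx.
rewrite lt_neqAle; apply/andP; split; last exact: (sortedP (0, 0) so).
have nk1 := ltnW nk.
rewrite -(nth_map (0, 0) 0 fst nk1) -(nth_map (0, 0) 0 fst nk) nth_uniq ?size_map//.
by rewrite ltn_eqF.
Qed.

Let Z j : pt := mk (cx j) (cy j) ts.

Let Z_spec j : (exists2 v, val j = inl v & hv v = ts /\ Z j = f v) \/
  (exists a b, [/\ val j = inr (a, b), adj a b, hv b < ts, ts < hv a & on_segment (f b) (f a)
      (Z j)]).
Proof.
rewrite /Z /cx /cy; case: j => -[v|[a b]] /= h; [left; exists v => //|right; exists a, b].
  by move/eqP: h => h; split=> //; apply: pt_eq; rewrite ?px_mk ?py_mk ?ph_mk.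
move: h => /and3P[ab h1 h2]; split=> //; apply/on_edge; first exact: lt_trans h1 h2.
by rewrite px_mk py_mk ph_mk; split=> //; rewrite !ltW.
Qed.

(** A vertex on a crossing edge would be collinear with its endpoints. Two crossing edges can only
    meet in a common endpoint, and their endpoints are off the level. *)
Let Z_inj i j : cx i = cx j -> cy i = cy j -> i = j.
Proof.
have vtx v a b : adj a b -> hv b < ts -> ts < hv a -> hv v = ts ->
    on_segment (f b) (f a) (f v) -> False.
  move=> ab h1 h2 h3 [t [_ e]].
  have nba : b != a by apply: contraTneq (lt_trans h1 h2) => ->; rewrite ltxx.
  have nav : a != v by apply: contraTneq h2 => ->; rewrite h3 ltxx.
  have nbv : b != v by apply: contraTneq h1 => ->; rewrite h3 ltxx.
  apply: (proj1 (proj2 emb) b a v nba nav nbv); exists (1 - t), t, (- 1); split.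
    by rewrite !xpair_eqE oppr_eq0 oner_eq0 andbF.
  by split; [ring|rewrite scaleN1r e subrr].
move=> ex ey; have ZZ : Z i = Z j by rewrite /Z ex ey.
apply: val_inj; have [[v vi [hvi Zi]]|[a [b [vi ab h1 h2 Zi]]]] := Z_spec i;
  have [[w wj [hwj Zj]]|[c [d [wj cd h3 h4 Zj]]]] := Z_spec j.
- by rewrite vi wj; congr inl; apply: (proj1 emb); rewrite -Zi -Zj.
- by exfalso; rewrite -ZZ Zi in Zj; apply: vtx Zj.
- by exfalso; rewrite ZZ Zj in Zi; apply: vtx Zi.
- rewrite vi wj; have [e|ne] := eqVneq (a, b) (c, d); first by rewrite e.
  exfalso; rewrite -ZZ in Zj.
  have := proj2 (proj2 emb) a b c d ab cd _ (Z i) (on_segmentC Zi) (on_segmentC Zj).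
  case.
    move=> /orP[/andP[/eqP ac /eqP bd]|/andP[/eqP ac /eqP bd]]; first by rewrite ac bd eqxx in ne.
    by rewrite ac in h2; have := lt_trans h2 h3; rewrite ltxx.
  move=> v [vab [_ zv]].
  have hz : hv v = ts by rewrite /hv -zv ph_mk.
  by case/orP: vab => /eqP e; rewrite e in hz; rewrite hz ltxx in h1 h2.
Qed.

(** The width [e] depends on [ts] alone and not on [t1]; the infimum argument of [sweep] needs this
    order of quantifiers. *)
Lemma level_step (x0 : pt) : ts + 1 <= ph x0 -> exists2 e, 0 < e & forall t1,
  ts <= t1 -> t1 < ts + e -> LSfree (above graph_ray t1) x0 ->
  LSfree (above graph_ray (ts - e / 2)) x0.
Proof.
move=> x0h; have ts0' := ts0.
have [e1 e10 he1] : exists2 e, 0 < e & forall v, hv v != ts -> e <= `|hv v - ts|.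
  have [|e e0 he] := @pos_lower_bound R V (fun v => if hv v == ts then 1 else `|hv v - ts|).
    by move=> v; case: eqVneq => // n; rewrite normr_gt0 subr_eq0.
  by exists e => // v n; have := he v; rewrite (negbTE n).
have [r r0 hr] : exists2 r, 0 < r & forall i j : J, i != j ->
    2 * r <= Num.max `|cx i - cx j| `|cy i - cy j|.
  have [|r r0 hr] := @pos_lower_bound R (J * J)%type (fun ij => if ij.1 == ij.2 then 1 else
      Num.max `|cx ij.1 - cx ij.2| `|cy ij.1 - cy ij.2| / 2).
    move=> [i j] /=; case: eqVneq => // n; rewrite divr_gt0// lt_max !normr_gt0 !subr_eq0.
    rewrite -negb_and; apply: contra n => /andP[/eqP ex /eqP ey]; apply/eqP; exact: Z_inj.
  by exists r => // i j n; have := hr (i, j); rewrite /= (negbTE n) ler_pdivlMr// mulrC.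
have [dl dl0 hdl] : exists2 dl, 0 < dl & forall j n, (n.+1 < k j)%N -> wx j n + 2 * dl <= wx j n.+1.
  have [|d d0 hd] := @pos_lower_bound R (J * 'I_(\max_j k j).+1)%type (fun jn =>
      if (jn.2.+1 < k jn.1)%N then (wx jn.1 jn.2.+1 - wx jn.1 jn.2) / 2 else 1).
    by move=> [j n] /=; case: ifP => // /wlt h; rewrite divr_gt0// subr_gt0.
  exists d => // j n nk.
  have nb : (n < (\max_j k j).+1)%N.
    by apply: leq_trans (ltnW (ltnW nk)) _; apply: leq_trans (leq_bigmax j) _.
  by have := hd (j, Ordinal nb); rewrite /= nk; lra.
(* Respectively: no other vertex height within [eps], the base point above the slab, and strands of
   different centres far apart. *)
pose eps := Num.min e1 (Num.min 1 (r / (8 * M))).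
have eps0 : 0 < eps by rewrite !lt_min e10 ltr01 divr_gt0// mulr_gt0.
have ee1 : eps <= e1 by rewrite ge_min lexx.
have ee2 : eps <= 1 by rewrite !ge_min lexx orbT.
have ee3 : eps <= r / (8 * M) by rewrite !ge_min lexx !orbT.
have Mr : 4 * (M * eps) < r.
  have := ler_wpM2l (ltW M0) ee3; have -> : M * (r / (8 * M)) = r / 8 by field; rewrite gt_eqF.
  lra.
have gap v : hv v != ts -> hv v <= ts - eps \/ ts + eps <= hv v.
  move=> /he1 h; have [h'|h'] := leP 0 (hv v - ts); [right|left].
    by rewrite ger0_norm// in h; lra.
  by rewrite ltr0_norm// in h; lra.
have gap1 v : ts < hv v -> ts + eps <= hv v.
  by move=> h; have [|h'|//] := gap v; [rewrite gt_eqF|lra].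
have gap2 v : hv v < ts -> hv v <= ts - eps.
  by move=> h; have [|//|h'] := gap v; [rewrite lt_eqF|lra].
exists eps => // t1 h1 h2.
apply: (@LSfree_level R graph_ray ts eps r M dl J cx cy up k wx wy x0) => //.
- exact: open_not_graph_ray.
- move=> p /andP[p1 p2]; split.
    move=> [[[v e]|[v [w [vw s]]]]|[_ _ e]]; last lra.
      by rewrite e -/(hv v) in p1 p2; have := gap1 v p1; lra.
    have [a [b [ab hab /(on_edge _ hab)[/andP[q1 q2] ex ey]]]] := edge_up vw s.
    have ha : ts < hv a by lra.
    have [hb|hb|hb] := ltgtP (hv b) ts.
    + have ac : act (inr (a, b)) by rewrite /= ab hb.
      exists (exist _ (inr (a, b)) ac), (sx b a), (sy b a); split=> //=.
        by rewrite ex /cx /=; ring.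
      by rewrite ey /cy /=; ring.
    + by have := gap1 b hb; lra.
    + have ac : act (inl b) by rewrite /= hb.
      exists (exist _ (inl b) ac), (sx b a), (sy b a); rewrite /up /cx /cy /=; split.
      * by exists a; rewrite (proj1 sgr).
      * by rewrite ex hb.
      * by rewrite ey hb.
  move=> [[[v|[a b]] /= ac] [u1 [u2 [hu ex ey]]]]; left; rewrite /up /cx /cy /= in hu ex ey.
    have [w [vw hvw eu1 eu2]] := hu; move/eqP: ac => ac; rewrite ac in hvw.
    have := gap1 w hvw => g.
    apply: (@img_edge w v); first by rewrite (proj1 sgr).
    apply/on_edge; first by rewrite ac.
    by rewrite ac ex ey eu1 eu2; split=> //; apply/andP; split; lra.
  have [eu1 eu2] := hu; have /and3P[ab q1 q2] := ac.
  have := gap1 a q2 => g; apply: (img_edge ab); apply/on_edge; first exact: lt_trans q1 q2.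
  by rewrite ex ey eu1 eu2; split; [apply/andP; split; lra|ring|ring].
- move=> p pts; split.
    move=> [[[v e]|[v [w [vw s]]]]|[ex ey e]]; last first.
    + have ac : act (inl v0) by rewrite /=; apply/eqP; lra.
      by exists (exist _ (inl v0) ac); rewrite /cx /cy.
    + have [a [b [ab hab s']]] := edge_up vw s.
      have /(on_edge _ hab)[/andP[q1 q2] ex ey] := s'; rewrite pts in q1 q2 ex ey.
      have [hb|hb|hb] := ltgtP (hv b) ts; last first.
      * have ac : act (inl b) by rewrite /= hb.
        by exists (exist _ (inl b) ac); rewrite /cx /cy /= ex ey hb subrr !mul0r !addr0.
      * by lra.
      * have [ha|ha|ha] := ltgtP ts (hv a); last first.
        -- have ac : act (inl a) by rewrite /= ha.
           have d : hv a - hv b != 0 by rewrite subr_eq0 gt_eqF.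
           exists (exist _ (inl a) ac); rewrite /cx /cy /= ex ey ha /sx /sy.
           by rewrite !mulrA ![(hv a - hv b) * _]mulrC !mulfK//; split; ring.
        -- by lra.
        -- have ac : act (inr (a, b)) by rewrite /= ab hb.
           by exists (exist _ (inr (a, b)) ac).
    + have ac : act (inl v) by rewrite /=; rewrite e in pts; apply/eqP.
      by exists (exist _ (inl v) ac); rewrite e.
  move=> [[[v|[a b]] /= ac] [ex ey]]; left; rewrite /cx /cy /= in ex ey.
    by left; exists v; apply: pt_eq => //; rewrite pts; apply/esym/eqP.
  have /and3P[ab q1 q2] := ac; apply: (img_edge ab); apply/on_edge; first exact: lt_trans q1 q2.
  by rewrite pts; split=> //; rewrite !ltW.
- move=> p /andP[p1 p2]; split.
    move=> [[[v e]|[v [w [vw s]]]]|[ex ey e]]; last first.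
    + have h0 : hv v0 = ts.
        apply/eqP; rewrite eq_le ts0 /= leNgt; apply/negP => /gap2; lra.
      have ac : act (inl v0) by rewrite /= h0.
      exists (exist _ (inl v0) ac), 0%N.
      by rewrite /k /wx /wy /cx /cy /lows /= eqxx /= ex ey !mulr0 !addr0.
    + have [a [b [ab hab s']]] := edge_up vw s.
      have /(on_edge _ hab)[/andP[q1 q2] ex ey] := s'.
      have hb : hv b < ts by lra.
      have [ha|ha|ha] := ltgtP ts (hv a); last first.
      * have ac : act (inl a) by rewrite /= ha.
        have av : a != v0 by apply: contraTneq hab => ->; rewrite -leNgt v0_le.
        pose j : J := exist _ (inl a) ac.
        have hin : (- sx a b, - sy a b) \in lows j.
          rewrite /lows /= (negbTE av) mem_sort; apply/mapP; exists b => //.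
          by rewrite mem_filter ab hab mem_enum.
        exists j, (index (- sx a b, - sy a b) (lows j)).
        rewrite /k index_mem hin /wx /wy nth_index// /cx /cy /=; split=> //.
          by rewrite ex sxC /sx ha; field; rewrite subr_eq0 lt_eqF.
        by rewrite ey syC /sy ha; field; rewrite subr_eq0 lt_eqF.
      * by have := gap2 a ha; lra.
      * have ac : act (inr (a, b)) by rewrite /= ab hb.
        exists (exist _ (inr (a, b)) ac), 0%N; rewrite /k /wx /wy /cx /cy /=; split=> //.
          by rewrite ex; ring.
        by rewrite ey; ring.
    + by rewrite e -/(hv v) in p1 p2; have := gap2 v p2; lra.
  move=> [j [n [nk ex ey]]]; have := mem_nth (0, 0) nk; move: ex ey; rewrite /wx /wy.
  have jP : act (val j) := valP j.
  move=> ex ey /lowsP[[vj e]|[v [w [vj vv vw hw e]]]|[a [b [vj e]]]];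
      rewrite /cx /cy vj e /= in ex ey;
    rewrite vj /= in jP.
  + by right; rewrite !mulr0 !addr0 in ex ey; rewrite (eqP jP); split=> //; lra.
  + left; have hvs := eqP jP; have := gap2 w; rewrite -{1}hvs => /(_ hw) g.
    apply: (@img_edge v w) => //; apply/on_edge => //.
    have d : hv v - hv w != 0 by rewrite subr_eq0 gt_eqF.
    split; first by apply/andP; split; lra.
      by rewrite ex -hvs sxC /sx; field.
    by rewrite ey -hvs syC /sy; field.
  + left; have /and3P[ab q1 q2] := jP; have := gap2 b q1 => g.
    apply: (img_edge ab); apply/on_edge; first exact: lt_trans q1 q2.
    by rewrite ex ey; split; [apply/andP; split; lra|ring|ring].
- by apply: le_trans x0h; lra.
Qed.

End AtLevel.

(** * The global sweep and the removal of the ray *)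

Let in_image_bounds p : image_graph adj f p -> [/\ hv v0 <= ph p,
  ph p < 1 + \sum_v `|hv v|,
  `|px p - px (f v0)| < 1 + \sum_v (`|px (f v) - px (f v0)| + `|py (f v) - py (f v0)|) &
  `|py p - py (f v0)| < 1 + \sum_v (`|px (f v) - px (f v0)| + `|py (f v) - py (f v0)|)].
Proof.
set T := \sum_v `|hv v|; set B := \sum_v _.
have hT v : hv v <= T.
  apply: le_trans (ler_norm _) _; exact: (@le_sum_nonneg _ _ (fun v => `|hv v|)).
have hB v : `|px (f v) - px (f v0)| <= B /\ `|py (f v) - py (f v0)| <= B.
  have := @le_sum_nonneg _ _ (fun v => `|px (f v) - px (f v0)| + `|py (f v) - py (f v0)|) v
    (fun _ => addr_ge0 (normr_ge0 _) (normr_ge0 _)).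
  rewrite -/B; have := normr_ge0 (px (f v) - px (f v0)); have := normr_ge0 (py (f v) - py (f v0)).
  by move=> *; split; lra.
have conv (t x y c b : R) : unit_I t -> `|x - c| <= b -> `|y - c| <= b ->
    `|(1 - t) * x + t * y - c| <= b.
  move=> /andP[t0 t1]; rewrite !ler_norml => /andP[? ?] /andP[? ?]; apply/andP; split; nra.
move=> [[v ->]|[v [w [_ [t [tI]]]]]].
  by have [h1 h2] := hB v; split; [exact: v0_le|have := hT v; rewrite /hv; lra|lra|lra].
rewrite -/(seg _ _ _) => ->; rewrite px_seg py_seg ph_seg.
have [h1 h2] := hB v; have [h3 h4] := hB w.
have := conv _ _ _ _ _ tI h1 h3; have := conv _ _ _ _ _ tI h2 h4 => h5 h6.
have /andP[t0 t1] := tI; have := v0_le v; have := v0_le w; have := hT v; have := hT w.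
by rewrite /hv => *; split; [nra|nra|lra|lra].
Qed.

Let T : R := 1 + \sum_v `|hv v|.
Let Bd : R := 1 + \sum_v (`|px (f v) - px (f v0)| + `|py (f v) - py (f v0)|).

Let T_high p : T <= ph p -> ~ graph_ray p.
Proof.
move=> hp [/in_image_bounds[]|[_ _ h]]; first by rewrite -/T; lra.
have : `|hv v0| <= \sum_v `|hv v| by exact: (@le_sum_nonneg _ _ (fun v => `|hv v|)).
by have := ler_norm (hv v0); rewrite /T in hp; lra.
Qed.

Let x0 : pt := mk 0 0 (T + 2).

(** Otherwise the infimum of the good levels is at least the height of [v0]. Some good level lies
    within the width of the level step above this infimum, and the step then produces a good level
    below it. *)
Let sweep : exists2 t, t < hv v0 & LSfree (above graph_ray t) x0.
Proof.
apply: contrapT => no.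
pose S : set R := [set t | t <= T /\ LSfree (above graph_ray t) x0].
have lS : lbound S (hv v0).
  by move=> t [_ ft]; rewrite leNgt; apply/negP => tv; apply: no; exists t.
have ST : S T.
  split=> //; apply: LSfree_ext (_ : LSfree (fun p => 0 < ph p - T) x0).
    move=> p; rewrite subr_gt0; split=> [h|[]//]; split=> //; exact/T_high/ltW.
  apply: LSfree_convex; last by rewrite ph_mk; lra.
  move=> p q t hp hq /andP[t0 t1]; rewrite ph_seg.
  have [t2|t2] := leP t (1 / 2); nra.
have hS : has_inf S by split; [exists T|exists (hv v0)].
pose ts := inf S.
have ts0 : hv v0 <= ts by apply: lb_le_inf => //; exists T.
have tsT : ts <= T by apply: ge_inf ST; case: hS.
have x0h : ts + 1 <= ph x0 by rewrite ph_mk; lra.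
have [e e0 he] := level_step ts0 x0h.
have [t1 [t1T ft1] t1e] := inf_adherent e0 hS.
have t1s : ts <= t1 by apply: ge_inf; [case: hS|].
have : ts <= ts - e / 2.
  by apply: ge_inf; [case: hS|split; [lra|exact: he ft1]].
by lra.
Qed.

Let c1 := px (f v0).
Let c2 := py (f v0).

Let off (p : pt) : R := Num.max `|px p - c1| `|py p - c2|.

Let ray_off p : ph p < hv v0 -> graph_ray p <-> off p = 0.
Proof.
move=> hp; split=> [[/in_image_bounds[]|[e1 e2 _]]|]; first by lra.
  by rewrite /off e1 e2 !subrr normr0 maxxx.
move=> e; have : off p <= 0 by rewrite e.
rewrite /off ge_max !normr_le0 !subr_eq0 => /andP[/eqP e1 /eqP e2].
by right; split=> //; apply: ltW.
Qed.

Let off_ge0 p : 0 <= off p. Proof. by rewrite le_max normr_ge0. Qed.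

(* Slide a point under v0 outwards beyond the graph, then up above it, then to x0. *)
Let slide (u : R) (p : pt) : pt :=
  let m := 1 + clamp (3 * u) * (Bd / off p) in
  seg (mk (c1 + (px p - c1) * m) (c2 + (py p - c2) * m)
    (ph p + clamp (3 * u - 1) * (T + 1 + `|ph p|))) x0 (clamp (3 * u - 2)).

(** Adding the open half-space below [v0] fills in the ray. It meets [above graph_ray t] in a slab
    minus the ray. This slab is connected, so it adds no generator; its loops contract in
    [above graph_ray t] by [slide], so it imposes no relation either. *)
Lemma LSfree_not_graph : LSfree (fun p => ~ image_graph adj f p) x0.
Proof.
have [t tv ft] := sweep.
pose A := above graph_ray t; pose B : region := fun p => 0 < hv v0 - ph p.
have AB p : A p /\ B p <-> [/\ t < ph p, ph p < hv v0 & 0 < off p].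
  rewrite /A /B /above subr_gt0; split.
    by move=> [[h1 h2] h3]; split=> //; rewrite lt_neqAle off_ge0 andbT eq_sym;
        apply/eqP => /(ray_off h3).
  by move=> [h1 h2 h3]; split=> //; split=> // /(ray_off h2) e; rewrite e ltxx in h3.
apply: (@LSfree_ext _ (fun p => A p \/ B p)).
  move=> p; split.
    move=> [[_ h] i|h /in_image_bounds[h' _ _ _]]; first by apply: h; left.
    by rewrite /B in h; lra.
  move=> h; have [hp|hp] := leP (hv v0) (ph p); last by right; rewrite /B; lra.
  have [r|nr] := pselect (graph_ray p); last by left; split=> //; lra.
  case: r => [//|[e1 e2 e3]]; exfalso; apply: h; left; exists v0.
  by apply: pt_eq => //; rewrite -/(hv v0); lra.
have Bd0 : 0 < Bd.
  by apply: ltr_wpDr => //; apply: sumr_ge0 => v _; rewrite addr_ge0.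
have T0 : 0 < T by apply: ltr_wpDr => //; apply: sumr_ge0 => v _; rewrite normr_ge0.
pose C (o : option void) : region := fun p => A p /\ B p.
pose b (o : option void) : pt := mk (c1 + 1) c2 ((t + hv v0) / 2).
have Cp x y h : t < h -> h < hv v0 -> (x != 0) || (y != 0) ->
    A (mk (c1 + x) (c2 + y) h) /\ B (mk (c1 + x) (c2 + y) h).
  move=> h1 h2 xy; apply/AB; rewrite ph_mk; split=> //.
  by rewrite /off px_mk py_mk ![_ + _ - _]addrAC !subrr !add0r lt_max !normr_gt0.
apply: (@LSfree_union R A B x0 void C b (fun=> x0) (fun _ => slide)) => //.
- apply: open_and; last exact: open_not_graph_ray.
  apply: (@open_ext _ (fun p => 0 < ph p - t)); first by move=> p; rewrite subr_gt0.
  by apply: open_pos => x; have hh := @cth_ x; ctt.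
- by apply: open_pos => x; have hh := @cth_ x; ctt.
- move=> p q s hp hq /andP[s0 s1]; rewrite /B ph_seg in hp hq *.
  have [s2|s2] := leP s (1 / 2); nra.
- move=> k; have := @Cp 1 0 ((t + hv v0) / 2); rewrite addr0; apply; rewrite ?oner_neq0//; lra.
- by move=> k y [].
- by move=> k y [].
- by move=> y Ay By; exists None.
- by move=> [[]|] [[]|].
- move=> k y Cy; have /AB[y1 y2 y3] := Cy.
  pose a := px y - c1; pose a' := py y - c2.
  have yE : y = mk (c1 + a) (c2 + a') (ph y) by rewrite -{1}(mkE y) /a /a'; congr mk; ring.
  have aa : (a != 0) || (a' != 0) by move: y3; rewrite /off lt_max !normr_gt0.
  have ps u1 v1 h1 u2 v2 h2 : t < h1 < hv v0 -> t < h2 < hv v0 ->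
      (forall s, unit_I s -> ((1 - s) * u1 + s * u2 != 0) || ((1 - s) * v1 + s * v2 != 0)) ->
      pth (C k) (seg (mk (c1 + u1) (c2 + v1) h1) (mk (c1 + u2) (c2 + v2) h2)).
    move=> /andP[q1 q2] /andP[q3 q4] hs; split=> [|s sI]; first exact: contI_seg.
    have -> : seg (mk (c1 + u1) (c2 + v1) h1) (mk (c1 + u2) (c2 + v2) h2) s =
        mk (c1 + ((1 - s) * u1 + s * u2)) (c2 + ((1 - s) * v1 + s * v2)) ((1 - s) * h1 + s * h2).
      by apply: pt_eq; rewrite ?px_seg ?py_seg ?ph_seg ?px_mk ?py_mk ?ph_mk; ring.
    have /andP[s0 s1] := sI.
    by apply: Cp; [have := convex_comb_lt sI (_ : - h1 < - t) (_ : - h2 < - t);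
        rewrite !ltrN2 => /(_ q1 q3); lra|exact: convex_comb_lt|exact: hs].
  have bE : b k = mk (c1 + 1) (c2 + 0) ((t + hv v0) / 2) by rewrite addr0.
  have hm : t < (t + hv v0) / 2 < hv v0 by apply/andP; split; lra.
  have hy : t < ph y < hv v0 by rewrite y1 y2.
  (* Only when [y] is on the opposite side of the ray from [b k] does the straight segment meet the
     ray; then the path goes round through [m]. *)
  have [bad|ok] := boolP ((a' == 0) && (a < 0)).
    have /andP[/eqP a0 an] := bad.
    pose m := mk (c1 + 0) (c2 + 1) ((t + hv v0) / 2).
    exists (concat (seg (b k) m) (seg m y)); rewrite concat0 concat1 seg0 seg1; split=> //.
    apply: pth_concat; rewrite ?seg0 ?seg1//.
      rewrite bE; apply: ps => // s _; have [->|s0] := eqVneq s 0;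
          first by rewrite subr0 !mul1r !mul0r !addr0 oner_neq0.
      by rewrite !mulr0 !mulr1 add0r s0 orbT.
    rewrite yE; apply: ps => // s _; have [->|s0] := eqVneq s 0;
        first by rewrite subr0 !mul1r !mul0r !addr0 oner_neq0 orbT.
    by rewrite mulr0 add0r mulf_neq0// lt_eqF.
  exists (seg (b k) y); rewrite seg0 seg1; split=> //; rewrite yE bE;
      apply: ps => // s /andP[s0 s1].
  rewrite mulr0 mulr1 add0r; have [->|sn] := eqVneq s 0;
      first by rewrite subr0 mul0r addr0 oner_neq0.
  have [a0|a0] := eqVneq a' 0; last by rewrite mulf_neq0 ?orbT.
  rewrite a0 eqxx /= -leNgt in ok; rewrite a0 eqxx orbF in aa.
  have ap : 0 < a by rewrite lt_neqAle eq_sym aa.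
  have sp : 0 < s by rewrite lt_neqAle eq_sym sn.
  by apply/orP; left; apply: lt0r_neq0; have := mulr_gt0 sp ap; lra.
- by move=> k y z _ /(_ 1 (unit_I1 _)); rewrite seg1.
- move=> k W z u F hu hF _ /AB[_ _ o0].
  have hx : ct z (fun w => px (F w)) by apply: hF.
  have hy : ct z (fun w => py (F w)) by apply: hF.
  have hh : ct z (fun w => ph (F w)) by apply: hF.
  have ho : ct z (fun w => (off (F w))^-1).
    by apply: ctV; [exact: lt0r_neq0|rewrite /off; ctt].
  have hc (d : R) : ct z (fun w => clamp (3 * u w - d)) by apply: ct_clamp; ctt.
  have hc0 : ct z (fun w => clamp (3 * u w)) by apply: ct_clamp; ctt.
  have h1 := hc 1; have h2 := hc 2.
  by apply: ctp_seg => //; [apply: ctp_mk; ctt|exact: ctp_cst].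
- move=> k y _; rewrite /slide mulr0 !clamp0 ?seg0; [|lra..].
  by rewrite !mul0r !addr0 !mulr1; apply: pt_eq; rewrite ?px_mk ?py_mk ?ph_mk; ring.
- by move=> k y _; rewrite /slide mulr1 (@clamp1 _ (3 - 2)) ?seg1//; lra.
- move=> k u y /andP[u0 u1] Cy; have /AB[y1 y2 y3] := Cy; rewrite /slide.
  have tT : t < T.
    have : `|hv v0| <= \sum_v `|hv v| by exact: (@le_sum_nonneg _ _ (fun v => `|hv v|)).
    by have := ler_norm (hv v0); rewrite /T; lra.
  have q0 : 0 <= Bd / off y by rewrite divr_ge0// ltW.
  have /andP[m0 m1] := clampI (3 * u).
  set m := 1 + _; have mp : 0 < m by rewrite /m; have := mulr_ge0 m0 q0; lra.
  have offm h : off (mk (c1 + (px y - c1) * m) (c2 + (py y - c2) * m) h) = off y * m.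
    rewrite /off px_mk py_mk ![_ + _ * _ - _]addrAC !subrr !add0r !normrM (gtr0_norm mp).
    by rewrite -maxr_pMl// ltW.
  have om : 0 < off y * m by rewrite mulr_gt0.
  have [u3|u3] := leP (3 * u) 1.
    rewrite !(@clamp0 _ (3 * u - _)) ?seg0 ?mul0r ?addr0; [|lra..].
    by apply: (proj1 (proj2 (AB _) _)); rewrite ph_mk offm.
  have mE : m = 1 + Bd / off y by rewrite /m clamp1 ?mul1r// ltW.
  have K0 : 0 <= ph y + `|ph y| by have := ler_norm (- ph y); rewrite normrN; lra.
  have /andP[n0 n1] := clampI (3 * u - 1).
  have [u4|u4] := leP (3 * u) 2.
    rewrite (@clamp0 _ (3 * u - 2)) ?seg0; last lra.
    set h := ph y + _.
    have hy : ph y <= h by rewrite lerDl mulr_ge0//; have := normr_ge0 (ph y); lra.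
    split; first by rewrite ph_mk; lra.
    (* The outward slide has increased the horizontal distance by [Bd], so the vertical move misses
       the graph and the ray. *)
    have oB : off y * m = off y + Bd by rewrite mE mulrDr mulr1 mulrCA mulfV ?mulr1// gt_eqF.
    move=> [/in_image_bounds[_ _ b1 b2]|[b1 b2 _]].
      have : off (mk (c1 + (px y - c1) * m) (c2 + (py y - c2) * m) h) < Bd by rewrite gt_max b1.
      by rewrite offm oB; lra.
    have : off (mk (c1 + (px y - c1) * m) (c2 + (py y - c2) * m) h) = 0.
      by rewrite /off b1 b2 !subrr normr0 maxxx.
    by rewrite offm; lra.
  have n1' : clamp (3 * u - 1) = 1 by apply: clamp1; lra.
  have /andP[w0 w1] := clampI (3 * u - 2).
  rewrite n1' mul1r; set P := seg _ _ _.
  have hP : T <= ph P.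
    rewrite /P ph_seg !ph_mk; move: (clamp _) w0 w1 => w w0 w1.
    have : 0 <= (1 - w) * (ph y + `|ph y|) by apply: mulr_ge0; lra.
    by nra.
  by split; [lra|exact: T_high].
Qed.

End Core.

(** * Linear change of coordinates *)

Section LinearChange.
Variable R : realType.
Notation pt := (Defs.point R).
Notation region := (pt -> Prop).

(* The moment curve meets each of finitely many given planes finitely often. *)
Lemma moment_generic (T : finType) (u : T -> pt) : exists s : R,
  forall i, u i != 0 -> (ph (u i) * s + py (u i)) * s + px (u i) != 0.
Proof.
pose Q i : {poly R} := Poly [:: px (u i); py (u i); ph (u i)].
pose P := \prod_(i | u i != 0) Q i.
have P0 : P != 0.
  apply/prodf_neq0 => i ui; apply: contraNneq ui => e; apply/eqP.
  have c n : [:: px (u i); py (u i); ph (u i)]`_n = 0 by rewrite -coef_Poly -/(Q i) e coef0.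
  have := c 0%N; have := c 1%N; have := c 2%N => /= e2 e1 e0.
  by apply: pt_eq; rewrite ?e0 ?e1 ?e2 /px /py /ph mxE.
have [s hs] : exists s : R, P.[s] != 0.
  apply: contrapT => /forallNP h.
  have := @max_poly_roots _ P [seq n%:R | n <- iota 0 (size P)] P0.
  rewrite size_map size_iota ltnn => H; apply: notF; apply: H.
    by apply/allP => x _; apply/negPn/negP => /h.
  by rewrite map_inj_uniq ?iota_uniq// => a b /eqP; rewrite eqr_nat => /eqP.
exists s => i ui; apply: contraNneq hs => e.
rewrite /P (bigD1 i)//= hornerM; suff -> : (Q i).[s] = 0 by rewrite mul0r.
by rewrite horner_Poly /= mul0r add0r.
Qed.

Lemma dotE (u v : pt) : dot u v = px u * px v + py u * py v + ph u * ph v.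
Proof.
rewrite /dot !big_ord_recr big_ord0 /= add0r /px /py /ph.
by congr (_ * _ + _ * _ + _ * _); congr (_ _ _); apply: val_inj.
Qed.

Lemma pxD (p q : pt) : px (p + q) = px p + px q. Proof. by rewrite /px mxE. Qed.
Lemma pyD (p q : pt) : py (p + q) = py p + py q. Proof. by rewrite /py mxE. Qed.
Lemma phD (p q : pt) : ph (p + q) = ph p + ph q. Proof. by rewrite /ph mxE. Qed.
Lemma pxZ a (p : pt) : px (a *: p) = a * px p. Proof. by rewrite /px mxE. Qed.
Lemma pyZ a (p : pt) : py (a *: p) = a * py p. Proof. by rewrite /py mxE. Qed.
Lemma phZ a (p : pt) : ph (a *: p) = a * ph p. Proof. by rewrite /ph mxE. Qed.
Lemma pxN (p : pt) : px (- p) = - px p. Proof. by rewrite /px mxE. Qed.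
Lemma pyN (p : pt) : py (- p) = - py p. Proof. by rewrite /py mxE. Qed.
Lemma phN (p : pt) : ph (- p) = - ph p. Proof. by rewrite /ph mxE. Qed.
Definition pE := (px_mk, py_mk, ph_mk, pxD, pyD, phD, pxZ, pyZ, phZ, pxN, pyN, phN).

Definition cross (a b : pt) : pt := mk (py a * ph b - ph a * py b)
  (ph a * px b - px a * ph b) (px a * py b - py a * px b).

Variables (l m : pt).
(** The new axes are [m], [n] and [l], so that height is measured along [l] and the first coordinate
    along the generic [m]. The inverse [uncoords] uses the reciprocal basis, with determinant
    [dt]. *)
Let n := cross l m.
Let dt := dot m (cross n l).

Definition coords (p : pt) : pt := mk (dot m p) (dot n p) (dot l p).
Definition uncoords (q : pt) : pt :=
  (px q / dt) *: cross n l + (py q / dt) *: cross l m + (ph q / dt) *: cross m n.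

Hypothesis dt0 : dt != 0.

Lemma coordsK p : uncoords (coords p) = p.
Proof.
move: dt0; rewrite /uncoords /coords /dt /n => d0.
by apply: pt_eq; rewrite !pE !dotE !pE; field; move: d0; rewrite !dotE !pE.
Qed.

Lemma uncoordsK q : coords (uncoords q) = q.
Proof.
move: dt0; rewrite /uncoords /coords /dt /n => d0.
by apply: pt_eq; rewrite !pE !dotE !pE; field; move: d0; rewrite !dotE !pE.
Qed.

Lemma coordsD p q : coords (p + q) = coords p + coords q.
Proof. by apply: pt_eq; rewrite !pE !dotE !pE; ring. Qed.

Lemma coordsZ a p : coords (a *: p) = a *: coords p.
Proof. by apply: pt_eq; rewrite !pE !dotE !pE; ring. Qed.

Lemma on_segment_coords p q x :
  on_segment (coords p) (coords q) (coords x) <-> on_segment p q x.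
Proof.
split=> -[t [tI e]]; exists t; split=> //; last by rewrite e coordsD !coordsZ.
by apply: (can_inj coordsK); rewrite coordsD !coordsZ.
Qed.

Lemma image_graph_coords (V : finType) (adj : rel V) (f : V -> pt) x :
  image_graph adj (fun v => coords (f v)) (coords x) <-> image_graph adj f x.
Proof.
split=> -[[v e]|[v [w [vw s]]]].
- by left; exists v; apply: (can_inj coordsK).
- by right; exists v, w; split=> //; apply/on_segment_coords.
- by left; exists v; rewrite e.
- by right; exists v, w; split=> //; apply/on_segment_coords.
Qed.

Lemma linear_embedding_coords (V : finType) (adj : rel V) (f : V -> pt) :
  linear_embedding adj f -> linear_embedding adj (fun v => coords (f v)).
Proof.
move=> [inj [gp seg]]; split; [|split].
- by move=> v w /(can_inj coordsK)/inj.
- move=> u v w uv vw uw [a [b [c [nz [s e]]]]]; apply: (gp u v w) => //.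
  exists a, b, c; split=> //; split=> //; apply: (can_inj coordsK).
  rewrite !coordsD !coordsZ e; apply: pt_eq; rewrite !pE !dotE /px /py /ph !mxE; ring.
- move=> a b c d ab cd ne x; rewrite -(uncoordsK x).
  move=> /on_segment_coords s1 /on_segment_coords s2.
  by have [v [h1 [h2 e]]] := seg a b c d ab cd ne _ s1 s2; exists v; rewrite e.
Qed.

Lemma cth_coords X : cth X (fun _ : R => coords).
Proof.
move=> T z u F _ hF _ _.
have hx : ct z (fun w => px (F w)) by apply: hF.
have hy : ct z (fun w => py (F w)) by apply: hF.
have hh : ct z (fun w => ph (F w)) by apply: hF.
have hd a : ct z (fun w => dot a (F w)).
  by apply: (@ct_ext _ _ _ _ _ (fun w => esym (dotE a (F w)))); ctt.
by apply: ctp_mk.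
Qed.

Lemma cth_uncoords X : cth X (fun _ : R => uncoords).
Proof.
move=> T z u F _ hF _ _.
have hx : ct z (fun w => px (F w)) by apply: hF.
have hy : ct z (fun w => py (F w)) by apply: hF.
have hh : ct z (fun w => ph (F w)) by apply: hF.
by apply: ctpD; [apply: ctpD|]; (apply: ctpZ; [ctt|exact: ctp_cst]).
Qed.

End LinearChange.

Theorem theorem1 (R : realType) (V : finType) (adj : rel V) (f : V -> point R) :
  simple_graph adj -> linear_embedding adj f -> has_descending_direction adj f ->
  free_embedding adj f.
Proof.
move=> sg emb [l [[l1 gl] [v0 [nd0 desc]]]] x0 nx0.
pose h v := dot l (f v).
have dotB (u v w : point R) : dot u (v - w) = dot u v - dot u w by rewrite !dotE !pE; ring.
have dotZ (u : point R) a (v : point R) : dot u (a *: v) = a * dot u v by rewrite !dotE !pE; ring.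
have GvE v w : dot l (Gvector f v w) = h w - h v by rewrite /Gvector dotB.
pose sl v w : point R := (h w - h v)^-1 *: (f w - f v).
(* The vectors to which [m] must not be orthogonal. With edges rescaled to height 1, the differences
   [sl v w - sl v w'] give distinct first slopes at a vertex; the vector for [None] serves the
   independence of [l] and [m]. *)
pose fam (i : option (V * V * V)) : point R :=
  if i is Some (v, w, w') then sl v w - sl v w' else mk (- py l) (px l) 0.
have [s hs] := moment_generic fam.
pose m : point R := mk 1 s (s ^+ 2).
have dm u : (ph u * s + py u) * s + px u = dot m u by rewrite dotE !pE; ring.
(* The determinant is the squared length of [cross l m]. The third coordinate of this vector is
   [dot m (fam None)]; if [fam None] vanishes, then [l] is vertical and the second coordinate is
   [ph l], which is nonzero. *)
have dt0 : dot m (cross (cross l m) l) != 0.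
  have -> : dot m (cross (cross l m) l) = dot (cross l m) (cross l m) by rewrite !dotE !pE; ring.
  have z : dot (cross l m) (cross l m) = 0 -> py (cross l m) = 0 /\ ph (cross l m) = 0.
    rewrite dotE => e; split; apply/eqP; rewrite -sqrf_eq0; apply/eqP; nra.
  apply/eqP => /z[]; rewrite !pE => e1 e2.
  have := hs None; rewrite dm.
  have [u0 _|u0 /(_ isT) /eqP] := eqVneq (fam None) 0; last first.
    by apply; rewrite dotE !pE; lra.
  have := congr1 (fun p => px p) u0; have := congr1 (fun p => py p) u0; rewrite /= !pE.
  have -> : py (0 : point R) = 0 by rewrite /py mxE.
  have -> : px (0 : point R) = 0 by rewrite /px mxE.
  move=> lx ly; move: l1; rewrite dotE lx; have -> : py l = 0 by lra.
  have -> : ph l = 0 by rewrite lx in e1; lra.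
  by rewrite !mul0r !addr0 => /eqP; rewrite eq_sym oner_eq0.
have phc v : ph (coords l m (f v)) = h v by rewrite ph_mk.
have ne v w : adj v w -> h w - h v != 0 by move=> vw; rewrite -GvE; apply: (proj2 (conj l1 gl)).
have adj_ne v w : adj v w -> v != w by apply: contraTneq => ->; rewrite (proj2 sg).
have slx v w : px (coords l m (f w)) - px (coords l m (f v)) = (h w - h v) * dot m (sl v w) \/
    h w - h v = 0.
  have [->|d] := eqVneq (h w - h v) 0; [by right|left].
  by rewrite !px_mk /sl dotZ dotB mulVKf.
have gx v w w' : adj v w -> adj v w' -> w != w' -> dot m (sl v w) != dot m (sl v w').
  move=> vw vw' ww; rewrite -subr_eq0 -dotB -dm; apply: (hs (Some (v, w, w'))) => /=.
  apply/eqP => /subr0_eq e.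
  apply: (proj1 (proj2 emb) v w w'); rewrite ?(adj_ne _ _ vw) ?(adj_ne _ _ vw')//.
  (* Equal rescaled edge vectors are an affine dependence of [f v], [f w] and [f w'], which general
     position forbids. *)
  exists ((h w' - h v)^-1 - (h w - h v)^-1), (h w - h v)^-1, (- (h w' - h v)^-1); split.
    by rewrite !xpair_eqE invr_eq0 (negbTE (ne _ _ vw)) andbF.
  split; first by ring.
  move: e; rewrite /sl !scalerBr scalerBl scaleNr => e.
  have {}e : (h w - h v)^-1 *: f w = (h w' - h v)^-1 *: f w' - (h w' - h v)^-1 *: f v + (h w -
      h v)^-1 *: f v.
    by rewrite -e subrK.
  by rewrite e; apply/rowP => i; rewrite !mxE; ring.
pose b0 : point R := mk 0 0 (1 + \sum_v `|ph (coords l m (f v))| + 2).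
have LF : LSfree (fun p => ~ image_graph adj (fun v => coords l m (f v)) p) b0.
  apply: (@LSfree_not_graph R V adj (fun v => coords l m (f v)) v0) => //.
  - exact: linear_embedding_coords.
  - by move=> v w /ne; rewrite !phc subr_eq0 eq_sym.
  - by move=> v /desc[w [vw]]; rewrite GvE subr_lt0 => hw; exists w; rewrite ?phc.
  - move=> v w w' vw vw' _ _ ww; rewrite !phc.
    have nz := ne _ _ vw; have nz' := ne _ _ vw'.
    have [->|e] := slx v w; last by rewrite e eqxx in nz.
    have [->|e] := slx v w'; last by rewrite e eqxx in nz'.
    by rewrite ![(_ - _) * dot _ _]mulrC !mulfK//; apply: gx.
have oX := @open_not_graph R V adj f.
apply: (LSfree_pi1_free oX); apply: (@LSfree_base _ _ (uncoords l m b0)) => //.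
apply: (@LSfree_homeo R (fun x => ~ image_graph adj f x) _ (coords l m) (uncoords l m));
    last exact: LF.
- exact: cth_coords.
- exact: cth_uncoords.
- by move=> x nx /(image_graph_coords dt0).
- by move=> y ny hy; apply: ny; rewrite -(uncoordsK dt0 y); apply/(image_graph_coords dt0).
- by move=> x _; apply: coordsK.
- by move=> y _; apply: uncoordsK.
Qed.
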